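(* Let $\ell_p^*=\frac{n-p}{p-1}$. Assume that there are constants $A,B>0$, $\ell$ with $\ell_p^*\le \ell\le\frac{n}{p-1}$, and a function $h$ such that $\mathcal{K}(r)=A+Br^{\ell}+h(r)$ and $\lim_{r\to 0}\frac{|h(r)|+r|h'(r)|}{r^{\ell}}=0$. Assume further that at least one of the following holds: (a) the function $t\mapsto\mathcal{K}(e^t)$ is uniformly continuous in $[0,+\infty)$ and there are $\overline{K}>\underline{K}>0$ such that $\underline{K}<\mathcal{K}(r)<\overline{K}$ for any $r>0$; (b) there is $\rho_1>0$ such that $\mathcal{K}(r)\ge\mathcal{K}(\rho_1)$ for all $r\ge\rho_1$. For $\mathcal{R}>0$ consider the problem $$\Delta_p u(x)+\mathcal{K}(|x|)\,u(x)|u(x)|^{q-2}=0,\quad u(x)>0 \text{ for } |x|<\mathcal{R},\quad u(x)=0 \text{ for } |x|=\mathcal{R}.\qquad (P_{\mathcal{R}})$$ (i) If $\ell=\ell_p^*$, then there exists $\mathcal{R}_0>0$ such that $(P_{\mathcal{R}})$ does not admit any radial solution when $\mathcal{R}<\mathcal{R}_0$, and admits at least one radial solution when $\mathcal{R}>\mathcal{R}_0$. (ii) If $\ell>\ell_p^*$, then there exists $\mathcal{R}_0>0$ such that $(P_{\mathcal{R}})$ does not admit any radial solution when $\mathcal{R}<\mathcal{R}_0$, admits at least one radial solution when $\mathcal{R}=\mathcal{R}_0$, and admits at least two radial solutions when $\mathcal{R}>\mathcal{R}_0$.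
   Context: Standing assumptions: $n$ is a positive integer (the space dimension, $x\in\mathbb{R}^n$), $p$ is real with $1<p<n$ and $\frac{2n}{n+2}\le p\le 2$, $q=\frac{np}{n-p}$, and $\mathcal{K}:[0,+\infty)\to(0,+\infty)$ is $C^1$. $\Delta_p u=\operatorname{div}(\nabla u|\nabla u|^{p-2})$. Radial solutions $u=u(r)$, $r=|x|$, solve $(r^{n-1}u'|u'|^{p-2})'+r^{n-1}\mathcal{K}(r)u|u|^{q-2}=0$. For each $d>0$ there is a unique (regular) solution $u(r;d)$ of this ODE with $\lim_{r\to0}u(r;d)=d$; it satisfies $u'(0;d)=0$. A radial solution of $(P_{\mathcal{R}})$ is a regular solution $u(\cdot;d)$, $d>0$, with $u(r;d)>0$ for $0\le r<\mathcal{R}$ and $u(\mathcal{R};d)=0$. *)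

(* Defs.v *)
From Stdlib Require Import Reals.
From Coquelicot Require Import Coquelicot.
Open Scope R_scope.

Definition ell_star (n : nat) (p : R) : R := (INR n - p) / (p - 1).

Definition q_crit (n : nat) (p : R) : R := INR n * p / (INR n - p).

(* x |x|^(a-2), with the usual convention that it vanishes at x = 0: the
   factor x absorbs the junk value [Rpower 0 _ = 1]. *)
Definition spow (a x : R) : R := x * Rpower (Rabs x) (a - 2).

(* f is C^1 on [0, +oo): derivative and continuity are one-sided at 0, and
   values of f on negative reals are irrelevant. *)
Definition C1_halfline (f : R -> R) : Prop :=
  exists f' : R -> R, forall r : R, 0 <= r ->
    filterdiff f (within (Rle 0) (locally r)) (fun y : R => scal y (f' r)) /\
    filterlim f' (within (Rle 0) (locally r)) (locally (f' r)).

(* Radial form of Delta_p u + K(|x|) u|u|^(q-2) = 0, r = |x|: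
   (r^(n-1) u'|u'|^(p-2))' + r^(n-1) K(r) u|u|^(q-2) = 0 on (0, +oo). *)
Definition radial_ode (n : nat) (p : R) (K u : R -> R) : Prop :=
  forall r : R, 0 < r ->
    ex_derive u r /\
    ex_derive (fun s : R => s ^ (n - 1) * spow p (Derive u s)) r /\
    Derive (fun s : R => s ^ (n - 1) * spow p (Derive u s)) r
      + r ^ (n - 1) * K r * spow (q_crit n p) (u r) = 0.

(* u = u(.; d) on [0, +oo); u is extended to r = 0 by its limit d.  The property
   u'(0) = 0 is a consequence (as p < n) and is not imposed. *)
Definition regular_solution (n : nat) (p : R) (K : R -> R) (d : R)
    (u : R -> R) : Prop :=
  radial_ode n p K u /\ filterlim u (at_right 0) (locally d) /\ u 0 = d.

(* Radial solutions of
   Delta_p u + K(|x|) u|u|^(q-2) = 0 in |x| < rad,  u > 0 there,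
   u = 0 on |x| = rad. *)
Definition radial_solution (n : nat) (p : R) (K : R -> R) (rad : R)
    (u : R -> R) : Prop :=
  (exists d : R, 0 < d /\ regular_solution n p K d u) /\
  (forall r : R, 0 <= r < rad -> 0 < u r) /\
  u rad = 0.

Definition admits_one (n : nat) (p : R) (K : R -> R) (rad : R) : Prop :=
  exists u : R -> R, radial_solution n p K rad u.

(* Distinctness is tested on [0, rad] only, since elements of [R -> R] may also
   differ at meaningless (negative) arguments. *)
Definition admits_two (n : nat) (p : R) (K : R -> R) (rad : R) : Prop :=
  exists u1 u2 : R -> R,
    radial_solution n p K rad u1 /\ radial_solution n p K rad u2 /\
    exists r : R, 0 <= r <= rad /\ u1 r <> u2 r.

(* Main.v *)
(* Shooting in d = u(0).  The nonlinearities are locally Lipschitz because p <= 2 and q >= 2, and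
   for solutions of the equation with the source K (u^+)^(q-1) the map (d, r) |-> u(r; d) is
   continuous in d and strictly decreasing in r.  Hence the radii of existence are the r with
   u(r; d) = 0 for some d > 0, and everything follows from the intermediate value theorem in d
   once the following is known: u(.; d) is positive on [0, M] for d small (since q > p); it is so
   for d large when ell > ell_star, and on some fixed [0, m] when ell = ell_star; and
   some u(.; d) vanishes somewhere.

   With delta = d^(-p/(n-p)), the Pohozaev function P of u satisfies P' = r^n K' u^q / q.  As K
   increases near 0, P >= 0 there, which bounds u by an explicit solution for constant K at scale
   delta; then P <= C delta^e whenever e <= ell and e < n/(p-1), whereas at a zero r of u it is at least
   c (delta / r)^ell_star.  This gives the positivity for large d.  If u never vanishes, then u is
   also bounded below by the decay rate r^(-ell_star), so that ell <= n/(p-1) makes P(rho) at least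
   c delta^(n/(p-1)) log(1/delta), while positivity forces P(rho) <= C delta^(n/(p-1)). *)
Require Import Defs.
From Stdlib Require Import Reals Lra Lia Classical IndefiniteDescription.
From Coquelicot Require Import Coquelicot.
Open Scope R_scope.

(** * Powers *)

(** All solutions are handled through the integral equation [u = d - drop], which absorbs the
    singularity at r = 0. In its positive-part version u is strictly decreasing on the whole
    half-line, so the sign of u(R; d) tells on which side of R its zero lies, and continuity in d at
    one fixed R is enough.

    The split between (i) and (ii) comes from the two bounds on P at a first zero R:
    (delta/R)^ell_star <= C delta^e. With e = ell_star the powers of delta cancel and R is bounded
    below uniformly in d; with e > ell_star, R tends to infinity as delta tends to 0. Then the d
    whose zero stays bounded lie in a compact interval, which yields attainment at R0 and a second
    solution beyond it; with e = ell_star the d belonging to zeros near R0 are not confined in this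
    way.

    The bound e < n/(p-1) is strict so that the integral of x^(n+e-1) u^q concentrates at x of order
    delta. At e = n/(p-1) it picks up a logarithm, and a lower bound with this logarithm is what
    forces some solution to vanish. *)

Lemma Rpower_pos (x a : R) : 0 < Rpower x a.
Proof. apply exp_pos. Qed.

Lemma Rpower_le_base (a x y : R) : 0 <= a -> 0 < x <= y -> Rpower x a <= Rpower y a.
Proof. intros Ha Hx; apply Rle_Rpower_l; lra. Qed.

Lemma Rpower_1_base (a : R) : Rpower 1 a = 1.
Proof. unfold Rpower; rewrite ln_1, Rmult_0_r; apply exp_0. Qed.

Lemma is_derive_Rpower (a x : R) : 0 < x ->
  is_derive (fun y => Rpower y a) x (a * Rpower x (a - 1)).
Proof.
  intros Hx; apply is_derive_Reals, derivable_pt_lim_power, Hx.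
Qed.


(** Differentiability is asked on the open interval only: solutions and the Pohozaev function are
    merely known to be continuous at r = 0. *)
Lemma mvt_open (f df : R -> R) (a b : R) : a < b ->
  (forall x, a < x < b -> is_derive f x (df x)) ->
  (forall x, a <= x <= b -> continuous f x) ->
  exists c, a < c < b /\ f b - f a = df c * (b - a).
Proof.
  intros Hab Hd Hc.
  assert (pr1 : forall c, a < c < b -> derivable_pt f c).
  { intros c Hc'; exists (df c); apply is_derive_Reals, Hd, Hc'. }
  assert (pr2 : forall c, a < c < b -> derivable_pt id c).
  { intros; apply derivable_pt_id. }
  destruct (MVT f id a b pr1 pr2 Hab) as [c [P HP]].
  - intros c Hc'; apply continuity_pt_filterlim, Hc, Hc'.
  - intros c Hc'; apply derivable_continuous_pt, derivable_pt_id.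
  - exists c; split; [exact P|].
    rewrite (derive_pt_eq_0 f c (df c) (pr1 c P)) in HP
      by (apply is_derive_Reals, Hd, P).
    rewrite (derive_pt_eq_0 id c 1 (pr2 c P)) in HP by (apply derivable_pt_lim_id).
    unfold id in HP; lra.
Qed.

(** Nearly all integral estimates below have this form: a bound on a derivative is integrated by
    comparison with an explicit primitive. Taking one of the two functions constant gives
    monotonicity. *)
Lemma increment_le (f df g dg : R -> R) (a b : R) : a <= b ->
  (forall x, a < x < b -> is_derive f x (df x)) ->
  (forall x, a <= x <= b -> continuous f x) ->
  (forall x, a < x < b -> is_derive g x (dg x)) ->
  (forall x, a <= x <= b -> continuous g x) ->
  (forall x, a < x < b -> df x <= dg x) -> f b - f a <= g b - g a.
Proof.
  intros Hab Hf Cf Hg Cg Hle.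
  destruct (Req_dec a b) as [->|Hne]; [lra|].
  destruct (mvt_open (fun x => g x - f x) (fun x => dg x - df x) a b) as [c [Hc1 Hc2]].
  - lra.
  - intros x Hx; apply (is_derive_minus g f x); auto.
  - intros x Hx; apply (continuous_minus g f x); auto.
  - specialize (Hle c Hc1).
    assert (0 <= (dg c - df c) * (b - a)) by (apply Rmult_le_pos; lra). lra.
Qed.

Lemma is_derive_continuous (f : R -> R) (x l : R) : is_derive f x l -> continuous f x.
Proof. intros H; apply (ex_derive_continuous f); exists l; exact H. Qed.

(** * Signed powers: inversion, monotonicity, Lipschitz bounds, derivatives *)

Lemma spow_0 (a : R) : spow a 0 = 0.
Proof. unfold spow; ring. Qed.

Lemma spow_pos_eq (a x : R) : 0 < x -> spow a x = Rpower x (a - 1).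
Proof.
  intros Hx; unfold spow; rewrite Rabs_pos_eq by lra.
  rewrite <- (Rpower_1 x Hx) at 1; rewrite <- Rpower_plus; f_equal; ring.
Qed.

Lemma spow_opp (a x : R) : spow a (- x) = - spow a x.
Proof. unfold spow; rewrite Rabs_Ropp; ring. Qed.

Lemma spow_nonneg (a x : R) : 0 <= x -> 0 <= spow a x.
Proof. intros Hx; apply Rmult_le_pos; [exact Hx|]; apply Rlt_le, exp_pos. Qed.

Lemma Rabs_spow (a x : R) : Rabs (spow a x) = spow a (Rabs x).
Proof.
  unfold spow; rewrite Rabs_mult, Rabs_Rabsolu, (Rabs_pos_eq (Rpower _ _)); auto.
  apply Rlt_le, exp_pos.
Qed.

Lemma spow_self_nonneg (a x : R) : 0 <= x * spow a x.
Proof.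
  unfold spow; rewrite <- Rmult_assoc; apply Rmult_le_pos; [nra|apply Rlt_le, exp_pos].
Qed.

Lemma spow_self_pos (a x : R) : 0 < x -> x * spow a x = Rpower x a.
Proof.
  intros Hx; rewrite spow_pos_eq by exact Hx.
  rewrite <- (Rpower_1 x Hx) at 1; rewrite <- Rpower_plus; f_equal; ring.
Qed.

Lemma spow_self_abs (a x : R) : x * spow a x = Rabs x * spow a (Rabs x).
Proof.
  unfold spow; rewrite Rabs_Rabsolu.
  replace (x * (x * Rpower (Rabs x) (a - 2))) with (Rsqr x * Rpower (Rabs x) (a - 2))
    by (unfold Rsqr; ring).
  rewrite Rsqr_abs; unfold Rsqr; ring.
Qed.

(** The hypothesis says that a and b are conjugate exponents. With [p] and [conj_exp p] this solves
    u'|u'|^(p-2) = y for u'. *)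
Lemma spow_inv (a b x : R) : (a - 1) * (b - 1) = 1 -> spow a (spow b x) = x.
Proof.
  intros Hab.
  assert (H : forall y, 0 < y -> spow a (spow b y) = y).
  { intros y Hy; rewrite (spow_pos_eq b y Hy), spow_pos_eq by apply exp_pos.
    rewrite Rpower_mult, Rmult_comm, Hab; apply Rpower_1, Hy. }
  destruct (Rtotal_order x 0) as [Hx|[->|Hx]].
  - specialize (H (- x) ltac:(lra)); rewrite !spow_opp in H; lra.
  - rewrite !spow_0; reflexivity.
  - auto.
Qed.

Lemma spow_le_nonneg (a x y : R) : 1 <= a -> 0 <= x <= y -> spow a x <= spow a y.
Proof.
  intros Ha [Hx Hxy]; destruct Hx as [Hx|<-].
  - rewrite !spow_pos_eq by lra; apply Rpower_le_base; lra.
  - rewrite spow_0; apply spow_nonneg; lra.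
Qed.

Lemma spow_le (a x y : R) : 1 <= a -> x <= y -> spow a x <= spow a y.
Proof.
  intros Ha Hxy; destruct (Rle_dec 0 x) as [H|H].
  - apply spow_le_nonneg; lra.
  - destruct (Rle_dec 0 y) as [H'|H'].
    + apply Rle_trans with 0; [|apply spow_nonneg, H'].
      replace x with (- (- x)) by ring; rewrite spow_opp.
      assert (0 <= spow a (- x)) by (apply spow_nonneg; lra). lra.
    + replace x with (- (- x)) by ring; replace y with (- (- y)) by ring.
      rewrite (spow_opp a (- x)), (spow_opp a (- y)).
      assert (spow a (- y) <= spow a (- x)) by (apply spow_le_nonneg; lra). lra.
Qed.

Lemma Rabs_spow_le (a x M : R) : 1 <= a -> Rabs x <= M -> Rabs (spow a x) <= spow a M.
Proof.
  intros Ha Hx; rewrite Rabs_spow; apply spow_le_nonneg; [exact Ha|].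
  split; [apply Rabs_pos|exact Hx].
Qed.

Lemma spow_lipschitz_nonneg (a M x y : R) : 2 <= a -> 0 <= y <= x -> x <= M ->
  Rabs (spow a x - spow a y) <= (a - 1) * Rpower M (a - 2) * (x - y).
Proof.
  intros Ha [Hy Hyx] HxM.
  rewrite Rabs_pos_eq by (assert (H := spow_le_nonneg a y x ltac:(lra) ltac:(lra)); lra).
  destruct Hy as [Hy|<-].
  - destruct Hyx as [Hyx| ->]; [|lra].
    destruct (mvt_open (fun z => Rpower z (a - 1)) (fun z => (a - 1) * Rpower z (a - 1 - 1)) y x)
      as [c [Hc Heq]].
    + exact Hyx.
    + intros z Hz; apply is_derive_Rpower; lra.
    + intros z Hz; eapply is_derive_continuous, is_derive_Rpower; lra.
    + rewrite !spow_pos_eq by lra; rewrite Heq.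
      apply Rmult_le_compat_r; [lra|]; apply Rmult_le_compat_l; [lra|].
      replace (a - 1 - 1) with (a - 2) by ring; apply Rpower_le_base; lra.
  - rewrite spow_0, !Rminus_0_r.
    destruct Hyx as [Hx|<-]; [|rewrite spow_0; lra].
    unfold spow; rewrite (Rabs_pos_eq x) by lra.
    assert (Rpower x (a - 2) <= Rpower M (a - 2)) by (apply Rpower_le_base; lra).
    assert (H0 := Rpower_pos x (a - 2)).
    apply Rle_trans with (x * Rpower M (a - 2)); [nra|].
    assert (0 <= x * Rpower M (a - 2)) by nra. nra.
Qed.

Lemma spow_lipschitz (a M x y : R) : 2 <= a -> Rabs x <= M -> Rabs y <= M ->
  Rabs (spow a x - spow a y) <= (a - 1) * Rpower M (a - 2) * Rabs (x - y).
Proof.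
  intros Ha.
  assert (W : forall x y, y <= x -> Rabs x <= M -> Rabs y <= M ->
    Rabs (spow a x - spow a y) <= (a - 1) * Rpower M (a - 2) * Rabs (x - y)).
  { clear x y; intros x y Hyx Hx Hy.
    rewrite (Rabs_pos_eq (x - y)) by lra.
    apply Rabs_le_between in Hx; apply Rabs_le_between in Hy.
    destruct (Rle_dec 0 y) as [H|H]; [apply spow_lipschitz_nonneg; lra|].
    destruct (Rle_dec x 0) as [H'|H'].
    - replace (spow a x - spow a y) with (spow a (- y) - spow a (- x))
        by (rewrite !spow_opp; ring).
      replace (x - y) with (- y - - x) by ring.
      apply spow_lipschitz_nonneg; lra.
    (* Opposite signs: pass through 0 and use oddness, so that both halves are increments on the
       nonnegative side. *)
    - replace (spow a x - spow a y) with ((spow a x - spow a 0) + (spow a (- y) - spow a 0))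
        by (rewrite spow_opp, spow_0; ring).
      eapply Rle_trans; [apply Rabs_triang|].
      assert (H1 := spow_lipschitz_nonneg a M x 0 Ha ltac:(lra) ltac:(lra)).
      assert (H2 := spow_lipschitz_nonneg a M (- y) 0 Ha ltac:(lra) ltac:(lra)).
      lra. }
  intros Hx Hy; destruct (Rle_dec y x) as [H|H]; [auto|].
  rewrite (Rabs_minus_sym (spow a x)), (Rabs_minus_sym x); apply W; lra.
Qed.

Lemma continuous_spow (a x : R) : 2 <= a -> continuous (spow a) x.
Proof.
  intros Ha; apply filterlim_locally; intros eps.
  set (M := Rabs x + 1); set (L := (a - 1) * Rpower M (a - 2)).
  assert (HM : 0 < M) by (unfold M; assert (H := Rabs_pos x); lra).
  assert (HL : 0 < L) by (apply Rmult_lt_0_compat; [lra|apply exp_pos]).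
  assert (Hd : 0 < Rmin 1 (eps / L)).
  { apply Rmin_pos; [lra|]; apply Rdiv_lt_0_compat; [apply eps|exact HL]. }
  exists (mkposreal _ Hd); intros y Hy.
  change (Rabs (y - x) < Rmin 1 (eps / L)) in Hy.
  change (Rabs (spow a y - spow a x) < eps).
  assert (H1 : Rabs (y - x) < 1) by (eapply Rlt_le_trans; [exact Hy|apply Rmin_l]).
  assert (H2 : Rabs (y - x) < eps / L) by (eapply Rlt_le_trans; [exact Hy|apply Rmin_r]).
  apply Rle_lt_trans with (L * Rabs (y - x)).
  - apply spow_lipschitz; [exact Ha| |unfold M; lra].
    unfold M; replace y with (x + (y - x)) by ring.
    eapply Rle_trans; [apply Rabs_triang|]. lra.
  - apply (Rmult_lt_compat_l L) in H2; [|exact HL].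
    replace (L * (eps / L)) with (pos eps) in H2 by (field; lra). exact H2.
Qed.

(** The function is |x|^a, written without a case distinction. The energy below contains |u|^q for
    solutions that may change sign, so the derivative is needed at 0 as well. *)
Lemma is_derive_spow_self (a x : R) : 2 <= a ->
  is_derive (fun y => y * spow a y) x (a * spow a x).
Proof.
  intros Ha.
  assert (Hpos : forall y, 0 < y -> is_derive (fun z => z * spow a z) y (a * spow a y)).
  { intros y Hy; rewrite spow_pos_eq by exact Hy.
    apply is_derive_ext_loc with (fun z => Rpower z a); [|apply is_derive_Rpower, Hy].
    exists (mkposreal y Hy); intros z Hz.
    change (Rabs (z - y) < y) in Hz; apply Rabs_def2 in Hz.
    symmetry; apply spow_self_pos; lra. }
  destruct (Rtotal_order x 0) as [Hx|[->|Hx]]; [| |auto].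
  - apply is_derive_ext with (fun z => (- z) * spow a (- z)).
    { intros z; rewrite spow_opp; change (- z * - spow a z = z * spow a z :> R); ring. }
    replace (a * spow a x) with (scal (-1) (a * spow a (- x)))
      by (rewrite spow_opp; unfold scal; simpl; unfold mult; simpl; ring).
    apply (is_derive_comp (fun z => z * spow a z) (fun z => - z)).
    + apply Hpos; lra.
    + auto_derive; [exact I|ring].
  - rewrite spow_0, Rmult_0_r.
    assert (Hc := continuous_spow a 0 Ha).
    (* At 0 the difference quotient is [spow a y] itself, which tends to 0 by continuity. *)
    split; [apply is_linear_scal_l|].
    intros y Hy; assert (E : 0 = y :> R) by exact (is_filter_lim_locally_unique _ _ Hy); subst y.
    intros eps; specialize (Hc (ball (spow a 0) eps) (locally_ball _ eps)).
    unfold filtermap in Hc; revert Hc; apply filter_imp; clear Hy; intros y Hy.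
    rewrite spow_0 in Hy.
    assert (Hy' : Rabs (spow a y) < eps)
      by (replace (spow a y) with (spow a y - 0) by ring; exact Hy).
    unfold minus, plus, opp, scal, norm; simpl.
    unfold mult, abs; simpl.
    replace (y * spow a y + - (0 * spow a 0) + - ((y + - 0) * 0)) with (spow a y * (y + - 0)) by ring.
    rewrite Rabs_mult; apply Rmult_le_compat_r; [apply Rabs_pos|lra].
Qed.

(** * The integral operator *)

(* For a radial solution u with source g = K |u|^(q-2) u and N = n - 1: flux = - r^N u' |u'|^(p-2),
   vel = - u' |u'|^(p-2) (with value 0 at r = 0, as 0 / 0 = 0), and drop = u(0) - u when a = p/(p-1). *)
Definition flux (N : nat) (g : R -> R) (s : R) : R := RInt (fun t => t ^ N * g t) 0 s.

Definition vel (N : nat) (g : R -> R) (s : R) : R := flux N g s / s ^ N.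

Definition drop (N : nat) (a : R) (g : R -> R) (r : R) : R :=
  RInt (fun s => spow a (vel N g s)) 0 r.

Lemma continuous_pow (N : nat) (x : R) : continuous (fun t => t ^ N) x.
Proof.
  apply (ex_derive_continuous (fun t => t ^ N)); auto_derive; exact I.
Qed.

Lemma is_derive_RInt_continuous (f : R -> R) (a x : R) :
  (forall t, continuous f t) -> is_derive (RInt f a) x (f x).
Proof.
  intros Hf; apply is_derive_RInt with a; [|apply Hf].
  apply filter_forall; intros y.
  apply (RInt_correct f), (ex_RInt_continuous f); intros; apply Hf.
Qed.

Lemma Rabs_RInt_le_primitive (f H h : R -> R) (a b : R) : a <= b ->
  (forall x, continuous f x) ->
  (forall x, a <= x <= b -> is_derive H x (h x)) ->
  (forall x, a < x < b -> Rabs (f x) <= h x) ->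
  Rabs (RInt f a b) <= H b - H a.
Proof.
  intros Hab Cf HH Hle.
  assert (E0 : RInt f a a = 0) by apply (RInt_point a f).
  assert (D : forall x, is_derive (RInt f a) x (f x))
    by (intros x; apply is_derive_RInt_continuous, Cf).
  apply Rabs_le; split.
  - assert (I1 := increment_le (fun x => - RInt f a x) (fun x => - f x) H h a b Hab).
    cut (- RInt f a b - - RInt f a a <= H b - H a); [lra|].
    apply I1.
    + intros x Hx; apply (is_derive_opp (RInt f a) x (f x)), D.
    + intros x Hx; apply (continuous_opp (RInt f a) x).
      apply (is_derive_continuous (RInt f a) x (f x)), D.
    + intros x Hx; apply HH; lra.
    + intros x Hx; apply (is_derive_continuous H x (h x)), HH; lra.
    + intros x Hx; specialize (Hle x Hx); apply Rabs_le_between in Hle; lra.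
  - cut (RInt f a b - RInt f a a <= H b - H a); [lra|].
    apply (increment_le (RInt f a) f H h a b Hab).
    + intros x Hx; apply D.
    + intros x Hx; apply (is_derive_continuous (RInt f a) x (f x)), D.
    + intros x Hx; apply HH; lra.
    + intros x Hx; apply (is_derive_continuous H x (h x)), HH; lra.
    + intros x Hx; specialize (Hle x Hx); apply Rabs_le_between in Hle; lra.
Qed.

Section Operator.
Variables (N : nat) (a : R).
Hypotheses (HN : (1 <= N)%nat) (Ha : 2 <= a).

Lemma flux_integrand_continuous (g : R -> R) (x : R) :
  (forall t, continuous g t) -> continuous (fun t => t ^ N * g t) x.
Proof.
  intros Hg; apply (continuous_mult (fun t => t ^ N) g); [apply continuous_pow|apply Hg].
Qed.

Lemma is_derive_flux (g : R -> R) (x : R) :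
  (forall t, continuous g t) -> is_derive (flux N g) x (x ^ N * g x).
Proof.
  intros Hg; apply (is_derive_RInt_continuous (fun t => t ^ N * g t)).
  intros t; apply flux_integrand_continuous, Hg.
Qed.

Lemma flux_0 (g : R -> R) : flux N g 0 = 0.
Proof. apply (RInt_point 0 (fun t => t ^ N * g t)). Qed.

Lemma vel_0 (g : R -> R) : vel N g 0 = 0.
Proof. unfold vel; rewrite flux_0; apply Rmult_0_l. Qed.

(** The weight (t/s)^N inside [vel] is at most 1 on [0, s], so the division by s^N costs nothing and
    |vel| is at most the integral of |g|. *)
Lemma Rabs_vel_le_primitive (g H h : R -> R) (s : R) : 0 <= s ->
  (forall t, continuous g t) ->
  (forall x, 0 <= x <= s -> is_derive H x (h x)) ->
  (forall x, 0 < x < s -> Rabs (g x) <= h x) ->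
  Rabs (vel N g s) <= H s - H 0.
Proof.
  intros [Hs|<-] Cg HH Hle; [|rewrite vel_0, Rabs_R0; lra].
  assert (Hsn : 0 < s ^ N) by (apply pow_lt, Hs).
  unfold vel, Rdiv; rewrite Rabs_mult, Rabs_inv, (Rabs_pos_eq (s ^ N)) by lra.
  apply Rmult_le_reg_r with (s ^ N); [exact Hsn|].
  rewrite Rmult_assoc, Rinv_l, Rmult_1_r by lra.
  replace ((H s - H 0) * s ^ N) with (s ^ N * H s - s ^ N * H 0) by ring.
  apply (Rabs_RInt_le_primitive (fun t => t ^ N * g t) (fun x => s ^ N * H x) (fun x => s ^ N * h x)).
  - lra.
  - intros x; apply flux_integrand_continuous, Cg.
  - intros x Hx; apply (is_derive_scal H x (s ^ N) (h x)), HH, Hx.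
  - intros x Hx; rewrite Rabs_mult, (Rabs_pos_eq (x ^ N)) by (apply pow_le; lra).
    apply Rmult_le_compat; [apply pow_le; lra|apply Rabs_pos| |auto].
    apply pow_incr; lra.
Qed.

Lemma Rabs_vel_le (g : R -> R) (G s : R) : 0 <= s ->
  (forall t, continuous g t) -> (forall t, 0 <= t <= s -> Rabs (g t) <= G) ->
  Rabs (vel N g s) <= s * G.
Proof.
  intros Hs Cg HG.
  replace (s * G) with (G * s - G * 0) by ring.
  apply (Rabs_vel_le_primitive g (fun t => G * t) (fun _ => G)); auto.
  - intros x Hx; auto_derive; [exact I|ring].
  - intros x Hx; apply HG; lra.
Qed.

Lemma vel_minus (g1 g2 : R -> R) (s : R) :
  (forall t, continuous g1 t) -> (forall t, continuous g2 t) ->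
  vel N g1 s - vel N g2 s = vel N (fun t => g1 t - g2 t) s.
Proof.
  intros C1 C2; unfold vel, flux.
  assert (E : RInt (fun t => t ^ N * (g1 t - g2 t)) 0 s =
    RInt (fun t => t ^ N * g1 t) 0 s - RInt (fun t => t ^ N * g2 t) 0 s).
  { rewrite (RInt_ext _ (fun t => minus (t ^ N * g1 t) (t ^ N * g2 t))).
    - apply (RInt_minus (fun t => t ^ N * g1 t) (fun t => t ^ N * g2 t));
        apply (ex_RInt_continuous (V := R_CompleteNormedModule));
        intros; apply flux_integrand_continuous; assumption.
    - intros x _; unfold minus, plus, opp; simpl; ring. }
  rewrite E; unfold Rdiv; ring.
Qed.

Lemma is_derive_vel (g : R -> R) (s : R) : s <> 0 ->
  (forall t, continuous g t) ->
  is_derive (vel N g) s (g s - INR N * vel N g s / s).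
Proof.
  intros Hs Cg.
  assert (Hsn : s ^ N <> 0) by (apply pow_nonzero, Hs).
  assert (D := is_derive_div (flux N g) (fun x => x ^ N) s (s ^ N * g s)
    (INR N * 1 * s ^ pred N) (is_derive_flux g s Cg)
    (is_derive_pow (fun x => x) N s 1 (is_derive_id s)) Hsn).
  replace (g s - INR N * vel N g s / s) with
    ((s ^ N * g s * s ^ N - flux N g s * (INR N * 1 * s ^ pred N)) / (s ^ N) ^ 2); [exact D|].
  unfold vel; destruct N as [|k]; [lia|]; simpl pred.
  change (s ^ S k) with (s * s ^ k) in *.
  field; split; [|exact Hs].
  intros E; apply Hsn; rewrite E; ring.
Qed.

(** At 0 the reason is |vel(s)| <= |s| G with G a local bound for |g|. Negative s are included so
    that [drop] is the integral of a function continuous on all of R. *)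
Lemma continuous_vel (g : R -> R) (s : R) :
  (forall t, continuous g t) -> continuous (vel N g) s.
Proof.
  intros Cg; destruct (Req_dec s 0) as [->|Hs].
  - assert (CF : continuous (fun t => Rabs (g t)) 0).
    { apply (continuous_comp g Rabs); [apply Cg|apply continuous_Rabs]. }
    set (G := Rabs (g 0) + 1).
    assert (HG0 : 0 < G) by (unfold G; assert (H := Rabs_pos (g 0)); lra).
    assert (HG : locally 0 (fun t => Rabs (g t) <= G)).
    { assert (Hc := CF (ball (Rabs (g 0)) (mkposreal 1 Rlt_0_1)) (locally_ball _ _)).
      unfold filtermap in Hc; revert Hc; apply filter_imp; intros t Ht.
      assert (Ht' : Rabs (Rabs (g t) - Rabs (g 0)) < 1) by exact Ht.
      apply Rabs_def2 in Ht'; unfold G; lra. }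
    destruct HG as [e He].
    apply filterlim_locally; intros eps.
    assert (Hd : 0 < Rmin e (eps / G)).
    { apply Rmin_pos; [apply e|]; apply Rdiv_lt_0_compat; [apply eps|exact HG0]. }
    exists (mkposreal _ Hd); intros s Hs.
    assert (Hs' : Rabs (s - 0) < Rmin e (eps / G)) by exact Hs.
    rewrite Rminus_0_r in Hs'.
    assert (Hs1 : Rabs s < e) by (eapply Rlt_le_trans; [exact Hs'|apply Rmin_l]).
    assert (Hs2 : Rabs s < eps / G) by (eapply Rlt_le_trans; [exact Hs'|apply Rmin_r]).
    rewrite vel_0; change (Rabs (vel N g s - 0) < eps); rewrite Rminus_0_r.
    assert (Hb : forall t, Rabs t <= Rabs s -> Rabs (g t) <= G).
    { intros t Ht; apply He; change (Rabs (t - 0) < e); rewrite Rminus_0_r; lra. }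
    apply Rle_lt_trans with (Rabs s * G).
    + destruct (Rle_dec 0 s) as [Hp|Hp].
      * rewrite (Rabs_pos_eq s) by exact Hp; apply Rabs_vel_le; auto.
        intros t Ht; apply Hb; rewrite !Rabs_pos_eq; lra.
      * unfold vel, Rdiv; rewrite Rabs_mult, Rabs_inv.
        assert (Hsn : 0 < Rabs (s ^ N)) by (apply Rabs_pos_lt, pow_nonzero; lra).
        apply Rmult_le_reg_r with (Rabs (s ^ N)); [exact Hsn|].
        rewrite Rmult_assoc, Rinv_l, Rmult_1_r by lra.
        unfold flux; rewrite <- (opp_RInt_swap (V := R_CompleteNormedModule))
          by (apply (ex_RInt_continuous (V := R_CompleteNormedModule)); intros;
              apply flux_integrand_continuous; assumption).
        change (Rabs (- RInt (fun t => t ^ N * g t) s 0) <= Rabs s * G * Rabs (s ^ N)).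
        rewrite Rabs_Ropp.
        apply Rle_trans with ((0 - s) * (G * Rabs (s ^ N))).
        -- apply abs_RInt_le_const; [lra| |].
           ++ apply (ex_RInt_continuous (V := R_CompleteNormedModule)); intros;
              apply flux_integrand_continuous; assumption.
           ++ intros t Ht; rewrite Rabs_mult, Rmult_comm.
              assert (Rabs t <= Rabs s) by (rewrite !Rabs_left1; lra).
              apply Rmult_le_compat; try apply Rabs_pos; [auto|].
              rewrite <- !RPow_abs; apply pow_incr; split; [apply Rabs_pos|assumption].
        -- rewrite (Rabs_left1 s) by lra; lra.
    + apply (Rmult_lt_compat_r G) in Hs2; [|exact HG0].
      replace (eps / G * G) with (pos eps) in Hs2 by (field; lra). exact Hs2.
  - eapply is_derive_continuous, is_derive_vel; [exact Hs|exact Cg].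
Qed.

Lemma continuous_spow_vel (g : R -> R) (s : R) :
  (forall t, continuous g t) -> continuous (fun t => spow a (vel N g t)) s.
Proof.
  intros Cg; apply (continuous_comp (vel N g) (spow a)).
  - apply continuous_vel, Cg.
  - apply continuous_spow, Ha.
Qed.

Lemma is_derive_drop (g : R -> R) (r : R) :
  (forall t, continuous g t) -> is_derive (drop N a g) r (spow a (vel N g r)).
Proof.
  intros Cg; apply (is_derive_RInt_continuous (fun s => spow a (vel N g s))).
  intros t; apply continuous_spow_vel, Cg.
Qed.

Lemma drop_0 (g : R -> R) : drop N a g 0 = 0.
Proof. apply (RInt_point 0 (fun s => spow a (vel N g s))). Qed.

Lemma continuous_drop (g : R -> R) (r : R) :
  (forall t, continuous g t) -> continuous (drop N a g) r.
Proof. intros Cg; eapply is_derive_continuous, is_derive_drop, Cg. Qed.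

Lemma drop_lipschitz (g : R -> R) (G r s t : R) : 0 <= s <= t -> t <= r ->
  (forall t, continuous g t) -> (forall t, 0 <= t <= r -> Rabs (g t) <= G) ->
  Rabs (drop N a g t - drop N a g s) <= spow a (r * G) * (t - s).
Proof.
  intros Hs Ht Cg HG.
  destruct (Req_dec s t) as [->|Hne]; [rewrite !Rminus_diag, Rabs_R0; lra|].
  destruct (mvt_open (drop N a g) (fun x => spow a (vel N g x)) s t) as [c [Hc Heq]].
  - lra.
  - intros x _; apply is_derive_drop, Cg.
  - intros x _; apply continuous_drop, Cg.
  - rewrite Heq, Rabs_mult, (Rabs_pos_eq (t - s)) by lra.
    apply Rmult_le_compat_r; [lra|]; apply Rabs_spow_le; [lra|].
    apply Rle_trans with (c * G).
    + apply Rabs_vel_le; [lra|exact Cg|]. intros x Hx; apply HG; lra.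
    + apply Rmult_le_compat_r; [|lra].
      apply Rle_trans with (Rabs (g 0)); [apply Rabs_pos|apply HG; lra].
Qed.

(* The weight exp(lam t) turns the Volterra operator into a contraction. *)
Lemma drop_contraction (R0 G L : R) : 0 < R0 -> 0 <= G -> 0 <= L ->
  exists lam, 0 < lam /\ forall g1 g2 C, 0 <= C ->
    (forall t, continuous g1 t) -> (forall t, continuous g2 t) ->
    (forall t, 0 <= t <= R0 -> Rabs (g1 t) <= G) ->
    (forall t, 0 <= t <= R0 -> Rabs (g2 t) <= G) ->
    (forall t, 0 <= t <= R0 -> Rabs (g1 t - g2 t) <= L * (C * exp (lam * t))) ->
    forall r, 0 <= r <= R0 ->
      Rabs (drop N a g1 r - drop N a g2 r) <= C / 2 * exp (lam * r).
Proof.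
  intros HR HG HL.
  set (M := R0 * G + 1); set (Lp := (a - 1) * Rpower M (a - 2)).
  assert (HM : 0 < M) by (unfold M; assert (0 <= R0 * G) by (apply Rmult_le_pos; lra); lra).
  assert (HLp : 0 < Lp) by (apply Rmult_lt_0_compat; [lra|apply exp_pos]).
  (* Each of the two integrations gains a factor 1/lam, so the contraction factor is Lp L / lam^2;
     this lam makes it at most 1/2. *)
  set (lam := 1 + 2 * Lp * L).
  assert (HLL : 0 <= Lp * L) by (apply Rmult_le_pos; lra).
  assert (Hlam : 0 < lam) by (unfold lam; lra).
  exists lam; split; [exact Hlam|].
  intros g1 g2 C HC C1 C2 B1 B2 Hd r Hr.
  assert (Hdv : forall s, 0 <= s <= R0 ->
    Rabs (vel N g1 s - vel N g2 s) <= L * C / lam * exp (lam * s)).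
  { intros s Hs; rewrite vel_minus by assumption.
    apply Rle_trans with (L * C / lam * exp (lam * s) - L * C / lam * exp (lam * 0)).
    - apply (Rabs_vel_le_primitive (fun t => g1 t - g2 t) (fun t => L * C / lam * exp (lam * t))
        (fun t => L * (C * exp (lam * t)))).
      + lra.
      + intros t; apply (continuous_minus g1 g2); auto.
      + intros x _; auto_derive; [exact I|field; lra].
      + intros x Hx; apply Hd; lra.
    - assert (0 <= L * C / lam * exp (lam * 0)); [|lra].
      apply Rmult_le_pos; [|apply Rlt_le, exp_pos].
      apply Rmult_le_pos; [apply Rmult_le_pos; lra|apply Rlt_le, Rinv_0_lt_compat, Hlam]. }
  assert (E : drop N a g1 r - drop N a g2 r =
    RInt (fun s => spow a (vel N g1 s) - spow a (vel N g2 s)) 0 r).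
  { symmetry; apply (RInt_minus (fun s => spow a (vel N g1 s)) (fun s => spow a (vel N g2 s)));
      apply (ex_RInt_continuous (V := R_CompleteNormedModule)); intros;
      apply continuous_spow_vel; assumption. }
  rewrite E.
  apply Rle_trans with (Lp * (L * C / lam) / lam * exp (lam * r)
    - Lp * (L * C / lam) / lam * exp (lam * 0)).
  - apply (Rabs_RInt_le_primitive _ (fun t => Lp * (L * C / lam) / lam * exp (lam * t))
      (fun t => Lp * (L * C / lam * exp (lam * t)))).
    + lra.
    + intros x; apply (continuous_minus (fun s => spow a (vel N g1 s)) (fun s => spow a (vel N g2 s)));
        apply continuous_spow_vel; assumption.
    + intros x _; auto_derive; [exact I|field; lra].
    + intros x Hx.
      apply Rle_trans with (Lp * Rabs (vel N g1 x - vel N g2 x)).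
      * assert (Bv : forall g, (forall t, continuous g t) ->
          (forall t, 0 <= t <= R0 -> Rabs (g t) <= G) -> Rabs (vel N g x) <= M).
        { intros g Cg Bg; apply Rle_trans with (x * G).
          - apply Rabs_vel_le; [lra|exact Cg|]. intros t Ht; apply Bg; lra.
          - unfold M; assert (x * G <= R0 * G) by (apply Rmult_le_compat_r; lra). lra. }
        apply spow_lipschitz; auto.
      * apply Rmult_le_compat_l; [lra|]; apply Hdv; lra.
  - set (A := Lp * (L * C / lam) / lam).
    assert (HA : A = Lp * L * C / (lam * lam)) by (unfold A; field; lra).
    assert (HA0 : 0 <= A).
    { rewrite HA; apply Rmult_le_pos; [apply Rmult_le_pos; assumption|].
      apply Rlt_le, Rinv_0_lt_compat; nra. }
    assert (HA1 : A <= C / 2).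
    { rewrite HA; apply Rmult_le_reg_r with (lam * lam); [nra|].
      replace (Lp * L * C / (lam * lam) * (lam * lam)) with (Lp * L * C) by (field; lra).
      assert (2 * (Lp * L) <= lam * lam) by (unfold lam; nra).
      nra. }
    assert (0 < exp (lam * 0)) by apply exp_pos.
    assert (0 < exp (lam * r)) by apply exp_pos.
    nra.
Qed.

(** Continuous dependence on the initial value, and uniqueness when [d1 = d2]. At the maximum point
    m of the weighted difference w, the contraction leaves w(m) exp(lam m) <= |d1 - d2| + w(m)
    exp(lam m) / 2, and the last term is absorbed. *)
Lemma drop_gronwall (R0 G L : R) : 0 < R0 -> 0 <= G -> 0 <= L ->
  exists C, 0 < C /\ forall g1 g2 u1 u2 d1 d2,
    (forall t, continuous g1 t) -> (forall t, continuous g2 t) ->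
    (forall t, 0 <= t <= R0 -> continuous u1 t) -> (forall t, 0 <= t <= R0 -> continuous u2 t) ->
    (forall t, 0 <= t <= R0 -> Rabs (g1 t) <= G) ->
    (forall t, 0 <= t <= R0 -> Rabs (g2 t) <= G) ->
    (forall t, 0 <= t <= R0 -> Rabs (g1 t - g2 t) <= L * Rabs (u1 t - u2 t)) ->
    (forall t, 0 <= t <= R0 -> u1 t = d1 - drop N a g1 t) ->
    (forall t, 0 <= t <= R0 -> u2 t = d2 - drop N a g2 t) ->
    forall r, 0 <= r <= R0 -> Rabs (u1 r - u2 r) <= C * Rabs (d1 - d2).
Proof.
  intros HR HG HL.
  destruct (drop_contraction R0 G L HR HG HL) as [lam [Hlam Hc]].
  exists (2 * exp (lam * R0)); split; [assert (H := exp_pos (lam * R0)); lra|].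
  intros g1 g2 u1 u2 d1 d2 C1 C2 Cu1 Cu2 B1 B2 Hd E1 E2 r Hr.
  set (w := fun t => Rabs (u1 t - u2 t) * exp (- lam * t)).
  destruct (continuity_ab_maj w 0 R0) as [m [Hm Hm']].
  { lra. }
  { intros c Hc'; apply continuity_pt_filterlim.
    apply (continuous_mult (fun t => Rabs (u1 t - u2 t)) (fun t => exp (- lam * t))).
    - apply (continuous_comp (fun t => u1 t - u2 t) Rabs); [|apply continuous_Rabs].
      apply (continuous_minus u1 u2); auto.
    - apply (ex_derive_continuous (fun t => exp (- lam * t))); auto_derive; exact I. }
  assert (Hw : forall t, Rabs (u1 t - u2 t) = w t * exp (lam * t)).
  { intros t; unfold w; rewrite Rmult_assoc, <- exp_plus.
    replace (- lam * t + lam * t) with 0 by ring; rewrite exp_0; ring. }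
  assert (HC : 0 <= w m) by (apply Rmult_le_pos; [apply Rabs_pos|apply Rlt_le, exp_pos]).
  assert (Hdrop : Rabs (drop N a g1 m - drop N a g2 m) <= w m / 2 * exp (lam * m)).
  { apply Hc; auto; intros t Ht.
    eapply Rle_trans; [apply Hd, Ht|]; apply Rmult_le_compat_l; [exact HL|].
    rewrite Hw; apply Rmult_le_compat_r; [apply Rlt_le, exp_pos|auto]. }
  assert (Hm2 : w m * exp (lam * m) <= Rabs (d1 - d2) + w m / 2 * exp (lam * m)).
  { rewrite <- Hw, E1, E2 by exact Hm'.
    replace (d1 - drop N a g1 m - (d2 - drop N a g2 m))
      with ((d1 - d2) + - (drop N a g1 m - drop N a g2 m)) by ring.
    eapply Rle_trans; [apply Rabs_triang|]; rewrite Rabs_Ropp; lra. }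
  assert (He : 1 <= exp (lam * m)).
  { rewrite <- exp_0; destruct (Req_dec (lam * m) 0) as [->|Hne]; [lra|].
    apply Rlt_le, exp_increasing; assert (0 <= lam * m) by (apply Rmult_le_pos; lra); lra. }
  assert (Hwm : w m <= 2 * Rabs (d1 - d2)) by nra.
  rewrite Hw.
  assert (w r <= w m) by auto.
  assert (exp (lam * r) <= exp (lam * R0)).
  { destruct (Req_dec r R0) as [->|Hne]; [lra|].
    apply Rlt_le, exp_increasing, Rmult_lt_compat_l; lra. }
  assert (0 <= w r) by (apply Rmult_le_pos; [apply Rabs_pos|apply Rlt_le, exp_pos]).
  assert (0 < exp (lam * r)) by apply exp_pos.
  nra.
Qed.

End Operator.

(** * Picard iteration *)

Lemma le_geometric (x C : R) : (forall k, x <= C * (1/2) ^ k) -> x <= 0.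
Proof.
  intros H.
  assert (HL : is_lim_seq (fun k => C * (1/2) ^ k) (C * 0)%R).
  { apply (is_lim_seq_scal_l (fun k => (1/2) ^ k) C 0), is_lim_seq_geom.
    rewrite Rabs_pos_eq; lra. }
  rewrite Rmult_0_r in HL.
  apply (is_lim_seq_le (fun _ => x) (fun k => C * (1/2) ^ k) x 0 H); [apply is_lim_seq_const|exact HL].
Qed.

Lemma continuous_Rmax_0 (x : R) : continuous (Rmax 0) x.
Proof.
  apply continuous_ext with (fun y => (y + Rabs y) / 2).
  { intros y; unfold Rmax; destruct (Rle_dec 0 y) as [H|H].
    - rewrite Rabs_pos_eq by exact H; simpl; lra.
    - rewrite Rabs_left1 by lra; simpl; lra. }
  apply (continuous_mult (fun y => y + Rabs y) (fun _ => / 2)).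
  - apply (continuous_plus (fun y => y) Rabs); [apply continuous_id|apply continuous_Rabs].
  - apply continuous_const.
Qed.

Fixpoint picard (N : nat) (a d : R) (F : R -> R -> R) (k : nat) : R -> R :=
  match k with
  | O => fun _ => d
  | S j => fun r => d - drop N a (fun t => F t (picard N a d F j t)) r
  end.

(** Since F is bounded and Lipschitz uniformly in x, the weighted contraction applies on each
    [0, R0]. The iterates therefore converge on the whole half-line at once, and no continuation
    argument is needed. *)
Lemma volterra_exists (N : nat) (a d : R) (F : R -> R -> R) :
  (1 <= N)%nat -> 2 <= a ->
  (forall u, (forall t, continuous u t) -> forall t, continuous (fun s => F s (u s)) t) ->
  (forall R0, 0 < R0 -> exists G, 0 <= G /\ forall t x, 0 <= t <= R0 -> Rabs (F t x) <= G) ->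
  (forall R0, 0 < R0 -> exists L, 0 <= L /\ forall t x y, 0 <= t <= R0 ->
     Rabs (F t x - F t y) <= L * Rabs (x - y)) ->
  exists u, (forall t, continuous u t) /\
    forall r, 0 <= r -> u r = d - drop N a (fun t => F t (u t)) r.
Proof.
  intros HN Ha Fc Fb Fl.
  set (v := picard N a d F).
  assert (Cv : forall k t, continuous (v k) t).
  { induction k as [|k IH]; intros t; [apply continuous_const|].
    apply (continuous_minus (fun _ => d) (drop N a (fun t => F t (v k t)))).
    - apply continuous_const.
    - apply continuous_drop; auto. }
  assert (Cg : forall k t, continuous (fun t => F t (v k t)) t) by (intros k; apply Fc, Cv).
  assert (key : forall R0, 0 < R0 -> exists lam L G C, 0 < lam /\ 0 <= L /\ 0 <= C /\
    (forall t x, 0 <= t <= R0 -> Rabs (F t x) <= G) /\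
    (forall t x y, 0 <= t <= R0 -> Rabs (F t x - F t y) <= L * Rabs (x - y)) /\
    (forall g1 g2 C, 0 <= C ->
      (forall t, continuous g1 t) -> (forall t, continuous g2 t) ->
      (forall t, 0 <= t <= R0 -> Rabs (g1 t) <= G) ->
      (forall t, 0 <= t <= R0 -> Rabs (g2 t) <= G) ->
      (forall t, 0 <= t <= R0 -> Rabs (g1 t - g2 t) <= L * (C * exp (lam * t))) ->
      forall r, 0 <= r <= R0 ->
      Rabs (drop N a g1 r - drop N a g2 r) <= C / 2 * exp (lam * r)) /\
    (forall k r, 0 <= r <= R0 -> Rabs (v (S k) r - v k r) <= C * (1/2)^k * exp (lam * r))).
  { intros R0 HR; destruct (Fb R0 HR) as [G [HG HbG]]; destruct (Fl R0 HR) as [L [HL HbL]].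
    destruct (drop_contraction N a HN Ha R0 G L HR HG HL) as [lam [Hlam Hc]].
    assert (HC : 0 <= spow a (R0 * G) * R0).
    { apply Rmult_le_pos; [|lra]; apply spow_nonneg, Rmult_le_pos; lra. }
    exists lam, L, G, (spow a (R0 * G) * R0).
    repeat (split; [assumption|]).
    induction k as [|k IH]; intros r Hr.
    - simpl; rewrite Rmult_1_r.
      change (v 1%nat r - v 0%nat r) with (d - drop N a (fun t => F t d) r - d).
      replace (d - drop N a (fun t => F t d) r - d)
        with (- (drop N a (fun t => F t d) r - drop N a (fun t => F t d) 0))
        by (rewrite drop_0; ring).
      rewrite Rabs_Ropp.
      apply Rle_trans with (spow a (R0 * G) * (r - 0)).
      + apply drop_lipschitz; auto; try lra. apply (Cg 0%nat).
      + assert (1 <= exp (lam * r)).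
        { rewrite <- exp_0; destruct (Req_dec (lam * r) 0) as [->|Hne]; [lra|].
          apply Rlt_le, exp_increasing; assert (0 <= lam * r) by (apply Rmult_le_pos; lra); lra. }
        assert (spow a (R0 * G) * (r - 0) <= spow a (R0 * G) * R0).
        { apply Rmult_le_compat_l; [apply spow_nonneg, Rmult_le_pos; lra|lra]. }
        nra.
    - change (v (S (S k)) r) with (d - drop N a (fun t => F t (v (S k) t)) r).
      change (v (S k) r) with (d - drop N a (fun t => F t (v k t)) r).
      replace (d - drop N a (fun t => F t (v (S k) t)) r - (d - drop N a (fun t => F t (v k t)) r))
        with (- (drop N a (fun t => F t (v (S k) t)) r - drop N a (fun t => F t (v k t)) r)) by ring.
      rewrite Rabs_Ropp.
      replace (spow a (R0 * G) * R0 * (1 / 2) ^ S k)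
        with ((spow a (R0 * G) * R0 * (1 / 2) ^ k) / 2) by (simpl; field).
      apply Hc; auto.
      + apply Rmult_le_pos; [exact HC|apply pow_le; lra].
      + intros t Ht; eapply Rle_trans; [apply HbL, Ht|].
        apply Rmult_le_compat_l; [exact HL|auto]. }
  assert (conv : forall R0, 0 < R0 -> exists C, 0 <= C /\ forall k m r, 0 <= r <= R0 ->
    Rabs (v (m + k)%nat r - v k r) <= C * (1/2)^k).
  { intros R0 HR; destruct (key R0 HR) as (lam & L & G & C & Hlam & _ & HC & _ & _ & _ & Hk).
    set (E := exp (lam * R0)).
    assert (HE : 0 < E) by apply exp_pos.
    exists (2 * C * E); split; [apply Rmult_le_pos; lra|].
    intros k m r Hr.
    assert (Hk' : forall j, Rabs (v (S j) r - v j r) <= C * E * (1/2) ^ j).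
    { intros j; eapply Rle_trans; [apply Hk, Hr|].
      replace (C * E * (1/2)^j) with (C * (1/2)^j * E) by ring.
      apply Rmult_le_compat_l; [apply Rmult_le_pos; [lra|apply pow_le; lra]|].
      unfold E; destruct (Req_dec r R0) as [->|Hne]; [lra|].
      apply Rlt_le, exp_increasing, Rmult_lt_compat_l; lra. }
    (* The bound is sharpened to the exact partial geometric sum so that the induction on [m]
       closes. *)
    cut (Rabs (v (m + k)%nat r - v k r) <= 2 * C * E * ((1/2)^k - (1/2)^(m+k))).
    { intros H; eapply Rle_trans; [exact H|].
      apply Rmult_le_compat_l; [apply Rmult_le_pos; lra|].
      assert (0 <= (1/2)^(m+k)) by (apply pow_le; lra). lra. }
    induction m as [|m IH]; [rewrite !Rminus_diag, Rabs_R0; lra|].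
    change (S m + k)%nat with (S (m + k)).
    replace (v (S (m + k)) r - v k r)
      with ((v (S (m + k)) r - v (m + k)%nat r) + (v (m + k)%nat r - v k r))
      by ring.
    eapply Rle_trans; [apply Rabs_triang|].
    specialize (Hk' (m + k)%nat); change ((1/2)^S (m + k)) with (1/2 * (1/2)^(m + k)); lra. }
  (* Convergence is controlled for r >= 0 only; freezing the argument at 0 for negative r makes the
     limit continuous on R. *)
  set (w := fun r => real (Lim_seq (fun k => v k (Rmax 0 r)))).
  assert (lim : forall r, is_lim_seq (fun k => v k (Rmax 0 r)) (w r)).
  { intros r; apply Lim_seq_correct', ex_lim_seq_cauchy_corr; intros eps.
    assert (Hr : 0 <= Rmax 0 r) by apply Rmax_l.
    destruct (conv (Rmax 0 r + 1) ltac:(lra)) as [C [HC Hconv]].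
    assert (Hg : is_lim_seq (fun k => C * (1/2)^k) (C * 0)%R).
    { apply (is_lim_seq_scal_l (fun k => (1/2) ^ k) C 0), is_lim_seq_geom.
      rewrite Rabs_pos_eq; lra. }
    rewrite Rmult_0_r in Hg; apply is_lim_seq_spec in Hg.
    assert (He2 : 0 < eps / 2) by (assert (H := cond_pos eps); lra).
    destruct (Hg (mkposreal _ He2)) as [k0 Hk0].
    exists k0; intros m1 m2 H1 H2.
    specialize (Hk0 k0 (le_n _)); simpl in Hk0; rewrite Rminus_0_r in Hk0.
    assert (A1 := Hconv k0 (m1 - k0)%nat (Rmax 0 r) ltac:(lra)).
    assert (A2 := Hconv k0 (m2 - k0)%nat (Rmax 0 r) ltac:(lra)).
    replace (m1 - k0 + k0)%nat with m1 in A1 by lia.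
    replace (m2 - k0 + k0)%nat with m2 in A2 by lia.
    apply Rabs_def2 in Hk0; apply Rabs_le_between in A1; apply Rabs_le_between in A2.
    apply Rabs_def1; lra. }
  assert (unif : forall R0, 0 < R0 -> exists C, 0 <= C /\ forall k r, r <= R0 ->
    Rabs (w r - v k (Rmax 0 r)) <= C * (1/2)^k).
  { intros R0 HR; destruct (conv R0 HR) as [C [HC Hconv]]; exists C; split; [exact HC|].
    intros k r Hr.
    assert (Hm : 0 <= Rmax 0 r <= R0) by (split; [apply Rmax_l|apply Rmax_lub; lra]).
    assert (HL : is_lim_seq (fun m => Rabs (v (m + k)%nat (Rmax 0 r) - v k (Rmax 0 r)))
      (Rabs (w r - v k (Rmax 0 r)))).
    { apply (is_lim_seq_abs _ (Finite (w r - v k (Rmax 0 r)))).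
      apply is_lim_seq_minus'; [|apply is_lim_seq_const].
      apply (is_lim_seq_incr_n (fun m => v m (Rmax 0 r)) k), lim. }
    apply (is_lim_seq_le _ (fun _ => C * (1/2)^k) _ (C * (1/2)^k) (fun m => Hconv k m _ Hm) HL).
    apply is_lim_seq_const. }
  assert (Cw : forall t, continuous w t).
  { intros t; apply continuity_pt_filterlim.
    assert (HR : 0 < Rabs t + 1) by (assert (H := Rabs_pos t); lra).
    destruct (unif (Rabs t + 1) HR) as [C [HC Hu]].
    apply (CVU_continuity (fun k r => v k (Rmax 0 r)) w t (mkposreal 1 Rlt_0_1)).
    - intros eps Heps.
      assert (Hg : is_lim_seq (fun k => C * (1/2)^k) (C * 0)%R).
      { apply (is_lim_seq_scal_l (fun k => (1/2) ^ k) C 0), is_lim_seq_geom.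
        rewrite Rabs_pos_eq; lra. }
      rewrite Rmult_0_r in Hg; apply is_lim_seq_spec in Hg.
      destruct (Hg (mkposreal _ Heps)) as [k0 Hk0].
      exists k0; intros k y Hk Hy.
      specialize (Hk0 k Hk); simpl in Hk0; rewrite Rminus_0_r in Hk0.
      apply Rle_lt_trans with (C * (1/2)^k); [|apply Rabs_def2 in Hk0; lra].
      apply Hu; unfold Boule in Hy; simpl in Hy; apply Rabs_def2 in Hy.
      assert (H := Rle_abs t); lra.
    - intros k y _; apply continuity_pt_filterlim.
      apply (continuous_comp (Rmax 0) (v k)); [apply continuous_Rmax_0|apply Cv].
    - unfold Boule; simpl; rewrite Rminus_diag, Rabs_R0; lra. }
  exists w; split; [exact Cw|].
  intros r Hr.
  destruct (key (r + 1) ltac:(lra)) as (lam & L & G & C0 & Hlam & HL & _ & HG & HLip & Hc & _).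
  destruct (unif (r + 1) ltac:(lra)) as [C [HC Hu]].
  cut (Rabs (w r - (d - drop N a (fun t => F t (w t)) r)) <= 0).
  { intros H; assert (H' := Rabs_pos (w r - (d - drop N a (fun t => F t (w t)) r))).
    assert (H0 : Rabs (w r - (d - drop N a (fun t => F t (w t)) r)) = 0) by lra.
    apply Rminus_diag_uniq; destruct (Req_dec (w r - (d - drop N a (fun t => F t (w t)) r)) 0) as [E|E];
      [exact E|apply Rabs_no_R0 in E; lra]. }
  (* The defect of w in the fixed-point equation is bounded by a fixed multiple of 2^(-k) for every
     k, hence it vanishes. *)
  apply (le_geometric _ (C + C / 2 * exp (lam * r))); intros k.
  replace (w r - (d - drop N a (fun t => F t (w t)) r)) with
    ((w r - v (S k) (Rmax 0 r)) - (drop N a (fun t => F t (v k t)) r - drop N a (fun t => F t (w t)) r)).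
  2:{ rewrite Rmax_right by exact Hr; unfold v; simpl; ring. }
  unfold Rminus at 1; eapply Rle_trans; [apply Rabs_triang|]; rewrite Rabs_Ropp.
  assert (H1 : Rabs (w r - v (S k) (Rmax 0 r)) <= C * (1/2)^k).
  { eapply Rle_trans; [apply Hu; lra|]; simpl.
    assert (0 <= C * (1/2)^k) by (apply Rmult_le_pos; [exact HC|apply pow_le; lra]). lra. }
  assert (H2 : Rabs (drop N a (fun t => F t (v k t)) r - drop N a (fun t => F t (w t)) r)
    <= (C * (1/2)^k) / 2 * exp (lam * r)).
  { apply Hc; auto; try lra.
    - apply Rmult_le_pos; [exact HC|apply pow_le; lra].
    - intros t Ht; eapply Rle_trans; [apply HLip, Ht|].
      apply Rmult_le_compat_l; [exact HL|].
      specialize (Hu k t ltac:(lra)); rewrite Rmax_right in Hu by lra.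
      rewrite Rabs_minus_sym.
      assert (1 <= exp (lam * t)).
      { rewrite <- exp_0; destruct (Req_dec (lam * t) 0) as [->|Hne]; [lra|].
        apply Rlt_le, exp_increasing; assert (0 <= lam * t) by (apply Rmult_le_pos; lra); lra. }
      assert (0 <= C * (1/2)^k) by (apply Rmult_le_pos; [exact HC|apply pow_le; lra]).
      nra. }
  lra.
Qed.

(** * Radial equation and integral equation *)

Definition conj_exp (p : R) : R := p / (p - 1).

(* K is only meaningful on the half-line; composing with [Rmax 0] makes it continuous on R. *)
Definition ext (K : R -> R) (r : R) : R := K (Rmax 0 r).

Lemma ext_eq (K : R -> R) (r : R) : 0 <= r -> ext K r = K r.
Proof. intros Hr; unfold ext; rewrite Rmax_right; auto. Qed.

Lemma ext_continuous (f : R -> R) :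
  (forall r, 0 <= r -> filterlim f (within (Rle 0) (locally r)) (locally (f r))) ->
  forall r, continuous (ext f) r.
Proof.
  intros H r.
  apply (filterlim_comp _ _ _ (Rmax 0) f _ (within (Rle 0) (locally (Rmax 0 r))));
    [|apply H, Rmax_l].
  intros P HP; assert (Hc := continuous_Rmax_0 r _ HP).
  unfold filtermap in *; revert Hc; apply filter_imp; intros x Hx; apply Hx, Rmax_l.
Qed.

(** At r > 0 the half-line is a neighbourhood, so the one-sided data give an ordinary derivative. At
    0 only the continuity of the two extensions is retained. *)
Lemma C1_halfline_ext (K : R -> R) : C1_halfline K ->
  exists K', (forall r, 0 < r -> is_derive K r (K' r)) /\
    (forall r, continuous (ext K) r) /\ (forall r, continuous (ext K') r).
Proof.
  intros [K' HK]; exists K'.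
  assert (Hlim : forall r, 0 <= r -> is_filter_lim (within (Rle 0) (locally r)) r).
  { intros r Hr P HP; unfold within; revert HP; apply filter_imp; auto. }
  split; [|split].
  - intros r Hr; destruct (HK r (Rlt_le _ _ Hr)) as [[Hl Hd] _].
    split; [exact Hl|].
    intros x Hx; assert (E : r = x :> R) by exact (is_filter_lim_locally_unique _ _ Hx); subst x.
    intros eps; specialize (Hd r (Hlim r (Rlt_le _ _ Hr)) eps).
    unfold within in Hd.
    assert (Hp : locally r (Rle 0)).
    { exists (mkposreal r Hr); intros y Hy; change (Rabs (y - r) < r) in Hy.
      apply Rabs_def2 in Hy; lra. }
    generalize (filter_and _ _ Hd Hp); apply filter_imp; intros y [Hy Hy0]; exact (Hy Hy0).
  - apply ext_continuous; intros r Hr; destruct (HK r Hr) as [Hf _].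
    apply (@filterdiff_continuous_aux R_AbsRing R_NormedModule R_NormedModule
      (within (Rle 0) (locally r)) _ K); [eexists; exact Hf|apply Hlim, Hr].
  - apply ext_continuous; intros r Hr; apply (HK r Hr).
Qed.

(** * Truncations, bounds and first zeros of continuous functions *)

Lemma Rmax_lipschitz (m x y : R) : Rabs (Rmax m x - Rmax m y) <= Rabs (x - y).
Proof.
  unfold Rmax; destruct (Rle_dec m x), (Rle_dec m y); unfold Rabs;
    repeat destruct (Rcase_abs _); lra.
Qed.

Lemma Rmin_lipschitz (m x y : R) : Rabs (Rmin m x - Rmin m y) <= Rabs (x - y).
Proof.
  unfold Rmin; destruct (Rle_dec m x), (Rle_dec m y); unfold Rabs;
    repeat destruct (Rcase_abs _); lra.
Qed.

Lemma continuous_Rmax2 (f g : R -> R) (x : R) :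
  continuous f x -> continuous g x -> continuous (fun t => Rmax (f t) (g t)) x.
Proof.
  intros Hf Hg.
  apply continuous_ext with (fun t => f t + Rmax 0 (g t - f t)).
  { intros t; unfold Rmax; destruct (Rle_dec 0 (g t - f t)), (Rle_dec (f t) (g t)); simpl; lra. }
  apply (continuous_plus f (fun t => Rmax 0 (g t - f t))); [exact Hf|].
  apply (continuous_comp (fun t => g t - f t) (Rmax 0)); [|apply continuous_Rmax_0].
  apply (continuous_minus g f); assumption.
Qed.

Lemma continuous_Rmin2 (f g : R -> R) (x : R) :
  continuous f x -> continuous g x -> continuous (fun t => Rmin (f t) (g t)) x.
Proof.
  intros Hf Hg.
  apply continuous_ext with (fun t => - Rmax (- f t) (- g t)).
  { intros t; unfold Rmax, Rmin; destruct (Rle_dec (- f t) (- g t)), (Rle_dec (f t) (g t)); simpl; lra. }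
  apply (continuous_opp (fun t => Rmax (- f t) (- g t))).
  apply (continuous_Rmax2 (fun t => - f t) (fun t => - g t)).
  - apply (continuous_opp f), Hf.
  - apply (continuous_opp g), Hg.
Qed.

Lemma continuous_bounded (f : R -> R) (b : R) : 0 <= b -> (forall t, continuous f t) ->
  exists M, 0 < M /\ forall t, 0 <= t <= b -> Rabs (f t) <= M.
Proof.
  intros Hb Cf.
  destruct (continuity_ab_maj (fun t => Rabs (f t)) 0 b Hb) as [m [Hm _]].
  { intros c _; apply continuity_pt_filterlim.
    apply (continuous_comp f Rabs); [apply Cf|apply continuous_Rabs]. }
  exists (Rabs (f m) + 1); split; [assert (H := Rabs_pos (f m)); lra|].
  intros t Ht; specialize (Hm t Ht); lra.
Qed.

Lemma continuous_pos_locally (f : R -> R) (x : R) :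
  continuous f x -> 0 < f x -> locally x (fun y => 0 < f y).
Proof.
  intros Cf Hf.
  assert (Hc := Cf (ball (f x) (mkposreal _ Hf)) (locally_ball _ _)).
  unfold filtermap in Hc; revert Hc; apply filter_imp; intros y Hy.
  assert (Hy' : Rabs (f y - f x) < f x) by exact Hy.
  apply Rabs_def2 in Hy'; lra.
Qed.

Lemma first_zero (f : R -> R) (b : R) : 0 <= b -> (forall t, continuous f t) ->
  0 < f 0 -> f b <= 0 ->
  exists s, 0 < s <= b /\ f s = 0 /\ forall t, 0 <= t < s -> 0 < f t.
Proof.
  intros Hb Cf H0 Hfb.
  set (E := fun s => 0 <= s <= b /\ forall t, 0 <= t <= s -> 0 < f t).
  destruct (completeness E) as [s [Hub Hlub]].
  { exists b; intros x [Hx _]; apply Hx. }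
  { exists 0; split; [lra|]; intros t Ht; replace t with 0 by lra; exact H0. }
  assert (Hs0 : 0 <= s).
  { apply Hub; split; [lra|]; intros t Ht; replace t with 0 by lra; exact H0. }
  assert (Hsb : s <= b) by (apply Hlub; intros x [Hx _]; apply Hx).
  assert (Hbef : forall t, 0 <= t < s -> 0 < f t).
  { intros t Ht; destruct (Rlt_dec 0 (f t)) as [H|H]; [exact H|exfalso].
    assert (s <= t); [|lra].
    apply Hlub; intros x [Hx1 Hx2]; apply Rnot_lt_le; intros Hxt.
    apply H, Hx2; lra. }
  assert (Hle : f s <= 0).
  { apply Rnot_lt_le; intros Hpos.
    destruct (continuous_pos_locally f s (Cf s) Hpos) as [e He].
    assert (Hsb' : s < b) by (destruct (Req_dec s b) as [->|]; lra).
    set (s' := Rmin b (s + e / 2)).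
    assert (He0 := cond_pos e).
    assert (Hs' : s < s') by (apply Rmin_glb_lt; lra).
    assert (s' <= s); [|lra].
    apply Hub; split.
    - split; [lra|apply Rmin_l].
    - intros t Ht; destruct (Rlt_dec t s) as [H|H]; [apply Hbef; lra|].
      apply He; change (Rabs (t - s) < e); rewrite Rabs_pos_eq by lra.
      assert (s' <= s + e / 2) by apply Rmin_r. lra. }
  assert (Hge : 0 <= f s).
  { apply Rnot_lt_le; intros Hneg.
    assert (Cn : continuous (fun t => - f t) s) by (apply (continuous_opp f), Cf).
    destruct (continuous_pos_locally _ s Cn ltac:(simpl; lra)) as [e He].
    assert (He0 := cond_pos e).
    assert (Hs1 : 0 < s) by (destruct (Req_dec s 0) as [E0|]; [rewrite E0 in Hneg; lra|lra]).
    set (t := Rmax 0 (s - e / 2)).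
    assert (Ht : 0 <= t < s) by (split; [apply Rmax_l|apply Rmax_lub_lt; lra]).
    specialize (Hbef t Ht).
    assert (0 < - f t); [|lra].
    apply He; change (Rabs (t - s) < e); rewrite Rabs_left1 by lra.
    assert (s - e / 2 <= t) by apply Rmax_r. lra. }
  exists s; split; [|split; [lra|exact Hbef]].
  split; [|exact Hsb].
  destruct (Req_dec s 0) as [E0|]; [rewrite E0 in Hle; lra|lra].
Qed.

Lemma drop_ext (N : nat) (a : R) (g1 g2 : R -> R) (r : R) : 0 <= r ->
  (forall t, 0 <= t <= r -> g1 t = g2 t) -> drop N a g1 r = drop N a g2 r.
Proof.
  intros Hr H; apply RInt_ext; intros s Hs.
  rewrite Rmin_left, Rmax_right in Hs by lra.
  f_equal; unfold vel, flux; f_equal; apply RInt_ext; intros t Ht.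
  rewrite Rmin_left, Rmax_right in Ht by lra.
  rewrite H by lra; reflexivity.
Qed.

Section Radial.
Variables (n : nat) (p : R) (K K' : R -> R).
Hypotheses (hp1 : 1 < p) (hpn : p < INR n)
  (hp_low : 2 * INR n / (INR n + 2) <= p) (hp2 : p <= 2)
  (hKpos : forall r, 0 <= r -> 0 < K r)
  (dK : forall r, 0 < r -> is_derive K r (K' r))
  (cK : forall r, continuous (ext K) r)
  (cK' : forall r, continuous (ext K') r).

Local Notation N := (n - 1)%nat.
Local Notation pc := (conj_exp p).
Local Notation q := (q_crit n p).

Lemma INR_N : INR N = INR n - 1.
Proof.
  rewrite minus_INR; [reflexivity|].
  destruct n; [simpl in hpn; lra|lia].
Qed.

Lemma N_ge_1 : (1 <= N)%nat.
Proof.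
  assert (H : (1 < n)%nat) by (apply INR_lt; simpl; lra).
  lia.
Qed.

Lemma conj_exp_ge_2 : 2 <= pc.
Proof.
  unfold conj_exp; apply Rmult_le_reg_r with (p - 1); [lra|].
  unfold Rdiv; rewrite Rmult_assoc, Rinv_l; lra.
Qed.

Lemma conj_exp_inv : (pc - 1) * (p - 1) = 1.
Proof. unfold conj_exp; field; lra. Qed.

(** Clearing denominators, this is p (n+2) >= 2n, the lower bound assumed on p. *)
Lemma q_crit_ge_2 : 2 <= q.
Proof.
  unfold q_crit; apply Rmult_le_reg_r with (INR n - p); [lra|].
  unfold Rdiv; rewrite Rmult_assoc, Rinv_l by lra.
  apply (Rmult_le_compat_r (INR n + 2)) in hp_low; [|lra].
  unfold Rdiv in hp_low; rewrite Rmult_assoc, Rinv_l in hp_low by lra.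
  lra.
Qed.

(** The parameter f is the identity for the equation itself and [Rmax 0] for its positive-part
    version. *)
Definition source (f : R -> R) (u : R -> R) (t : R) : R := ext K t * spow q (f (u t)).

Lemma continuous_source (f u : R -> R) (t : R) :
  (forall t, continuous f t) -> (forall t, continuous u t) -> continuous (source f u) t.
Proof.
  intros Cf Cu; apply (continuous_mult (ext K) (fun t => spow q (f (u t)))); [apply cK|].
  apply (continuous_comp (fun t => f (u t)) (spow q)); [|apply continuous_spow, q_crit_ge_2].
  apply (continuous_comp u f); auto.
Qed.

(* Since (n-1)/(p-1) >= 1, a nonzero flux at the origin would make u at least logarithmic there. *)
Lemma no_singular_flux (u : R -> R) (c d r0 : R) : 0 < c -> 0 < r0 ->
  (forall r, 0 < r < r0 -> exists l, is_derive u r l /\ spow pc (c / r ^ N) <= l) ->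
  filterlim u (at_right 0) (locally d) -> False.
Proof.
  intros Hc Hr0 Hd Hlim.
  assert (Hpc := conj_exp_ge_2).
  set (b := Rmin 1 r0 / 2).
  assert (Hb : 0 < b /\ b < 1 /\ b < r0).
  { unfold b; assert (H : 0 < Rmin 1 r0) by (apply Rmin_pos; lra).
    assert (Rmin 1 r0 <= 1) by apply Rmin_l; assert (Rmin 1 r0 <= r0) by apply Rmin_r; lra. }
  set (c1 := Rpower c (pc - 1)).
  assert (Hc1 : 0 < c1) by apply exp_pos.
  assert (Hlow : forall r, 0 < r < b -> u b - u r >= c1 * (ln b - ln r)).
  { intros r Hr.
    assert (Hder : forall x, 0 < x < r0 -> is_derive u x (Derive u x) /\ spow pc (c / x ^ N) <= Derive u x).
    { intros x Hx; destruct (Hd x Hx) as [l [Hl Hle]].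
      rewrite (is_derive_unique u x l Hl); split; assumption. }
    apply Rle_ge.
    replace (c1 * (ln b - ln r)) with (c1 * ln b - c1 * ln r) by ring.
    apply (increment_le (fun x => c1 * ln x) (fun x => c1 * / x) u (Derive u) r b); [lra| | | | |].
    - intros x Hx; auto_derive; [lra|ring].
    - intros x Hx; apply (ex_derive_continuous (fun x => c1 * ln x)); auto_derive; lra.
    - intros x Hx; apply Hder; lra.
    - intros x Hx; apply (is_derive_continuous u x (Derive u x)), Hder; lra.
    - intros x Hx; apply Rle_trans with (spow pc (c / x ^ N)); [|apply Hder; lra].
      assert (HxN : 0 < x ^ N) by (apply pow_lt; lra).
      rewrite spow_pos_eq by (apply Rdiv_lt_0_compat; lra).
      unfold Rdiv; rewrite <- Rpower_mult_distr; try lra; [|apply Rinv_0_lt_compat, HxN].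
      unfold c1; apply Rmult_le_compat_l; [apply Rlt_le, exp_pos|].
      rewrite <- (Rpower_1 (/ x)) by (apply Rinv_0_lt_compat; lra).
      rewrite <- pow_inv, <- Rpower_pow, Rpower_mult by (apply Rinv_0_lt_compat; lra).
      apply Rle_Rpower.
      + rewrite <- Rinv_1; apply Rlt_le, Rinv_lt_contravar; lra.
      + rewrite INR_N; rewrite <- conj_exp_inv at 1; rewrite Rmult_comm.
        apply Rmult_le_compat_r; lra. }
  assert (Hl := Hlim (ball d (mkposreal 1 Rlt_0_1)) (locally_ball _ _)).
  destruct Hl as [e He].
  (* Once ln b - ln r exceeds T, the logarithmic growth pushes u(r) below d - 1, against the limit d
     at 0. *)
  set (T := (u b - d + 1) / c1).
  set (r := Rmin (e / 2) (Rmin (b / 2) (exp (ln b - T - 1)))).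
  assert (He0 := cond_pos e).
  assert (Hr : 0 < r) by (repeat apply Rmin_pos; try lra; apply exp_pos).
  assert (Hre : r <= e / 2) by apply Rmin_l.
  assert (Hrb : r <= b / 2) by (eapply Rle_trans; [apply Rmin_r|apply Rmin_l]).
  assert (HrT : r <= exp (ln b - T - 1)) by (eapply Rle_trans; [apply Rmin_r|apply Rmin_r]).
  assert (Hball : Rabs (u r - d) < 1).
  { apply He; [|exact Hr]; change (Rabs (r - 0) < e); rewrite Rabs_pos_eq; lra. }
  specialize (Hlow r ltac:(lra)).
  assert (Hln : ln r <= ln b - T - 1).
  { rewrite <- (ln_exp (ln b - T - 1)); destruct HrT as [H|H]; [apply Rlt_le, ln_increasing; lra|rewrite H; lra]. }
  apply Rabs_def2 in Hball.
  assert (c1 * (T + 1) <= c1 * (ln b - ln r)) by (apply Rmult_le_compat_l; lra).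
  assert (c1 * T = u b - d + 1) by (unfold T; field; lra).
  lra.
Qed.

(** The equation says that r^N u'|u'|^(p-2) + flux is a constant L on (0, +oo). Once L = 0 is known,
    inverting the signed power gives u' and one more integration gives the formula. *)
Lemma regular_solution_integral (d : R) (u : R -> R) : regular_solution n p K d u ->
  (forall t, continuous (ext u) t) /\
  forall r, 0 <= r -> u r = d - drop N pc (source (fun x => x) (ext u)) r.
Proof.
  intros [Hode [Hlim Hu0]].
  assert (Hpc := conj_exp_ge_2). assert (HN := N_ge_1).
  assert (Cu : forall t, continuous (ext u) t).
  { apply ext_continuous; intros r [Hr|<-].
    - intros P HP; destruct (Hode r Hr) as [Hd _].
      assert (H := ex_derive_continuous u r Hd P HP); unfold filtermap, within in *.
      revert H; apply filter_imp; auto.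
    - intros P HP; rewrite Hu0 in HP; assert (H := Hlim P HP).
      unfold filtermap, at_right, within in *; revert H; apply filter_imp.
      intros x Hx [Hx0|<-]; [auto|]. rewrite Hu0; apply locally_singleton, HP. }
  split; [exact Cu|].
  set (g := source (fun x => x) (ext u)).
  assert (Cg : forall t, continuous g t).
  { intros t; apply continuous_source; [intros; apply continuous_id|exact Cu]. }
  set (Y := fun s => s ^ N * spow p (Derive u s)).
  assert (dY : forall r, 0 < r -> is_derive Y r (- (r ^ N * g r))).
  { intros r Hr; destruct (Hode r Hr) as [_ [Hex HE]].
    replace (- (r ^ N * g r)) with (Derive Y r); [apply Derive_correct, Hex|].
    unfold g, source; rewrite !ext_eq by lra. unfold Y; lra. }
  assert (const : forall a b f, 0 < a < b -> (forall r, a <= r <= b -> is_derive f r 0) -> f a = f b).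
  { intros a b f Hab Hf; destruct (mvt_open f (fun _ => 0) a b) as [c [_ Hc]]; [lra| | |lra].
    - intros x Hx; apply Hf; lra.
    - intros x Hx; apply (is_derive_continuous f x 0), Hf; lra. }
  set (L := Y 1 + flux N g 1).
  assert (YL : forall r, 0 < r -> Y r = L - flux N g r).
  { intros r Hr; cut (Y r + flux N g r = L); [lra|].
    assert (dS : forall x, 0 < x -> is_derive (fun x => Y x + flux N g x) x 0).
    { intros x Hx; replace 0 with (- (x ^ N * g x) + x ^ N * g x) by ring.
      apply (is_derive_plus Y (flux N g)); [apply dY, Hx|apply is_derive_flux, Cg]. }
    destruct (Rtotal_order r 1) as [H|[->|H]]; [|reflexivity|].
    - apply (const r 1 (fun x => Y x + flux N g x)); [lra|]; intros; apply dS; lra.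
    - symmetry; apply (const 1 r (fun x => Y x + flux N g x)); [lra|]; intros; apply dS; lra. }
  assert (du : forall r, 0 < r -> is_derive u r (spow pc ((L - flux N g r) / r ^ N))).
  { intros r Hr; rewrite <- YL by exact Hr.
    assert (HrN : r ^ N <> 0) by (apply pow_nonzero; lra).
    unfold Y; replace (r ^ N * spow p (Derive u r) / r ^ N) with (spow p (Derive u r))
      by (field; exact HrN).
    rewrite spow_inv by apply conj_exp_inv.
    apply Derive_correct, (Hode r Hr). }
  (* The flux of the source tends to 0 at the origin, so L different from 0 would leave at least
     |L|/2 in the numerator and contradict [no_singular_flux], applied to -u when L < 0. *)
  assert (HL : L = 0).
  { assert (Cfl : continuous (flux N g) 0) by (eapply is_derive_continuous, is_derive_flux, Cg).
    assert (small : forall c, 0 < c -> exists r0, 0 < r0 /\ forall r, 0 < r < r0 -> Rabs (flux N g r) < c).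
    { intros c Hc; destruct (Cfl (ball (flux N g 0) (mkposreal c Hc)) (locally_ball _ _)) as [e He].
      exists e; split; [apply cond_pos|]; intros r Hr.
      assert (Hb : Rabs (flux N g r - flux N g 0) < c).
      { apply He; change (Rabs (r - 0) < e); rewrite Rabs_pos_eq; lra. }
      rewrite flux_0, Rminus_0_r in Hb; exact Hb. }
    destruct (Rtotal_order L 0) as [H|[H|H]]; [exfalso|exact H|exfalso].
    - destruct (small (- L / 2) ltac:(lra)) as [r0 [Hr0 Hs]].
      apply (no_singular_flux (fun x => - u x) (- L / 2) (- d) r0); [lra|exact Hr0| |].
      + intros r Hr; exists (- spow pc ((L - flux N g r) / r ^ N)); split.
        * apply (is_derive_opp u), du; lra.
        * rewrite <- spow_opp; apply spow_le; [lra|].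
          assert (HrN : 0 < / r ^ N) by (apply Rinv_0_lt_compat, pow_lt; lra).
          specialize (Hs r Hr); apply Rabs_def2 in Hs. unfold Rdiv; nra.
      + apply (filterlim_comp _ _ _ u Ropp _ (locally d)); [exact Hlim|].
        apply (continuous_opp (fun x => x) d), continuous_id.
    - destruct (small (L / 2) ltac:(lra)) as [r0 [Hr0 Hs]].
      apply (no_singular_flux u (L / 2) d r0); [lra|exact Hr0| |exact Hlim].
      intros r Hr; exists (spow pc ((L - flux N g r) / r ^ N)); split; [apply du; lra|].
      apply spow_le; [lra|].
      assert (HrN : 0 < / r ^ N) by (apply Rinv_0_lt_compat, pow_lt; lra).
      specialize (Hs r Hr); apply Rabs_def2 in Hs. unfold Rdiv; nra. }
  assert (du' : forall r, 0 < r -> is_derive (ext u) r (- spow pc (vel N g r))).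
  { intros r Hr; apply is_derive_ext_loc with u.
    - exists (mkposreal r Hr); intros y Hy; change (Rabs (y - r) < r) in Hy.
      apply Rabs_def2 in Hy; symmetry; apply ext_eq; lra.
    - rewrite <- spow_opp; unfold vel.
      replace (- (flux N g r / r ^ N)) with ((L - flux N g r) / r ^ N)
        by (rewrite HL; unfold Rdiv; ring).
      apply du, Hr. }
  intros r [Hr|<-]; [|rewrite drop_0; lra].
  destruct (mvt_open (fun x => ext u x + drop N pc g x)
    (fun x => - spow pc (vel N g x) + spow pc (vel N g x)) 0 r) as [c [_ Hc]].
  - exact Hr.
  - intros x Hx; apply (is_derive_plus (ext u) (drop N pc g)); [apply du'; lra|].
    apply is_derive_drop; assumption.
  - intros x Hx; apply (continuous_plus (ext u) (drop N pc g)); [apply Cu|].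
    apply continuous_drop; assumption.
  - rewrite drop_0, !ext_eq, Hu0 in Hc by lra. lra.
Qed.

Lemma integral_regular_solution (d : R) (u : R -> R) : (forall t, continuous u t) ->
  (forall r, 0 <= r -> u r = d - drop N pc (source (fun x => x) u) r) ->
  regular_solution n p K d u.
Proof.
  intros Cu Hu.
  assert (Hpc := conj_exp_ge_2). assert (HN := N_ge_1).
  set (g := source (fun x => x) u) in *.
  assert (Cg : forall t, continuous g t).
  { intros t; apply continuous_source; [intros; apply continuous_id|exact Cu]. }
  assert (du : forall r, 0 < r -> is_derive u r (- spow pc (vel N g r))).
  { intros r Hr; apply is_derive_ext_loc with (fun r => d - drop N pc g r).
    - exists (mkposreal r Hr); intros y Hy; change (Rabs (y - r) < r) in Hy.
      apply Rabs_def2 in Hy; symmetry; apply Hu; lra.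
    - replace (- spow pc (vel N g r)) with (0 - spow pc (vel N g r)) by ring.
      apply (is_derive_minus (fun _ => d) (drop N pc g)); [apply (is_derive_const d)|].
      apply is_derive_drop; assumption. }
  assert (E0 : u 0 = d) by (rewrite Hu, drop_0; lra).
  split; [|split; [|exact E0]].
  - intros r Hr; split; [eexists; apply du, Hr|].
    assert (dY : is_derive (fun s => s ^ N * spow p (Derive u s)) r (- (r ^ N * g r))).
    { apply is_derive_ext_loc with (fun s => - flux N g s).
      - exists (mkposreal r Hr); intros y Hy; change (Rabs (y - r) < r) in Hy.
        apply Rabs_def2 in Hy.
        rewrite (is_derive_unique u y _ (du y ltac:(lra))), spow_opp, spow_inv
          by (rewrite Rmult_comm; apply conj_exp_inv).
        unfold vel; assert (y ^ N <> 0) by (apply pow_nonzero; lra).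
        change (- flux N g y = y ^ N * - (flux N g y / y ^ N) :> R); field; assumption.
      - apply (is_derive_opp (flux N g)), is_derive_flux, Cg. }
    split; [eexists; exact dY|].
    assert (E := is_derive_unique _ _ _ dY).
    change (Derive (fun s : R => s ^ N * spow p (Derive u s)) r = - (r ^ N * g r)) in E.
    rewrite E; unfold g, source; rewrite ext_eq by lra; ring.
  - rewrite <- E0; intros P HP; assert (H := Cu 0 P HP).
    unfold filtermap, at_right, within in *; revert H; apply filter_imp; auto.
Qed.

(** * Global existence *)

Lemma ext_pos (t : R) : 0 < ext K t.
Proof. apply hKpos, Rmax_l. Qed.

Lemma is_derive_ext_pos (r : R) : 0 < r -> is_derive (ext K) r (K' r).
Proof.
  intros Hr; apply is_derive_ext_loc with K; [|apply dK, Hr].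
  exists (mkposreal r Hr); intros y Hy; change (Rabs (y - r) < r) in Hy.
  apply Rabs_def2 in Hy; symmetry; apply ext_eq; lra.
Qed.

(** For t >= 0 this is the total variation of ln K on [0, t]. *)
Definition log_var (t : R) : R := RInt (fun s => Rabs (ext K' s) / ext K s) 0 t.

Lemma is_derive_log_var (t : R) : is_derive log_var t (Rabs (ext K' t) / ext K t).
Proof.
  apply (is_derive_RInt_continuous (fun s => Rabs (ext K' s) / ext K s)); intros s.
  apply (continuous_mult (fun s => Rabs (ext K' s)) (fun s => / ext K s)).
  - apply (continuous_comp (ext K') Rabs); [apply cK'|apply continuous_Rabs].
  - apply continuous_Rinv_comp; [apply cK|]. assert (H := ext_pos s); lra.
Qed.

Lemma log_var_0 : log_var 0 = 0.
Proof. apply (RInt_point 0 (fun s => Rabs (ext K' s) / ext K s)). Qed.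

Lemma log_var_nonneg (t : R) : 0 <= t -> 0 <= log_var t.
Proof.
  intros Ht.
  assert (H : 0 - 0 <= log_var t - log_var 0); [|rewrite log_var_0 in H; lra].
  apply (increment_le (fun _ => 0) (fun _ => 0) log_var (fun s => Rabs (ext K' s) / ext K s)).
  - exact Ht.
  - intros; apply (is_derive_const 0).
  - intros; apply continuous_const.
  - intros; apply is_derive_log_var.
  - intros; eapply is_derive_continuous, is_derive_log_var.
  - intros s _; apply Rmult_le_pos; [apply Rabs_pos|].
    apply Rlt_le, Rinv_0_lt_compat, ext_pos.
Qed.

(* The energy v^pc/(pc K) + |u|^q/q grows at most at the rate |K'|/K. *)
Lemma energy_bound (d r1 : R) (u g : R -> R) : 0 < d -> 0 <= r1 ->
  (forall t, continuous u t) -> (forall t, continuous g t) ->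
  (forall t, 0 <= t <= r1 -> g t = ext K t * spow q (u t)) ->
  (forall t, 0 <= t <= r1 -> u t = d - drop N pc g t) ->
  Rabs (u r1) <= d * exp (log_var r1).
Proof.
  intros Hd Hr1 Cu Cg Hg Hu.
  assert (Hpc := conj_exp_ge_2). assert (HN := N_ge_1). assert (Hq := q_crit_ge_2).
  set (v := vel N g).
  set (A := fun s => v s * spow pc (v s)).
  set (B := fun s => u s * spow q (u s)).
  set (e := fun s => A s / (pc * ext K s) + / q * B s).
  set (f := fun s => e s * exp (- log_var s)).
  assert (HA : forall s, 0 <= A s) by (intros; apply spow_self_nonneg).
  assert (HB : forall s, 0 <= B s) by (intros; apply spow_self_nonneg).
  assert (du : forall s, 0 < s < r1 -> is_derive u s (- spow pc (v s))).
  { intros s Hs; apply is_derive_ext_loc with (fun s => d - drop N pc g s).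
    - assert (Hm : 0 < Rmin s (r1 - s)) by (apply Rmin_pos; lra).
      exists (mkposreal _ Hm); intros y Hy; change (Rabs (y - s) < Rmin s (r1 - s)) in Hy.
      assert (Rmin s (r1 - s) <= s) by apply Rmin_l.
      assert (Rmin s (r1 - s) <= r1 - s) by apply Rmin_r.
      apply Rabs_def2 in Hy; symmetry; apply Hu; lra.
    - replace (- spow pc (v s)) with (0 - spow pc (v s)) by ring.
      apply (is_derive_minus (fun _ => d) (drop N pc g)); [apply (is_derive_const d)|].
      apply is_derive_drop; assumption. }
  (* The contributions of the source to the two halves of the energy cancel. What remains is a
     friction term, which is nonpositive, and the term with K'. *)
  assert (de : forall s, 0 < s < r1 -> is_derive e s
    (- (INR N * A s / (s * ext K s)) - A s * K' s / (pc * ext K s * ext K s))).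
  { intros s Hs.
    assert (HK := ext_pos s).
    assert (dA : is_derive A s ((g s - INR N * v s / s) * (pc * spow pc (v s)))).
    { apply (is_derive_comp (fun y => y * spow pc y) v).
      - apply is_derive_spow_self; lra.
      - apply is_derive_vel; auto; lra. }
    assert (dB : is_derive B s (- spow pc (v s) * (q * spow q (u s)))).
    { apply (is_derive_comp (fun y => y * spow q y) u); [|apply du, Hs].
      apply is_derive_spow_self; lra. }
    assert (dKs : is_derive (fun s => pc * ext K s) s (pc * K' s)).
    { apply (is_derive_scal (ext K)), is_derive_ext_pos; lra. }
    assert (dQ := is_derive_div A (fun s => pc * ext K s) s _ _ dA dKs ltac:(nra)).
    assert (dqB := is_derive_scal B s (/ q) _ dB).
    replace (- (INR N * A s / (s * ext K s)) - A s * K' s / (pc * ext K s * ext K s))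
      with (((g s - INR N * v s / s) * (pc * spow pc (v s)) * (pc * ext K s) - A s * (pc * K' s))
        / (pc * ext K s) ^ 2 + / q * (- spow pc (v s) * (q * spow q (u s)))).
    - apply (is_derive_plus (fun s => A s / (pc * ext K s)) (fun s => / q * B s)); assumption.
    - rewrite Hg by lra; unfold A; field; repeat split; lra. }
  assert (Cv : forall s, continuous v s) by (intros; apply continuous_vel; auto).
  assert (Csp : forall (a : R) (w : R -> R), 2 <= a -> (forall s, continuous w s) ->
    forall s, continuous (fun s => w s * spow a (w s)) s).
  { intros a w Haa Cw s; apply (continuous_mult w (fun s => spow a (w s))); [apply Cw|].
    apply (continuous_comp w (spow a)); [apply Cw|apply continuous_spow, Haa]. }
  assert (Cf : forall s, continuous f s).
  { intros s; apply (continuous_mult e (fun s => exp (- log_var s))).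
    - apply (continuous_plus (fun s => A s / (pc * ext K s)) (fun s => / q * B s)).
      + apply (continuous_mult A (fun s => / (pc * ext K s))); [apply Csp; auto|].
        apply continuous_Rinv_comp.
        * apply (continuous_scal_r pc (ext K)), cK.
        * assert (H := ext_pos s). nra.
      + apply (continuous_scal_r (/ q) B), Csp; auto.
    - apply (continuous_comp (fun s => - log_var s) exp).
      + apply (continuous_opp log_var); eapply is_derive_continuous, is_derive_log_var.
      + apply (ex_derive_continuous exp); auto_derive; exact I. }
  assert (Hf : f r1 - f 0 <= 0 - 0).
  { apply (increment_le f (fun s =>
      (- (INR N * A s / (s * ext K s)) - A s * K' s / (pc * ext K s * ext K s)) * exp (- log_var s)
      + e s * (- (Rabs (ext K' s) / ext K s) * exp (- log_var s))) (fun _ => 0) (fun _ => 0)).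
    - exact Hr1.
    - intros s Hs; apply (is_derive_mult e (fun s => exp (- log_var s))); [apply de, Hs| |intros; apply Rmult_comm].
      apply (is_derive_comp exp (fun s => - log_var s)).
      + apply is_derive_exp.
      + apply (is_derive_opp log_var), is_derive_log_var.
    - intros; apply Cf.
    - intros; apply (is_derive_const 0).
    - intros; apply continuous_const.
    - intros s Hs.
      assert (HK := ext_pos s).
      rewrite (ext_eq K' s) by lra.
      assert (He : A s / (pc * ext K s) <= e s).
      { unfold e; assert (0 <= / q * B s); [|lra].
        apply Rmult_le_pos; [apply Rlt_le, Rinv_0_lt_compat; lra|apply HB]. }
      assert (HN0 : 0 <= INR N * A s / (s * ext K s)).
      { apply Rmult_le_pos; [apply Rmult_le_pos; [apply pos_INR|apply HA]|].
        apply Rlt_le, Rinv_0_lt_compat; nra. }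
      assert (Hk : 0 <= Rabs (K' s) / ext K s).
      { apply Rmult_le_pos; [apply Rabs_pos|apply Rlt_le, Rinv_0_lt_compat, HK]. }
      assert (HKe : - (A s * K' s / (pc * ext K s * ext K s)) <= Rabs (K' s) / ext K s * e s).
      { apply Rle_trans with (Rabs (K' s) / ext K s * (A s / (pc * ext K s)));
          [|apply Rmult_le_compat_l; assumption].
        replace (- (A s * K' s / (pc * ext K s * ext K s)))
          with (- K' s * (A s / (pc * ext K s * ext K s))) by (field; lra).
        replace (Rabs (K' s) / ext K s * (A s / (pc * ext K s)))
          with (Rabs (K' s) * (A s / (pc * ext K s * ext K s))) by (field; lra).
        apply Rmult_le_compat_r.
        - apply Rmult_le_pos; [apply HA|]. apply Rlt_le, Rinv_0_lt_compat; nra.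
        - rewrite <- Rabs_Ropp; apply Rle_abs. }
      assert (Hexp := exp_pos (- log_var s)).
      replace (_ + _) with ((- (INR N * A s / (s * ext K s)) - A s * K' s / (pc * ext K s * ext K s)
        - Rabs (K' s) / ext K s * e s) * exp (- log_var s)) by ring.
      apply Rmult_le_reg_r with (/ exp (- log_var s)); [apply Rinv_0_lt_compat, Hexp|].
      rewrite Rmult_assoc, Rinv_r, Rmult_0_l by lra. lra. }
  assert (Hf0 : f 0 = / q * Rpower d q).
  { unfold f, e, A, B, v; rewrite log_var_0, Ropp_0, exp_0, vel_0.
    rewrite Hu by lra; rewrite drop_0, Rminus_0_r, (spow_self_pos q d) by exact Hd.
    unfold Rdiv; rewrite !Rmult_0_l; ring. }
  assert (Hfin : B r1 <= Rpower d q * exp (log_var r1)).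
  { assert (HBe : / q * B r1 <= e r1).
    { unfold e; assert (0 <= A r1 / (pc * ext K r1)); [|lra].
      apply Rmult_le_pos; [apply HA|]. apply Rlt_le, Rinv_0_lt_compat.
      assert (H := ext_pos r1); nra. }
    assert (He1 : e r1 = f r1 * exp (log_var r1)).
    { unfold f; rewrite Rmult_assoc, <- exp_plus, Rplus_opp_l, exp_0; ring. }
    assert (f r1 * exp (log_var r1) <= / q * Rpower d q * exp (log_var r1)).
    { apply Rmult_le_compat_r; [apply Rlt_le, exp_pos|lra]. }
    apply Rmult_le_reg_l with (/ q); [apply Rinv_0_lt_compat; lra|]. lra. }
  apply Rnot_lt_le; intros Hlt.
  assert (HJ := log_var_nonneg r1 Hr1).
  unfold B in Hfin; rewrite spow_self_abs in Hfin.
  assert (Hde : 0 < d * exp (log_var r1)) by (apply Rmult_lt_0_compat; [exact Hd|apply exp_pos]).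
  rewrite spow_self_pos in Hfin by lra.
  assert (H1 : Rpower (d * exp (log_var r1)) q < Rpower (Rabs (u r1)) q).
  { unfold Rpower; apply exp_increasing, Rmult_lt_compat_l; [lra|]. apply ln_increasing; lra. }
  (* The factor exp(log_var) can be moved inside the q-th power because q >= 1 and log_var >= 0. *)
  assert (H2 : Rpower d q * exp (log_var r1) <= Rpower (d * exp (log_var r1)) q).
  { rewrite <- Rpower_mult_distr by (try apply exp_pos; lra).
    apply Rmult_le_compat_l; [apply Rlt_le, exp_pos|].
    unfold Rpower; rewrite ln_exp.
    destruct (Req_dec (log_var r1) (q * log_var r1)) as [<-|Hne]; [lra|].
    apply Rlt_le, exp_increasing; nra. }
  lra.
Qed.

Lemma source_lipschitz (f u1 u2 : R -> R) (D Km t : R) : 0 < D ->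
  (forall x y, Rabs (f x - f y) <= Rabs (x - y)) ->
  Rabs (f (u1 t)) <= D -> Rabs (f (u2 t)) <= D -> Rabs (ext K t) <= Km ->
  Rabs (source f u1 t - source f u2 t) <= Km * ((q - 1) * Rpower D (q - 2)) * Rabs (u1 t - u2 t).
Proof.
  intros HD Hf H1 H2 HK.
  assert (Hq := q_crit_ge_2).
  unfold source; replace (ext K t * spow q (f (u1 t)) - ext K t * spow q (f (u2 t)))
    with (ext K t * (spow q (f (u1 t)) - spow q (f (u2 t)))) by ring.
  rewrite Rabs_mult, Rmult_assoc.
  apply Rmult_le_compat; try apply Rabs_pos; [exact HK|].
  eapply Rle_trans; [apply (spow_lipschitz q D); auto|].
  apply Rmult_le_compat_l; [|apply Hf].
  apply Rmult_le_pos; [lra|apply Rlt_le, exp_pos].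
Qed.

Lemma source_bound (f u : R -> R) (D Km t : R) : 0 < D ->
  Rabs (f (u t)) <= D -> Rabs (ext K t) <= Km ->
  Rabs (source f u t) <= Km * Rpower D (q - 1).
Proof.
  intros HD H HK; assert (Hq := q_crit_ge_2).
  unfold source; rewrite Rabs_mult.
  apply Rmult_le_compat; try apply Rabs_pos; [exact HK|].
  rewrite <- spow_pos_eq by exact HD; apply Rabs_spow_le; lra.
Qed.

Definition clip (m x : R) : R := Rmax (- m) (Rmin m x).

Lemma clip_eq (m x : R) : Rabs x <= m -> clip m x = x.
Proof.
  intros H; apply Rabs_le_between in H; unfold clip.
  rewrite (Rmin_right m x), Rmax_right by lra; reflexivity.
Qed.

Lemma Rabs_clip_le (m x : R) : 0 <= m -> Rabs (clip m x) <= m.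
Proof.
  intros Hm; apply Rabs_le; unfold clip; split; [apply Rmax_l|].
  apply Rmax_lub; [lra|apply Rmin_l].
Qed.

Lemma clip_lipschitz (m x y : R) : Rabs (clip m x - clip m y) <= Rabs (x - y).
Proof. eapply Rle_trans; [apply Rmax_lipschitz|apply Rmin_lipschitz]. Qed.

(** Clipping u at height m(t) makes the nonlinearity bounded and globally Lipschitz on bounded
    intervals of t, as the Picard scheme requires. A barrier m that is never reached then gives a
    solution of the original equation. *)
Lemma volterra_clip (d : R) (m f : R -> R) :
  (forall t, continuous m t) -> (forall t, 0 < m t) -> (forall t, continuous f t) ->
  (forall x y, Rabs (f x - f y) <= Rabs (x - y)) -> (forall x, Rabs (f x) <= Rabs x) ->
  exists u, (forall t, continuous u t) /\
    (forall t, continuous (fun t => ext K t * spow q (f (clip (m t) (u t)))) t) /\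
    forall r, 0 <= r -> u r = d - drop N pc (fun t => ext K t * spow q (f (clip (m t) (u t)))) r.
Proof.
  intros Cm Hm Cf Lf Bf.
  assert (Hpc := conj_exp_ge_2). assert (HN := N_ge_1). assert (Hq := q_crit_ge_2).
  assert (Cc : forall u, (forall t, continuous u t) ->
    forall t, continuous (fun t => ext K t * spow q (f (clip (m t) (u t)))) t).
  { intros u Cu t; apply (continuous_mult (ext K) (fun t => spow q (f (clip (m t) (u t))))); [apply cK|].
    apply (continuous_comp (fun t => f (clip (m t) (u t))) (spow q)); [|apply continuous_spow, Hq].
    apply (continuous_comp (fun t => clip (m t) (u t)) f); [|apply Cf].
    apply (continuous_Rmax2 (fun t => - m t) (fun t => Rmin (m t) (u t))).
    - apply (continuous_opp m), Cm.
    - apply continuous_Rmin2; auto. }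
  assert (Bd : forall R0, 0 < R0 -> exists D Km, 0 < D /\ 0 < Km /\
    (forall t, 0 <= t <= R0 -> Rabs (ext K t) <= Km) /\
    (forall t x, 0 <= t <= R0 -> Rabs (f (clip (m t) x)) <= D)).
  { intros R0 HR; destruct (continuous_bounded m R0 ltac:(lra) Cm) as [D [HD BD]].
    destruct (continuous_bounded (ext K) R0 ltac:(lra) cK) as [Km [HKm BK]].
    exists D, Km; repeat (split; [assumption|]); intros t x Ht.
    eapply Rle_trans; [apply Bf|]; eapply Rle_trans; [apply Rabs_clip_le, Rlt_le, Hm|].
    eapply Rle_trans; [apply Rle_abs|apply BD, Ht]. }
  destruct (volterra_exists N pc d (fun t x => ext K t * spow q (f (clip (m t) x)))) as [u [Cu Hu]].
  - exact HN.
  - exact Hpc.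
  - exact Cc.
  - intros R0 HR; destruct (Bd R0 HR) as (D & Km & HD & HKm & BK & BD).
    exists (Km * Rpower D (q - 1)); split.
    + apply Rmult_le_pos; [lra|apply Rlt_le, exp_pos].
    + intros t x Ht; apply (source_bound (fun y => f (clip (m t) y)) (fun _ => x)); auto.
  - intros R0 HR; destruct (Bd R0 HR) as (D & Km & HD & HKm & BK & BD).
    exists (Km * ((q - 1) * Rpower D (q - 2))); split.
    + apply Rmult_le_pos; [lra|]; apply Rmult_le_pos; [lra|apply Rlt_le, exp_pos].
    + intros t x y Ht.
      apply (source_lipschitz (fun z => f (clip (m t) z)) (fun _ => x) (fun _ => y)); auto.
      intros z w; eapply Rle_trans; [apply Lf|apply clip_lipschitz].
  - exists u; split; [exact Cu|split; [apply Cc, Cu|exact Hu]].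
Qed.

(** The barrier (d+1) exp(log_var) lies strictly above the energy bound d exp(log_var). At a first
    contact the clip would have been inactive so far, so the energy bound would hold there: a
    contradiction. *)
Lemma global_solution (d : R) : 0 < d ->
  exists u, (forall t, continuous u t) /\
    forall r, 0 <= r -> u r = d - drop N pc (source (fun x => x) u) r.
Proof.
  intros Hd.
  set (m := fun t => (d + 1) * exp (log_var t)).
  assert (Cm : forall t, continuous m t).
  { intros t; apply (continuous_scal_r (d + 1) (fun t => exp (log_var t))).
    apply (continuous_comp log_var exp).
    - eapply is_derive_continuous, is_derive_log_var.
    - apply (ex_derive_continuous exp); auto_derive; exact I. }
  assert (Hm : forall t, 0 < m t) by (intros; apply Rmult_lt_0_compat; [lra|apply exp_pos]).
  destruct (volterra_clip d m (fun x => x) Cm Hm) as [u [Cu [Cg Hu]]].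
  { intros; apply continuous_id. }
  { intros; lra. }
  { intros; lra. }
  exists u; split; [exact Cu|].
  assert (Hbound : forall r, 0 <= r -> 0 < m r - Rabs (u r)).
  { intros r Hr; apply Rnot_le_lt; intros Hle.
    destruct (first_zero (fun t => m t - Rabs (u t)) r Hr) as [s [Hs [Hs0 Hbef]]].
    - intros t; apply (continuous_minus m (fun t => Rabs (u t))); [apply Cm|].
      apply (continuous_comp u Rabs); [apply Cu|apply continuous_Rabs].
    - rewrite Hu, drop_0 by lra; unfold m; rewrite log_var_0, exp_0, Rabs_pos_eq; lra.
    - exact Hle.
    - assert (Hb : Rabs (u s) <= d * exp (log_var s)).
      { apply (energy_bound d s u _ Hd ltac:(lra) Cu Cg).
        - intros t Ht; simpl; rewrite clip_eq; [reflexivity|].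
          destruct (Req_dec t s) as [->|Hne]; [lra|]. specialize (Hbef t ltac:(lra)); lra.
        - intros t Ht; apply Hu; lra. }
      assert (H := exp_pos (log_var s)); unfold m in Hs0; lra. }
  intros r Hr; rewrite (Hu r Hr) at 1; apply (f_equal (fun x => d - x)), drop_ext; [exact Hr|].
  intros t Ht; unfold source; rewrite clip_eq; [reflexivity|].
  specialize (Hbound t ltac:(lra)); lra.
Qed.

(** * Positive-part solutions *)

Lemma flux_incr (g : R -> R) (s t : R) : 0 <= s <= t -> (forall t, continuous g t) ->
  (forall x, s < x < t -> 0 <= g x) -> flux N g s <= flux N g t.
Proof.
  intros Hst Cg Hg.
  assert (H : 0 - 0 <= flux N g t - flux N g s); [|lra].
  apply (increment_le (fun _ => 0) (fun _ => 0) (flux N g) (fun x => x ^ N * g x)).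
  - lra.
  - intros; apply (is_derive_const 0).
  - intros; apply continuous_const.
  - intros; apply is_derive_flux, Cg.
  - intros; eapply is_derive_continuous, is_derive_flux, Cg.
  - intros x Hx; apply Rmult_le_pos; [apply pow_le; lra|apply Hg, Hx].
Qed.

Lemma vel_nonneg (g : R -> R) (s : R) : 0 <= s -> (forall t, continuous g t) ->
  (forall x, 0 < x < s -> 0 <= g x) -> 0 <= vel N g s.
Proof.
  intros [Hs|<-] Cg Hg; [|rewrite vel_0; lra].
  apply Rmult_le_pos; [|apply Rlt_le, Rinv_0_lt_compat, pow_lt, Hs].
  rewrite <- (flux_0 N g); apply flux_incr; auto; lra.
Qed.

Lemma vel_pos (g : R -> R) (s : R) : 0 < s -> (forall t, continuous g t) ->
  (forall x, 0 < x < s -> 0 <= g x) -> 0 < g 0 -> 0 < vel N g s.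
Proof.
  intros Hs Cg Hg H0.
  apply Rdiv_lt_0_compat; [|apply pow_lt, Hs].
  destruct (continuous_pos_locally g 0 (Cg 0) H0) as [e He].
  set (b := Rmin s e).
  assert (Hb : 0 < b) by (apply Rmin_pos; [exact Hs|apply cond_pos]).
  assert (Hbs : b <= s) by apply Rmin_l. assert (Hbe : b <= e) by apply Rmin_r.
  apply Rlt_le_trans with (flux N g b).
  - destruct (mvt_open (flux N g) (fun x => x ^ N * g x) 0 b) as [c [Hc Hf]].
    + exact Hb.
    + intros; apply is_derive_flux, Cg.
    + intros; eapply is_derive_continuous, is_derive_flux, Cg.
    + rewrite flux_0, !Rminus_0_r in Hf; rewrite Hf.
      apply Rmult_lt_0_compat; [|exact Hb]; apply Rmult_lt_0_compat; [apply pow_lt; lra|].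
      apply He; change (Rabs (c - 0) < e); rewrite Rabs_pos_eq; lra.
  - apply flux_incr; [lra|exact Cg|]; intros; apply Hg; lra.
Qed.

(** The two solutions may obey different nonlinearities f1 and f2, provided that each agrees with
    the common f along its own solution. This compares the true equation with its positive-part
    version. *)
Lemma integral_close (f : R -> R) (D R0 : R) : 0 < D -> 0 < R0 ->
  (forall x y, Rabs (f x - f y) <= Rabs (x - y)) ->
  exists C, 0 < C /\ forall d1 d2 u1 u2 f1 f2,
    (forall t, continuous f1 t) -> (forall t, continuous f2 t) ->
    (forall t, continuous u1 t) -> (forall t, continuous u2 t) ->
    (forall t, 0 <= t <= R0 -> f1 (u1 t) = f (u1 t)) ->
    (forall t, 0 <= t <= R0 -> f2 (u2 t) = f (u2 t)) ->
    (forall t, 0 <= t <= R0 -> Rabs (f (u1 t)) <= D) ->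
    (forall t, 0 <= t <= R0 -> Rabs (f (u2 t)) <= D) ->
    (forall t, 0 <= t <= R0 -> u1 t = d1 - drop N pc (source f1 u1) t) ->
    (forall t, 0 <= t <= R0 -> u2 t = d2 - drop N pc (source f2 u2) t) ->
    forall r, 0 <= r <= R0 -> Rabs (u1 r - u2 r) <= C * Rabs (d1 - d2).
Proof.
  intros HD HR Lf.
  assert (Hq := q_crit_ge_2).
  destruct (continuous_bounded (ext K) R0 ltac:(lra) cK) as [Km [HKm BK]].
  destruct (drop_gronwall N pc N_ge_1 conj_exp_ge_2 R0 (Km * Rpower D (q - 1))
    (Km * ((q - 1) * Rpower D (q - 2))) HR) as [C [HC Hgr]].
  { apply Rmult_le_pos; [lra|apply Rlt_le, exp_pos]. }
  { apply Rmult_le_pos; [lra|]; apply Rmult_le_pos; [lra|apply Rlt_le, exp_pos]. }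
  exists C; split; [exact HC|].
  intros d1 d2 u1 u2 f1 f2 Cf1 Cf2 C1 C2 F1 F2 B1 B2 E1 E2 r Hr.
  apply (Hgr (source f1 u1) (source f2 u2) u1 u2 d1 d2); auto.
  - intros; apply continuous_source; auto.
  - intros; apply continuous_source; auto.
  - intros t Ht; apply source_bound; auto. rewrite F1; auto.
  - intros t Ht; apply source_bound; auto. rewrite F2; auto.
  - intros t Ht.
    replace (source f1 u1 t) with (source f u1 t) by (unfold source; rewrite F1; auto).
    replace (source f2 u2 t) with (source f u2 t) by (unfold source; rewrite F2; auto).
    apply source_lipschitz; auto.
Qed.

(* Solutions of the equation with u replaced by its positive part in the nonlinearity:
   they coincide with the regular solutions up to the first zero, and then stay negative. *)
Definition psol (d : R) (u : R -> R) : Prop :=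
  (forall t, continuous u t) /\
  forall r, 0 <= r -> u r = d - drop N pc (source (Rmax 0) u) r.

Lemma continuous_psol_source (d : R) (u : R -> R) (t : R) :
  psol d u -> continuous (source (Rmax 0) u) t.
Proof. intros [Cu _]; apply continuous_source; [apply continuous_Rmax_0|exact Cu]. Qed.

Lemma psol_source_nonneg (u : R -> R) (t : R) : 0 <= source (Rmax 0) u t.
Proof.
  apply Rmult_le_pos; [apply Rlt_le, ext_pos|apply spow_nonneg, Rmax_l].
Qed.

Lemma psol_0 (d : R) (u : R -> R) : psol d u -> u 0 = d.
Proof. intros [_ Hu]; rewrite Hu, drop_0; lra. Qed.

Lemma is_derive_psol (d : R) (u : R -> R) (r : R) : psol d u -> 0 < r ->
  is_derive u r (- spow pc (vel N (source (Rmax 0) u) r)).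
Proof.
  intros Hps Hr; apply is_derive_ext_loc with (fun r => d - drop N pc (source (Rmax 0) u) r).
  - exists (mkposreal r Hr); intros y Hy; change (Rabs (y - r) < r) in Hy.
    apply Rabs_def2 in Hy; symmetry; apply Hps; lra.
  - replace (- spow pc (vel N (source (Rmax 0) u) r))
      with (0 - spow pc (vel N (source (Rmax 0) u) r)) by ring.
    apply (is_derive_minus (fun _ => d) (drop N pc (source (Rmax 0) u))); [apply (is_derive_const d)|].
    apply is_derive_drop; [apply N_ge_1|apply conj_exp_ge_2|].
    intros t; apply (continuous_psol_source d u t Hps).
Qed.

Lemma psol_vel_nonneg (d : R) (u : R -> R) (r : R) : psol d u -> 0 <= r ->
  0 <= vel N (source (Rmax 0) u) r.
Proof.
  intros Hps Hr; apply vel_nonneg; [exact Hr| |].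
  - intros t; apply (continuous_psol_source d u t Hps).
  - intros; apply psol_source_nonneg.
Qed.

Lemma psol_vel_pos (d : R) (u : R -> R) (r : R) : 0 < d -> psol d u -> 0 < r ->
  0 < vel N (source (Rmax 0) u) r.
Proof.
  intros Hd Hps Hr; apply vel_pos; [exact Hr| | |].
  - intros t; apply (continuous_psol_source d u t Hps).
  - intros; apply psol_source_nonneg.
  - apply Rmult_lt_0_compat; [apply ext_pos|].
    rewrite (psol_0 d u Hps), Rmax_right by lra; rewrite spow_pos_eq by exact Hd; apply exp_pos.
Qed.

Lemma psol_decr (d : R) (u : R -> R) (s t : R) : psol d u -> 0 <= s <= t -> u t <= u s.
Proof.
  intros Hps Hst.
  assert (H : u t - u s <= 0 - 0); [|lra].
  apply (increment_le u (fun r => - spow pc (vel N (source (Rmax 0) u) r)) (fun _ => 0) (fun _ => 0)).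
  - lra.
  - intros x Hx; apply (is_derive_psol d); [exact Hps|lra].
  - intros; apply Hps.
  - intros; apply (is_derive_const 0).
  - intros; apply continuous_const.
  - intros x Hx; assert (0 <= spow pc (vel N (source (Rmax 0) u) x)); [|lra].
    apply spow_nonneg, (psol_vel_nonneg d); [exact Hps|lra].
Qed.

Lemma psol_decr_strict (d : R) (u : R -> R) (s t : R) : 0 < d -> psol d u ->
  0 <= s < t -> u t < u s.
Proof.
  intros Hd Hps Hst.
  destruct (mvt_open u (fun r => - spow pc (vel N (source (Rmax 0) u) r)) s t) as [c [Hc Hf]].
  - lra.
  - intros x Hx; apply (is_derive_psol d); [exact Hps|lra].
  - intros; apply Hps.
  - assert (Hv : 0 < vel N (source (Rmax 0) u) c) by (apply (psol_vel_pos d); auto; lra).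
    assert (0 < spow pc (vel N (source (Rmax 0) u) c)) by (rewrite spow_pos_eq by exact Hv; apply exp_pos).
    nra.
Qed.

Lemma psol_le (d : R) (u : R -> R) (r : R) : psol d u -> 0 <= r -> u r <= d.
Proof. intros Hps Hr; rewrite <- (psol_0 d u Hps); apply (psol_decr d); [exact Hps|lra]. Qed.

Lemma Rabs_Rmax_0_le (x D : R) : 0 <= D -> x <= D -> Rabs (Rmax 0 x) <= D.
Proof. intros H1 H2; rewrite Rabs_pos_eq by apply Rmax_l; apply Rmax_lub; assumption. Qed.

(** The source is nonnegative, so u <= d and the upper clip is inactive; the lower clip only alters
    negative values, which [Rmax 0] erases anyway. Hence a constant barrier is enough, for every
    real d. *)
Lemma psol_exists (d : R) : exists u, psol d u.
Proof.
  set (m := fun _ : R => Rabs d + 1).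
  assert (Hm : forall t, 0 < m t) by (intros t; unfold m; assert (H := Rabs_pos d); lra).
  destruct (volterra_clip d m (Rmax 0) ltac:(intros; apply continuous_const) Hm) as [u [Cu [Cg Hu]]].
  { apply continuous_Rmax_0. }
  { intros; apply Rmax_lipschitz. }
  { intros x; apply Rabs_Rmax_0_le; [apply Rabs_pos|apply Rle_abs]. }
  set (g := fun t => ext K t * spow q (Rmax 0 (clip (m t) (u t)))) in *.
  exists u; split; [exact Cu|].
  assert (Hdrop : forall r, 0 <= r -> 0 <= drop N pc g r).
  { intros r Hr.
    assert (H : 0 - 0 <= drop N pc g r - drop N pc g 0); [|rewrite drop_0 in H; lra].
    apply (increment_le (fun _ => 0) (fun _ => 0) (drop N pc g) (fun s => spow pc (vel N g s))).
    - exact Hr.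
    - intros; apply (is_derive_const 0).
    - intros; apply continuous_const.
    - intros; apply is_derive_drop; [apply N_ge_1|apply conj_exp_ge_2|exact Cg].
    - intros; apply continuous_drop; [apply N_ge_1|apply conj_exp_ge_2|exact Cg].
    - intros x Hx; apply spow_nonneg, vel_nonneg; [lra|exact Cg|].
      intros y _; apply Rmult_le_pos; [apply Rlt_le, ext_pos|apply spow_nonneg, Rmax_l]. }
  intros r Hr; rewrite (Hu r Hr) at 1; apply (f_equal (fun x => d - x)), drop_ext; [exact Hr|].
  intros t Ht; unfold g, source; do 2 f_equal.
  assert (Hut : u t <= m t).
  { rewrite Hu by lra; specialize (Hdrop t ltac:(lra)); assert (H := Rle_abs d); unfold m; lra. }
  unfold clip; rewrite (Rmin_right (m t)) by exact Hut.
  specialize (Hm t); unfold Rmax.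
  destruct (Rle_dec (- m t) (u t)), (Rle_dec 0 (u t)), (Rle_dec 0 (- m t)); lra.
Qed.

(** An upper bound on d suffices, because the positive part of u stays in [0, D] even if d or u is
    negative. *)
Lemma psol_continuous_data (D R0 : R) : 0 < D -> 0 < R0 ->
  exists C, 0 < C /\ forall d1 d2 u1 u2, d1 <= D -> d2 <= D -> psol d1 u1 -> psol d2 u2 ->
    forall r, 0 <= r <= R0 -> Rabs (u1 r - u2 r) <= C * Rabs (d1 - d2).
Proof.
  intros HD HR.
  destruct (integral_close (Rmax 0) D R0 HD HR (Rmax_lipschitz 0)) as [C [HC H]].
  exists C; split; [exact HC|].
  intros d1 d2 u1 u2 H1 H2 P1 P2 r Hr.
  assert (L1 : forall t, 0 <= t -> u1 t <= D)
    by (intros t Ht; assert (E := psol_le d1 u1 t P1 Ht); lra).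
  assert (L2 : forall t, 0 <= t -> u2 t <= D)
    by (intros t Ht; assert (E := psol_le d2 u2 t P2 Ht); lra).
  apply (H d1 d2 u1 u2 (Rmax 0) (Rmax 0)); auto; try apply continuous_Rmax_0;
    try apply P1; try apply P2; intros t Ht;
    try (apply Rabs_Rmax_0_le; [lra|]; first [apply L1|apply L2]; lra);
    first [apply P1|apply P2]; lra.
Qed.

(** A slope bound uniform in d: it carries a zero slightly beyond the threshold radius back to a
    small value at the threshold. *)
Lemma psol_lipschitz (D R0 : R) : 0 < D -> 0 < R0 ->
  exists C, 0 < C /\ forall d u s t, d <= D -> psol d u -> 0 <= s <= t -> t <= R0 ->
    u s - u t <= C * (t - s).
Proof.
  intros HD HR.
  destruct (continuous_bounded (ext K) R0 ltac:(lra) cK) as [Km [HKm BK]].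
  assert (HG : 0 < R0 * (Km * Rpower D (q - 1))).
  { repeat apply Rmult_lt_0_compat; auto; apply exp_pos. }
  exists (spow pc (R0 * (Km * Rpower D (q - 1)))); split.
  { rewrite spow_pos_eq by exact HG; apply exp_pos. }
  intros d u s t Hd Hps Hst Ht.
  assert (L : Rabs (drop N pc (source (Rmax 0) u) t - drop N pc (source (Rmax 0) u) s) <=
    spow pc (R0 * (Km * Rpower D (q - 1))) * (t - s)).
  { apply drop_lipschitz; [apply N_ge_1|apply conj_exp_ge_2|exact Hst|exact Ht| |].
    - intros; apply (continuous_psol_source d u _ Hps).
    - intros x Hx; apply source_bound; [exact HD| |apply BK, Hx].
      apply Rabs_Rmax_0_le; [lra|]. assert (E := psol_le d u x Hps ltac:(lra)); lra. }
  assert (Es := proj2 Hps s ltac:(lra)). assert (Et := proj2 Hps t ltac:(lra)).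
  apply Rabs_le_between in L. lra.
Qed.

(** Up to [rad] the solution is nonnegative, where the identity and [Rmax 0] agree; [integral_close]
    with equal initial values then identifies it with the positive-part solution. *)
Lemma radial_solution_psol (rad : R) (u : R -> R) : 0 < rad -> radial_solution n p K rad u ->
  exists d v, 0 < d /\ psol d v /\ v rad = 0.
Proof.
  intros Hrad [[d [Hd Hreg]] [Hpos Hz]].
  destruct (regular_solution_integral d u Hreg) as [Cu Hu].
  destruct (psol_exists d) as [v Hv].
  exists d, v; split; [exact Hd|split; [exact Hv|]].
  assert (Hnn : forall t, 0 <= t <= rad -> 0 <= u t).
  { intros t Ht; destruct (Req_dec t rad) as [->|Hne]; [lra|]. apply Rlt_le, Hpos; lra. }
  destruct (continuous_bounded (ext u) rad ltac:(lra) Cu) as [D [HD BD]].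
  destruct (integral_close (Rmax 0) (D + d) rad ltac:(lra) Hrad (Rmax_lipschitz 0)) as [C [HC H]].
  assert (E : Rabs (ext u rad - v rad) <= C * Rabs (d - d)).
  { apply (H d d (ext u) v (fun x => x) (Rmax 0)); try apply continuous_Rmax_0; try exact Cu; try apply Hv; try lra.
    - intros; apply continuous_id.
    - intros t Ht; rewrite ext_eq, Rmax_right by (try apply Hnn; lra); reflexivity.
    - intros; reflexivity.
    - intros t Ht; specialize (BD t Ht); apply Rabs_Rmax_0_le; [lra|].
      assert (E := Rle_abs (ext u t)); lra.
    - intros t Ht; apply Rabs_Rmax_0_le; [lra|]. assert (E := psol_le d v t Hv ltac:(lra)); lra.
    - intros t Ht; rewrite (ext_eq u) by lra; apply Hu; lra.
    - intros t Ht; apply Hv; lra. }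
  rewrite Rminus_diag, Rabs_R0, Rmult_0_r, ext_eq, Hz in E by lra.
  unfold Rminus in E; rewrite Rplus_0_l, Rabs_Ropp in E.
  assert (E' := Rabs_pos (v rad)).
  destruct (Req_dec (v rad) 0) as [E0|E0]; [exact E0|apply Rabs_no_R0 in E0; lra].
Qed.

(** A regular solution has to exist on the entire half-line, beyond [rad] too, where the
    positive-part solution is negative and solves another equation. Hence the global solution is
    taken and shown to agree with v on [0, rad]. *)
Lemma psol_radial_solution (rad d : R) (v : R -> R) : 0 < rad -> 0 < d -> psol d v -> v rad = 0 ->
  exists u, radial_solution n p K rad u /\ u 0 = d.
Proof.
  intros Hrad Hd Hv Hz.
  destruct (global_solution d Hd) as [u [Cu Hu]].
  assert (Hnn : forall t, 0 <= t <= rad -> 0 <= v t).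
  { intros t Ht; rewrite <- Hz; apply (psol_decr d); [exact Hv|lra]. }
  destruct (continuous_bounded u rad ltac:(lra) Cu) as [D [HD BD]].
  destruct (integral_close (fun x => x) (D + d) rad ltac:(lra) Hrad) as [C [HC H]].
  { intros; lra. }
  assert (E : forall t, 0 <= t <= rad -> u t = v t).
  { intros t Ht.
    assert (E : Rabs (u t - v t) <= C * Rabs (d - d)).
    { apply (H d d u v (fun x => x) (Rmax 0)); try apply continuous_Rmax_0; try exact Cu; try apply Hv; try lra.
      - intros; apply continuous_id.
      - intros; reflexivity.
      - intros s Hs; apply Rmax_right, Hnn, Hs.
      - intros s Hs; specialize (BD s Hs); lra.
      - intros s Hs; rewrite Rabs_pos_eq by apply Hnn, Hs.
        assert (E := psol_le d v s Hv ltac:(lra)); lra.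
      - intros s Hs; apply Hu; lra.
      - intros s Hs; apply Hv; lra. }
    rewrite Rminus_diag, Rabs_R0, Rmult_0_r in E.
    apply Rminus_diag_uniq.
    destruct (Req_dec (u t - v t) 0) as [E0|E0]; [exact E0|].
    assert (E' := Rabs_pos (u t - v t)); apply Rabs_no_R0 in E0; lra. }
  exists u; split; [split; [|split]|].
  - exists d; split; [exact Hd|]. apply integral_regular_solution; assumption.
  - intros r Hr; rewrite E by lra; rewrite <- Hz; apply (psol_decr_strict d); auto; lra.
  - rewrite E by lra; exact Hz.
  - rewrite E by lra; apply psol_0, Hv.
Qed.

(** * Small data and the Pohozaev function *)

(* A solution with u(0) = de^(-al) varies on the scale de: d^((q-p)/(p-1)) = de^(-pc). *)
Local Notation al := ((INR n - p) / p).
Local Notation be := (conj_exp p - 1).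
Local Notation nu := (INR n).
Local Notation ls := (ell_star n p).

Lemma al_pos : 0 < al.
Proof. apply Rdiv_lt_0_compat; lra. Qed.

Lemma be_ge_1 : 1 <= be.
Proof. assert (H := conj_exp_ge_2); lra. Qed.

Lemma ls_pos : 0 < ls.
Proof. apply Rdiv_lt_0_compat; lra. Qed.

Ltac exponents := unfold q_crit, conj_exp, ell_star in *; field; repeat split; lra.

Lemma al_conj_exp : al * pc = ls.
Proof. exponents. Qed.

Lemma ls_be : (nu - 1) * be = ls + 1.
Proof. exponents. Qed.

Lemma ls_lt : ls < nu * be.
Proof.
  assert (H : nu * be - ls = pc) by exponents.
  assert (H' := conj_exp_ge_2); lra.
Qed.

Lemma nu_ge_2 : 2 <= nu.
Proof.
  assert (H := N_ge_1); apply le_INR in H; rewrite INR_N in H; simpl in H; lra.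
Qed.

Lemma psol_source_bound (d Km t : R) (u : R -> R) : 0 < d -> psol d u -> 0 <= t ->
  Rabs (ext K t) <= Km -> Rabs (source (Rmax 0) u t) <= Km * Rpower d (q - 1).
Proof.
  intros Hd Hps Ht HK; apply source_bound; [exact Hd| |exact HK].
  apply Rabs_Rmax_0_le; [lra|]. apply (psol_le d u t Hps Ht).
Qed.

(** On [0, r] the source is at most Km d^(q-1), so the drop is at most Km^be d (r/de)^pc, where be =
    pc - 1: [de] is the natural length of the solution. The constant c0 solves Km^be c0^pc = 1/2. *)
Lemma half_height (R0 : R) : 0 < R0 -> exists c0, 0 < c0 /\ forall de u r,
  0 < de -> psol (Rpower de (- al)) u -> 0 <= r <= R0 -> r <= c0 * de ->
  Rpower de (- al) / 2 <= u r.
Proof.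
  intros HR.
  destruct (continuous_bounded (ext K) R0 ltac:(lra) cK) as [Km [HKm BK]].
  assert (Hpc := conj_exp_ge_2).
  assert (HKb : 0 < Rpower Km be) by apply exp_pos.
  set (c0 := Rpower (/ (2 * Rpower Km be)) (/ pc)).
  assert (Hc0 : 0 < c0) by apply exp_pos.
  assert (Hc0p : Rpower c0 pc = / (2 * Rpower Km be)).
  { unfold c0; rewrite Rpower_mult, Rinv_l, Rpower_1; [reflexivity| |lra].
    apply Rinv_0_lt_compat; lra. }
  exists c0; split; [exact Hc0|].
  intros de u r Hde Hps Hr Hrc.
  set (d := Rpower de (- al)) in *.
  assert (Hd : 0 < d) by apply exp_pos.
  destruct (Req_dec r 0) as [->|Hr0]; [rewrite (psol_0 d u Hps); lra|].
  assert (Hu := proj2 Hps r ltac:(lra)).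
  assert (Hdq : 0 < Rpower d (q - 1)) by apply exp_pos.
  assert (L := drop_lipschitz N pc N_ge_1 conj_exp_ge_2 (source (Rmax 0) u)
    (Km * Rpower d (q - 1)) r 0 r ltac:(lra) ltac:(lra)
    (fun t => continuous_psol_source d u t Hps)
    (fun t Ht => psol_source_bound d Km t u Hd Hps ltac:(lra) (BK t ltac:(lra)))).
  rewrite drop_0, !Rminus_0_r in L.
  assert (L' := Rle_trans _ _ _ (Rle_abs _) L).
  assert (Hb : spow pc (r * (Km * Rpower d (q - 1))) * r <= d / 2).
  { assert (HKd : 0 < Km * Rpower d (q - 1)) by (apply Rmult_lt_0_compat; assumption).
    rewrite spow_pos_eq by (apply Rmult_lt_0_compat; lra).
    rewrite <- !Rpower_mult_distr by (try lra; assumption).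
    rewrite (Rpower_mult d).
    assert (E1 : Rpower d ((q - 1) * be) = d * Rpower de (- pc)).
    { unfold d; rewrite Rpower_mult, <- Rpower_plus; f_equal. exponents. }
    assert (E2 : Rpower r be * r = Rpower r pc).
    { rewrite <- (Rpower_1 r) at 2 by lra; rewrite <- Rpower_plus; f_equal; ring. }
    rewrite E1.
    assert (E3 : Rpower r pc <= / (2 * Rpower Km be) * Rpower de pc).
    { rewrite <- Hc0p, Rpower_mult_distr by lra. apply Rpower_le_base; lra. }
    replace (Rpower r be * (Rpower Km be * (d * Rpower de (- pc))) * r)
      with (Rpower r be * r * (Rpower Km be * d * Rpower de (- pc))) by ring.
    rewrite E2.
    apply Rle_trans with (/ (2 * Rpower Km be) * Rpower de pc * (Rpower Km be * d * Rpower de (- pc))).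
    - apply Rmult_le_compat_r; [|exact E3].
      apply Rmult_le_pos; [apply Rmult_le_pos; lra|apply Rlt_le, exp_pos].
    - rewrite Rpower_Ropp; apply Req_le; field; split; apply Rgt_not_eq, exp_pos. }
  lra.
Qed.

Lemma Rpower_scale_inv (d : R) : 0 < d -> Rpower (Rpower d (- / al)) (- al) = d.
Proof.
  intros Hd; rewrite Rpower_mult.
  replace (- / al * - al) with 1 by (field; split; lra).
  apply Rpower_1, Hd.
Qed.

Lemma Rpower_anti (x y e : R) : 0 < e -> 0 < x <= y -> Rpower y (- e) <= Rpower x (- e).
Proof.
  intros He Hx; rewrite !Rpower_Ropp; apply Rinv_le_contravar; [apply exp_pos|].
  apply Rpower_le_base; lra.
Qed.

(** Small d means a large scale de = d^(-1/al); as soon as c0 de >= M the solution is still above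
    half its height at M. *)
Lemma positive_for_small_data (M : R) : 0 < M ->
  exists eta, 0 < eta /\ forall d u, 0 < d <= eta -> psol d u -> 0 < u M.
Proof.
  intros HM; destruct (half_height M HM) as [c0 [Hc0 Hh]].
  assert (Hal := al_pos).
  assert (HMc : 0 < M / c0) by (apply Rdiv_lt_0_compat; lra).
  exists (Rpower (M / c0) (- al)); split; [apply exp_pos|].
  intros d u Hd Hps.
  rewrite <- (Rpower_scale_inv d) in Hps by lra.
  assert (Hde := Rpower_pos d (- / al)).
  assert (Hle : M / c0 <= Rpower d (- / al)).
  { apply Rle_trans with (Rpower (Rpower (M / c0) (- al)) (- / al)).
    - rewrite Rpower_mult; replace (- al * - / al) with 1 by (field; split; lra).
      rewrite Rpower_1; lra.
    - apply Rpower_anti; [apply Rinv_0_lt_compat, Hal|lra]. }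
  assert (H := Hh _ u M Hde Hps ltac:(lra)).
  assert (HH : M <= c0 * Rpower d (- / al)).
  { apply (Rmult_le_compat_l c0) in Hle; [|lra].
    replace (c0 * (M / c0)) with M in Hle by (field; lra). exact Hle. }
  specialize (H HH); assert (H1 := Rpower_pos (Rpower d (- / al)) (- al)); lra.
Qed.

(** For d <= D the scale is bounded below by D^(-1/al), so one radius m serves all these d. *)
Lemma positive_near_origin (D : R) : 0 < D ->
  exists m, 0 < m /\ forall d u, 0 < d <= D -> psol d u -> 0 < u m.
Proof.
  intros HD; destruct (half_height 1 ltac:(lra)) as [c0 [Hc0 Hh]].
  assert (Hal := al_pos).
  assert (HDp := Rpower_pos D (- / al)).
  set (m := Rmin 1 (c0 * Rpower D (- / al))).
  assert (Hm : 0 < m) by (apply Rmin_pos; [lra|]; apply Rmult_lt_0_compat; lra).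
  exists m; split; [exact Hm|].
  intros d u Hd Hps.
  rewrite <- (Rpower_scale_inv d) in Hps by lra.
  assert (Hde := Rpower_pos d (- / al)).
  assert (Hle : Rpower D (- / al) <= Rpower d (- / al)).
  { apply Rpower_anti; [apply Rinv_0_lt_compat, Hal|lra]. }
  assert (H := Hh _ u m Hde Hps (conj (Rlt_le _ _ Hm) (Rmin_l _ _))).
  assert (HH : m <= c0 * Rpower d (- / al)).
  { eapply Rle_trans; [apply Rmin_r|]. apply Rmult_le_compat_l; lra. }
  specialize (H HH); assert (H1 := Rpower_pos (Rpower d (- / al)) (- al)); lra.
Qed.

(** Since |vel| = |u'|^(p-1), this is for positive u the classical r^n (|u'|^p (p-1)/p + K u^q/q) +
    ((n-p)/p) r^(n-1) u u'|u'|^(p-2). *)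
Definition pohozaev (u : R -> R) (r : R) : R :=
  let g := source (Rmax 0) u in
  r ^ n * (vel N g r * spow pc (vel N g r) / pc + ext K r * (u r * spow q (u r)) / q)
  - al * (flux N g r * u r).

Lemma pohozaev_0 (u : R -> R) : pohozaev u 0 = 0.
Proof.
  unfold pohozaev; rewrite flux_0, pow_ne_zero; [ring|].
  intros E; rewrite E in hpn; simpl in hpn; lra.
Qed.

Lemma continuous_pohozaev (d : R) (u : R -> R) (r : R) : psol d u -> continuous (pohozaev u) r.
Proof.
  intros Hps.
  assert (Hpc := conj_exp_ge_2). assert (Hq := q_crit_ge_2).
  set (g := source (Rmax 0) u).
  assert (Cg : forall t, continuous g t) by (intros; apply (continuous_psol_source d u _ Hps)).
  assert (Cv : forall t, continuous (vel N g) t) by (intros; apply continuous_vel; [apply N_ge_1|exact Cg]).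
  assert (Csp : forall (a : R) (w : R -> R), 2 <= a -> (forall s, continuous w s) ->
    forall s, continuous (fun s => w s * spow a (w s)) s).
  { intros a w Haa Cw s; apply (continuous_mult w (fun s => spow a (w s))); [apply Cw|].
    apply (continuous_comp w (spow a)); [apply Cw|apply continuous_spow, Haa]. }
  apply (continuous_minus (fun r => r ^ n * (vel N g r * spow pc (vel N g r) / pc
    + ext K r * (u r * spow q (u r)) / q)) (fun r => al * (flux N g r * u r))).
  - apply (continuous_mult (fun r => r ^ n) (fun r => vel N g r * spow pc (vel N g r) / pc
      + ext K r * (u r * spow q (u r)) / q)); [apply continuous_pow|].
    apply (continuous_plus (fun r => vel N g r * spow pc (vel N g r) / pc)
      (fun r => ext K r * (u r * spow q (u r)) / q)).
    + apply (continuous_mult (fun r => vel N g r * spow pc (vel N g r)) (fun _ => / pc));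
        [apply Csp; auto|apply continuous_const].
    + apply (continuous_mult (fun r => ext K r * (u r * spow q (u r))) (fun _ => / q));
        [|apply continuous_const].
      apply (continuous_mult (ext K) (fun r => u r * spow q (u r))); [apply cK|apply Csp; auto].
      apply Hps.
  - apply (continuous_scal_r al (fun r => flux N g r * u r)).
    apply (continuous_mult (flux N g) u); [|apply Hps].
    eapply is_derive_continuous, is_derive_flux, Cg.
Qed.

(** Criticality of q makes all other terms cancel: n/q = al removes K u^q, and n/pc - (n-1) + al = 0
    removes |u'|^p. *)
Lemma is_derive_pohozaev (d r : R) (u : R -> R) : psol d u -> 0 < r -> 0 < u r ->
  is_derive (pohozaev u) r (r ^ n * K' r * Rpower (u r) q / q).
Proof.
  intros Hps Hr Hur.
  assert (Hpc := conj_exp_ge_2). assert (Hq := q_crit_ge_2). assert (Hn := nu_ge_2).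
  set (g := source (Rmax 0) u).
  assert (Cg : forall t, continuous g t) by (intros; apply (continuous_psol_source d u _ Hps)).
  set (v := vel N g).
  assert (dv : is_derive v r (g r - INR N * v r / r)).
  { apply is_derive_vel; [apply N_ge_1|lra|exact Cg]. }
  assert (du := is_derive_psol d u r Hps Hr); fold g v in du.
  assert (dA := is_derive_comp (fun y => y * spow pc y) v r _ _ (is_derive_spow_self pc (v r) Hpc) dv).
  assert (dB := is_derive_comp (fun y => y * spow q y) u r _ _ (is_derive_spow_self q (u r) Hq) du).
  assert (dKr := is_derive_ext_pos r Hr).
  assert (dF : is_derive (flux N g) r (r ^ N * g r)) by (apply is_derive_flux, Cg).
  assert (dn : is_derive (fun r => r ^ n) r (nu * r ^ N)).
  { auto_derive; [exact I|]. replace (pred n) with N by lia; ring. }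
  assert (dA' := is_derive_scal _ r (/ pc) _ dA).
  assert (dKB := is_derive_mult (ext K) (fun r => u r * spow q (u r)) r _ _ dKr dB Rmult_comm).
  assert (dKB' := is_derive_scal _ r (/ q) _ dKB).
  assert (dS := is_derive_plus _ _ r _ _ dA' dKB').
  assert (dM := is_derive_mult (fun r => r ^ n) _ r _ _ dn dS Rmult_comm).
  assert (dFu := is_derive_scal _ r al _ (is_derive_mult (flux N g) u r _ _ dF du Rmult_comm)).
  assert (dP := is_derive_minus _ _ r _ _ dM dFu).
  assert (Egr : g r = K r * spow q (u r)).
  { unfold g, source; rewrite ext_eq, Rmax_right by lra; reflexivity. }
  assert (EF : flux N g r = r ^ N * v r).
  { unfold v, vel; field; apply pow_nonzero; lra. }
  assert (Ern : r ^ n = r * r ^ N).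
  { replace n with (S N) at 1 by (assert (H := N_ge_1); lia). reflexivity. }
  refine (eq_rect _ (is_derive (pohozaev u) r) (is_derive_ext _ _ _ _ _ dP) _ _).
  - intros t; unfold pohozaev, minus, plus, opp, scal, mult; simpl; unfold mult; simpl.
    fold g v. unfold Rdiv; ring.
  - unfold minus, plus, opp, scal, mult; simpl; unfold mult; simpl.
    rewrite <- (spow_self_pos q (u r) Hur), EF, Ern, INR_N, Egr, (ext_eq K r) by lra.
    set (V := v r); set (U := u r); set (X := spow pc V); set (Y := spow q U); set (RN := r ^ N).
    unfold q_crit, conj_exp; field; repeat split; lra.
Qed.

(** * Large data: bounds for u *)

Lemma Rpower_minus_1 (x e : R) : 0 < x -> Rpower x (e - 1) = Rpower x e / x.
Proof.
  intros Hx; unfold Rminus; rewrite Rpower_plus, Rpower_Ropp, Rpower_1 by exact Hx.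
  reflexivity.
Qed.

Lemma pow_N_Rpower (r : R) : 0 < r -> r ^ N = Rpower r (nu - 1).
Proof. intros Hr; rewrite <- INR_N, Rpower_pow by exact Hr; reflexivity. Qed.

Section Expansion.
Variables (ell rho c1 c2 c0 : R).
Hypotheses (hrho : 0 < rho <= 1) (hc1 : 0 < c1)
  (hK' : forall r, 0 < r <= rho -> c1 * Rpower r (ell - 1) <= K' r <= c2 * Rpower r (ell - 1))
  (hc0 : 0 < c0)
  (hhalf : forall de u r, 0 < de -> psol (Rpower de (- al)) u -> 0 <= r <= rho -> r <= c0 * de ->
     Rpower de (- al) / 2 <= u r).

Lemma K'_nonneg (r : R) : 0 < r <= rho -> 0 <= K' r.
Proof.
  intros Hr; eapply Rle_trans; [|apply hK', Hr].
  apply Rmult_le_pos; [lra|apply Rlt_le, exp_pos].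
Qed.

Lemma K_ge (r : R) : 0 <= r <= rho -> K 0 <= ext K r.
Proof.
  intros Hr; rewrite <- (ext_eq K 0) by lra.
  assert (H : 0 - 0 <= ext K r - ext K 0); [|lra].
  apply (increment_le (fun _ => 0) (fun _ => 0) (ext K) K').
  - lra.
  - intros; apply (is_derive_const 0).
  - intros; apply continuous_const.
  - intros; apply is_derive_ext_pos; lra.
  - intros; apply cK.
  - intros; apply K'_nonneg; lra.
Qed.

(** In the core r <= c0 de the solution exceeds d/2 and K >= K(0), so the flux leaving it is at
    least of order d^(q-1) de^n = de^al; further out the flux can only grow. *)
Lemma flux_lower : exists cW, 0 < cW /\ forall de u r, 0 < de -> c0 * de <= rho ->
  psol (Rpower de (- al)) u -> c0 * de <= r ->
  cW * Rpower de al <= flux N (source (Rmax 0) u) r.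
Proof.
  assert (HK0 := hKpos 0 (Rle_refl 0)).
  assert (Hn := nu_ge_2). assert (Hq := q_crit_ge_2).
  exists (K 0 * Rpower (/ 2) (q - 1) * Rpower c0 nu / nu); split.
  { apply Rdiv_lt_0_compat; [|lra]; repeat apply Rmult_lt_0_compat; try apply exp_pos; exact HK0. }
  intros de u r Hde Hrho Hps Hr.
  set (g := source (Rmax 0) u).
  assert (Cg : forall t, continuous g t) by (intros; apply (continuous_psol_source _ u _ Hps)).
  set (r0 := c0 * de) in *.
  assert (Hr0 : 0 < r0) by (apply Rmult_lt_0_compat; lra).
  apply Rle_trans with (flux N g r0).
  2:{ apply flux_incr; [lra|exact Cg|]. intros; apply psol_source_nonneg. }
  set (d := Rpower de (- al)) in *.
  assert (Hd : 0 < d) by apply exp_pos.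
  set (g0 := K 0 * Rpower (d / 2) (q - 1)).
  assert (Hg0 : forall t, 0 <= t <= r0 -> g0 <= g t).
  { intros t Ht; assert (Hu := hhalf de u t Hde Hps ltac:(lra) ltac:(unfold r0 in *; lra)).
    unfold g, source, g0; rewrite Rmax_right by (fold d in Hu; lra).
    apply Rmult_le_compat; [lra|apply Rlt_le, exp_pos|apply K_ge; lra|].
    rewrite spow_pos_eq by (fold d in Hu; lra).
    apply Rpower_le_base; [lra|]. fold d in Hu; lra. }
  assert (H : g0 * (r0 ^ n / nu) - g0 * (0 ^ n / nu) <= flux N g r0 - flux N g 0).
  { apply (increment_le (fun x => g0 * (x ^ n / nu)) (fun x => g0 * x ^ N) (flux N g) (fun x => x ^ N * g x)).
    - lra.
    - intros x Hx; auto_derive; [exact I|]. replace (pred n) with N by lia. field; lra.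
    - intros x _; apply (ex_derive_continuous (fun x => g0 * (x ^ n / nu))); auto_derive; exact I.
    - intros; apply is_derive_flux, Cg.
    - intros; eapply is_derive_continuous, is_derive_flux, Cg.
    - intros x Hx; rewrite Rmult_comm; apply Rmult_le_compat_l; [apply pow_le; lra|apply Hg0; lra]. }
  rewrite flux_0, pow_ne_zero in H by (intros E; rewrite E in hpn; simpl in hpn; lra).
  replace (K 0 * Rpower (/ 2) (q - 1) * Rpower c0 nu / nu * Rpower de al)
    with (g0 * (r0 ^ n / nu)); [lra|].
  assert (E : Rpower de al = Rpower d (q - 1) * Rpower de nu).
  { unfold d; rewrite Rpower_mult, <- Rpower_plus; f_equal; exponents. }
  rewrite E; unfold g0; replace (d / 2) with (d * / 2) by reflexivity.
  rewrite <- (Rpower_mult_distr d (/ 2)) by lra.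
  rewrite <- (Rpower_pow n r0) by exact Hr0.
  unfold r0; rewrite <- (Rpower_mult_distr c0 de) by lra.
  field; lra.
Qed.

Lemma vel_lower : exists cW, 0 < cW /\ forall de u r, 0 < de -> c0 * de <= rho ->
  psol (Rpower de (- al)) u -> c0 * de <= r ->
  cW * Rpower de al <= flux N (source (Rmax 0) u) r /\
  cW * Rpower de al * Rpower r (- (nu - 1)) <= vel N (source (Rmax 0) u) r.
Proof.
  destruct flux_lower as [cW [HcW H]]; exists cW; split; [exact HcW|].
  intros de u r Hde Hrho Hps Hr; specialize (H de u r Hde Hrho Hps Hr); split; [exact H|].
  assert (Hr0 : 0 < r) by (apply Rlt_le_trans with (c0 * de); [apply Rmult_lt_0_compat|]; lra).
  unfold vel; rewrite Rpower_Ropp, pow_N_Rpower by exact Hr0.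
  apply Rmult_le_compat_r; [apply Rlt_le, Rinv_0_lt_compat, exp_pos|exact H].
Qed.

Lemma pohozaev_nonneg (d R1 : R) (u : R -> R) : psol d u -> 0 <= R1 <= rho ->
  (forall r, 0 <= r < R1 -> 0 < u r) -> 0 <= pohozaev u R1.
Proof.
  intros Hps HR1 Hu.
  assert (Hq := q_crit_ge_2).
  assert (H : 0 - 0 <= pohozaev u R1 - pohozaev u 0); [|rewrite pohozaev_0 in H; lra].
  apply (increment_le (fun _ => 0) (fun _ => 0) (pohozaev u)
    (fun r => r ^ n * K' r * Rpower (u r) q / q)).
  - lra.
  - intros; apply (is_derive_const 0).
  - intros; apply continuous_const.
  - intros x Hx; apply (is_derive_pohozaev d); [exact Hps|lra|apply Hu; lra].
  - intros; apply (continuous_pohozaev d); exact Hps.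
  - intros x Hx; apply Rmult_le_pos; [|apply Rlt_le, Rinv_0_lt_compat; lra].
    apply Rmult_le_pos; [|apply Rlt_le, exp_pos].
    apply Rmult_le_pos; [apply pow_le; lra|apply K'_nonneg; lra].
Qed.

(* The derivative of v/(r u^m) has the sign of the Pohozaev function; the quotient is constant
   along the explicit solutions for constant K. *)
Lemma bubble_quotient_incr (d r0 r : R) (u : R -> R) : 0 < d -> psol d u -> 0 < r0 <= r -> r <= rho ->
  0 < u r ->
  let v := vel N (source (Rmax 0) u) in
  v r0 / (r0 * Rpower (u r0) (q / pc)) <= v r / (r * Rpower (u r) (q / pc)).
Proof.
  intros Hd Hps Hr0 Hr Hur v.
  assert (Hpc := conj_exp_ge_2). assert (Hq := q_crit_ge_2).
  set (g := source (Rmax 0) u) in *.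
  assert (Cg : forall t, continuous g t) by (intros; apply (continuous_psol_source d u _ Hps)).
  assert (Hu : forall x, 0 <= x <= r -> 0 < u x).
  { intros x Hx; apply Rlt_le_trans with (u r); [exact Hur|]. apply (psol_decr d); [exact Hps|lra]. }
  set (m := q / pc).
  set (G := fun x => v x / (x * Rpower (u x) m)).
  set (dG := fun x => ((g x - INR N * v x / x) * (x * Rpower (u x) m)
    - v x * (1 * Rpower (u x) m + x * (- spow pc (v x) * (m * Rpower (u x) (m - 1)))))
    / (x * Rpower (u x) m) ^ 2).
  assert (HG : forall x, 0 < x <= r -> is_derive G x (dG x)).
  { intros x Hx.
    assert (Hux := Hu x ltac:(lra)).
    assert (dv : is_derive v x (g x - INR N * v x / x)).
    { apply is_derive_vel; [apply N_ge_1|lra|exact Cg]. }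
    assert (du := is_derive_psol d u x Hps ltac:(lra)); fold g v in du.
    assert (dum := is_derive_comp (fun y => Rpower y m) u x _ _ (is_derive_Rpower m (u x) Hux) du).
    assert (dxu := is_derive_mult (fun y => y) _ x _ _ (is_derive_id x) dum Rmult_comm).
    apply (is_derive_div v (fun x => x * Rpower (u x) m) x _ _ dv dxu).
    apply Rgt_not_eq, Rmult_lt_0_compat; [lra|apply exp_pos]. }
  assert (Hinc : 0 - 0 <= G r - G r0); [|unfold G in Hinc; lra].
  apply (increment_le (fun _ => 0) (fun _ => 0) G dG).
  - lra.
  - intros; apply (is_derive_const 0).
  - intros; apply continuous_const.
  - intros; apply HG; lra.
  - intros x Hx; apply (is_derive_continuous G x (dG x)), HG; lra.
  - intros x Hx.
    assert (Hux := Hu x ltac:(lra)).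
    assert (HP : 0 <= pohozaev u x).
    { apply (pohozaev_nonneg d); [exact Hps|lra|]. intros; apply Hu; lra. }
    assert (HxN : 0 < x ^ N) by (apply pow_lt; lra).
    assert (Hum := Rpower_pos (u x) m).
    apply Rmult_le_pos; [|apply Rlt_le, Rinv_0_lt_compat, pow_lt, Rmult_lt_0_compat; lra].
    assert (EP : (g x - INR N * v x / x) * (x * Rpower (u x) m)
      - v x * (1 * Rpower (u x) m + x * (- spow pc (v x) * (m * Rpower (u x) (m - 1))))
      = Rpower (u x) m / (x ^ N * u x) * (q * pohozaev u x)).
    { unfold pohozaev; fold g v.
      assert (Egx : g x = ext K x * spow q (u x)).
      { unfold g, source; rewrite Rmax_right by lra; reflexivity. }
      assert (EF : flux N g x = x ^ N * v x) by (unfold v, vel; field; lra).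
      assert (Exn : x ^ n = x * x ^ N).
      { replace n with (S N) at 1 by (assert (H := N_ge_1); lia). reflexivity. }
      rewrite Rpower_minus_1, EF, Exn, INR_N, Egx by exact Hux.
      set (V := v x); set (U := u x) in *; set (X := spow pc V); set (Y := spow q U);
        set (RN := x ^ N) in *; set (W := Rpower U m).
      unfold m, q_crit, conj_exp; field; repeat split; lra. }
    rewrite EP; apply Rmult_le_pos; [|apply Rmult_le_pos; lra].
    apply Rlt_le, Rdiv_lt_0_compat; [exact Hum|]. apply Rmult_lt_0_compat; lra.
Qed.

(** The monotone quotient is at least cG/de at the edge of the core, which is a differential
    inequality for u. It integrates best for z = u^(-1/al), which is affine in r^pc along the
    explicit solutions: z >= k de^(-be) r^pc. The claim follows from u^q = z^(-n). *)
Lemma bubble_upper : exists CB, 0 < CB /\ forall de u r, 0 < de -> c0 * de <= rho ->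
  psol (Rpower de (- al)) u -> c0 * de <= r <= rho -> 0 < u r ->
  Rpower (u r) q <= CB * Rpower de (nu * be) * Rpower r (- (nu * pc)).
Proof.
  destruct vel_lower as [cW [HcW Hvel]].
  assert (Hpc := conj_exp_ge_2). assert (Hq := q_crit_ge_2). assert (Hn := nu_ge_2).
  assert (Hal := al_pos). assert (Hbe := be_ge_1).
  set (cG := cW * Rpower c0 (- nu)).
  assert (HcG : 0 < cG) by (apply Rmult_lt_0_compat; [exact HcW|apply exp_pos]).
  (* The first entry makes the differential inequality for z hold; the second gives k de^(-be) r0^pc
     <= de <= z(r0), so the initial values may be dropped after integration. *)
  set (k := Rmin (Rpower cG be / (al * pc)) (Rpower c0 (- pc))).
  assert (Hk : 0 < k).
  { apply Rmin_pos; [|apply exp_pos]. apply Rdiv_lt_0_compat; [apply exp_pos|].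
    apply Rmult_lt_0_compat; lra. }
  exists (Rpower k (- nu)); split; [apply exp_pos|].
  intros de u r Hde Hrho Hps Hr Hur.
  set (d := Rpower de (- al)) in *.
  assert (Hd : 0 < d) by apply exp_pos.
  set (g := source (Rmax 0) u) in *.
  set (v := vel N g) in *.
  set (r0 := c0 * de) in *.
  assert (Hr0 : 0 < r0) by (apply Rmult_lt_0_compat; lra).
  assert (Hu : forall x, 0 <= x <= r -> 0 < u x).
  { intros x Hx; apply Rlt_le_trans with (u r); [exact Hur|]. apply (psol_decr d); [exact Hps|lra]. }
  set (m := q / pc).
  assert (Hm : 0 <= m) by (apply Rlt_le, Rdiv_lt_0_compat; lra).
  assert (HG0 : cG * / de <= v r0 / (r0 * Rpower (u r0) m)).
  { destruct (Hvel de u r0 Hde Hrho Hps (Rle_refl _)) as [_ Hv0]; fold g v in Hv0.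
    apply Rle_trans with (cW * Rpower de al * Rpower r0 (- (nu - 1)) / (r0 * Rpower d m)).
    - assert (E1 : Rpower r0 (- (nu - 1)) = r0 * (Rpower c0 (- nu) * Rpower de (- nu))).
      { rewrite Rpower_mult_distr by lra; fold r0.
        rewrite <- (Rpower_1 r0) at 2 by exact Hr0. rewrite <- Rpower_plus; f_equal; ring. }
      assert (E2 : / de * Rpower d m = Rpower de al * Rpower de (- nu)).
      { rewrite <- (Rpower_1 de) at 1 by exact Hde.
        unfold d; rewrite <- Rpower_Ropp, Rpower_mult, <- !Rpower_plus; f_equal; unfold m; exponents. }
      assert (Hdm := Rpower_pos d m).
      apply Req_le; rewrite E1; unfold cG.
      replace (cW * Rpower de al * (r0 * (Rpower c0 (- nu) * Rpower de (- nu))))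
        with (cW * Rpower c0 (- nu) * r0 * (Rpower de al * Rpower de (- nu))) by ring.
      rewrite <- E2; field; repeat split; lra.
    - unfold Rdiv; apply Rmult_le_compat.
      + apply Rmult_le_pos; [|apply Rlt_le, exp_pos].
        apply Rmult_le_pos; [lra|apply Rlt_le, exp_pos].
      + apply Rlt_le, Rinv_0_lt_compat, Rmult_lt_0_compat; [exact Hr0|apply exp_pos].
      + exact Hv0.
      + apply Rinv_le_contravar; [apply Rmult_lt_0_compat; [exact Hr0|apply exp_pos]|].
        apply Rmult_le_compat_l; [lra|]. apply Rpower_le_base; [exact Hm|].
        split; [apply Hu; lra|apply (psol_le d); [exact Hps|lra]]. }
  assert (Hv : forall x, r0 <= x <= r -> cG * / de * (x * Rpower (u x) m) <= v x).
  { intros x Hx.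
    assert (HQ := bubble_quotient_incr d r0 x u Hd Hps ltac:(lra) ltac:(lra) (Hu x ltac:(lra))).
    cbv zeta in HQ; fold g v m in HQ.
    assert (Hxm : 0 < x * Rpower (u x) m) by (apply Rmult_lt_0_compat; [lra|apply exp_pos]).
    apply Rmult_le_reg_r with (/ (x * Rpower (u x) m)); [apply Rinv_0_lt_compat, Hxm|].
    rewrite Rmult_assoc, Rinv_r, Rmult_1_r by lra. unfold Rdiv in *; lra. }
  set (z := fun x => Rpower (u x) (- / al)).
  assert (Hz : k * Rpower de (- be) * Rpower r pc - k * Rpower de (- be) * Rpower r0 pc <= z r - z r0).
  { apply (increment_le (fun x => k * Rpower de (- be) * Rpower x pc)
      (fun x => k * Rpower de (- be) * (pc * Rpower x (pc - 1))) z
      (fun x => - spow pc (v x) * (- / al * Rpower (u x) (- / al - 1)))).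
    - lra.
    - intros x Hx; apply (is_derive_scal (fun x => Rpower x pc)), is_derive_Rpower; lra.
    - intros x Hx; eapply is_derive_continuous.
      apply (is_derive_scal (fun x => Rpower x pc)), is_derive_Rpower; lra.
    - intros x Hx; apply (is_derive_comp (fun y => Rpower y (- / al)) u).
      + apply is_derive_Rpower, Hu; lra.
      + apply (is_derive_psol d); [exact Hps|lra].
    - intros x Hx; eapply is_derive_continuous.
      apply (is_derive_comp (fun y => Rpower y (- / al)) u).
      + apply is_derive_Rpower, Hu; lra.
      + apply (is_derive_psol d); [exact Hps|lra].
    - intros x Hx.
      assert (Hux := Hu x ltac:(lra)).
      assert (Hde' : 0 < / de) by (apply Rinv_0_lt_compat, Hde).
      assert (Hb : 0 < cG * / de * (x * Rpower (u x) m)).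
      { repeat apply Rmult_lt_0_compat; try lra; apply exp_pos. }
      assert (Hvb : Rpower (cG * / de * (x * Rpower (u x) m)) be <= spow pc (v x)).
      { specialize (Hv x ltac:(lra)). rewrite spow_pos_eq by lra. apply Rpower_le_base; lra. }
      replace (- spow pc (v x) * (- / al * Rpower (u x) (- / al - 1)))
        with (/ al * Rpower (u x) (- / al - 1) * spow pc (v x)) by ring.
      apply Rle_trans with (/ al * Rpower (u x) (- / al - 1) * Rpower (cG * / de * (x * Rpower (u x) m)) be).
      2:{ apply Rmult_le_compat_l; [|exact Hvb].
          apply Rmult_le_pos; [apply Rlt_le, Rinv_0_lt_compat, Hal|apply Rlt_le, exp_pos]. }
      rewrite <- !Rpower_mult_distr; try apply exp_pos; try lra;
        try (apply Rmult_lt_0_compat; [lra|apply exp_pos]);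
        try (apply Rmult_lt_0_compat; lra).
      rewrite Rpower_mult.
      replace (/ al * Rpower (u x) (- / al - 1) *
        (Rpower cG be * Rpower (/ de) be * (Rpower x be * Rpower (u x) (m * be))))
        with (Rpower cG be / (al * pc) * (pc * Rpower (/ de) be * Rpower x be)
          * (Rpower (u x) (- / al - 1) * Rpower (u x) (m * be))) by (field; lra).
      rewrite <- (Rpower_plus (- / al - 1)).
      replace (- / al - 1 + m * be) with 0 by (unfold m; exponents).
      rewrite Rpower_O, Rmult_1_r by exact Hux.
      replace (Rpower (/ de) be) with (Rpower de (- be)).
      2:{ rewrite <- (Rpower_1 de) at 2 by exact Hde.
          rewrite <- Rpower_Ropp, Rpower_mult; f_equal; ring. }
      replace (k * Rpower de (- be) * (pc * Rpower x (pc - 1)))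
        with (k * (pc * Rpower de (- be) * Rpower x (pc - 1))) by ring.
      apply Rmult_le_compat_r; [|apply Rmin_l].
      apply Rmult_le_pos; [|apply Rlt_le, exp_pos].
      apply Rmult_le_pos; [lra|apply Rlt_le, exp_pos]. }
  assert (Hz0 : de <= z r0).
  { apply Rle_trans with (Rpower d (- / al)).
    - unfold d; rewrite Rpower_mult; replace (- al * - / al) with 1 by (field; split; lra).
      rewrite Rpower_1; lra.
    - apply Rpower_anti; [apply Rinv_0_lt_compat, Hal|].
      split; [apply Hu; lra|apply (psol_le d); [exact Hps|lra]]. }
  assert (Hkr0 : k * Rpower de (- be) * Rpower r0 pc <= de).
  { apply Rle_trans with (Rpower c0 (- pc) * Rpower de (- be) * Rpower r0 pc).
    - apply Rmult_le_compat_r; [apply Rlt_le, exp_pos|].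
      apply Rmult_le_compat_r; [apply Rlt_le, exp_pos|apply Rmin_r].
    - apply Req_le; unfold r0; rewrite <- Rpower_mult_distr by lra.
      replace (Rpower c0 (- pc) * Rpower de (- be) * (Rpower c0 pc * Rpower de pc))
        with ((Rpower c0 (- pc) * Rpower c0 pc) * (Rpower de (- be) * Rpower de pc)) by ring.
      rewrite <- !Rpower_plus; replace (- pc + pc) with 0 by ring.
      replace (- be + pc) with 1 by ring. rewrite Rpower_O, Rpower_1 by lra; ring. }
  assert (Hzr : k * Rpower de (- be) * Rpower r pc <= z r) by lra.
  assert (Hkr : 0 < k * Rpower de (- be) * Rpower r pc).
  { repeat apply Rmult_lt_0_compat; try apply exp_pos; exact Hk. }
  replace (Rpower (u r) q) with (Rpower (z r) (- nu)).
  2:{ unfold z; rewrite Rpower_mult; f_equal. exponents. }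
  apply Rle_trans with (Rpower (k * Rpower de (- be) * Rpower r pc) (- nu)).
  - apply Rpower_anti; lra.
  - apply Req_le. rewrite <- !Rpower_mult_distr; try apply exp_pos; try exact Hk;
      try (apply Rmult_lt_0_compat; [exact Hk|apply exp_pos]).
    rewrite !Rpower_mult; f_equal; [f_equal|]; f_equal; ring.
Qed.

(** * Large data: bounds for the Pohozaev function *)

Lemma pow_n_Rpower (r : R) : 0 < r -> r ^ n = Rpower r nu.
Proof. intros Hr; rewrite Rpower_pow by exact Hr; reflexivity. Qed.

Lemma c2_pos : 0 < c2.
Proof.
  destruct (hK' rho ltac:(lra)) as [H1 H2]; assert (H := Rpower_pos rho (ell - 1)).
  apply Rlt_le_trans with c1; [exact hc1|].
  apply Rmult_le_reg_r with (Rpower rho (ell - 1)); lra.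
Qed.

(** As rho <= 1, the exponent ell may be lowered to e. This keeps e strictly below n/(p-1) even when
    ell equals it. *)
Lemma weight_upper (e x : R) : e <= ell -> 0 < x <= rho ->
  x ^ n * K' x <= c2 * Rpower x (nu + e - 1).
Proof.
  intros He Hx; assert (H2 := c2_pos).
  rewrite pow_n_Rpower by lra.
  replace (c2 * Rpower x (nu + e - 1)) with (Rpower x nu * (c2 * Rpower x (e - 1))).
  2:{ replace (nu + e - 1) with (nu + (e - 1)) by ring.
      rewrite (Rpower_plus nu (e - 1) x); ring. }
  apply Rmult_le_compat_l; [apply Rlt_le, exp_pos|].
  eapply Rle_trans; [apply hK', Hx|]; apply Rmult_le_compat_l; [lra|].
  unfold Rpower.
  assert (Hl : ln x <= 0) by (rewrite <- ln_1; destruct (proj2 Hx) as [H|H];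
    [apply Rlt_le, ln_increasing; lra|destruct (proj2 hrho) as [H'|H'];
     [apply Rlt_le, ln_increasing; lra|rewrite H, H'; lra]]).
  assert (Hle : (ell - 1) * ln x <= (e - 1) * ln x) by nra.
  destruct Hle as [Hle|Hle]; [apply Rlt_le, exp_increasing, Hle|rewrite Hle; lra].
Qed.

(** P' is integrated over three zones with constants C1, C2, C3: the core r <= c0 de, where u <= d;
    then up to rho, where [bubble_upper] applies and e < n/(p-1) makes the inner end dominate; then
    up to M, where u <= u(rho) and the contribution de^(n/(p-1)) is at most de^e since de <= 1. *)
Lemma pohozaev_upper (e M : R) : 0 < e -> e <= ell -> e < nu * be -> rho <= M ->
  exists C, 0 < C /\ forall de u R1, 0 < de <= 1 -> c0 * de <= rho ->
    psol (Rpower de (- al)) u -> 0 < R1 <= M -> (forall r, 0 <= r < R1 -> 0 < u r) ->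
    pohozaev u R1 <= C * Rpower de e.
Proof.
  intros He Hell Henu HM.
  destruct bubble_upper as [CB [HCB Hbub]].
  destruct (continuous_bounded (ext K') M ltac:(lra) cK') as [Km [HKm BK]].
  assert (Hq := q_crit_ge_2). assert (Hn := nu_ge_2). assert (H2 := c2_pos).
  set (kap := nu * be - e).
  assert (Hkap : 0 < kap) by (unfold kap; lra).
  set (C1 := c2 / q * Rpower c0 (nu + e)).
  set (C2 := c2 * CB / q / kap * Rpower c0 (- kap)).
  set (C3 := M ^ n * Km * (CB * Rpower rho (- (nu * pc))) / q * M).
  assert (HC1 : 0 < C1).
  { apply Rmult_lt_0_compat; [apply Rdiv_lt_0_compat; lra|apply exp_pos]. }
  assert (HC2 : 0 < C2).
  { apply Rmult_lt_0_compat; [|apply exp_pos].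
    apply Rdiv_lt_0_compat; [apply Rdiv_lt_0_compat; [apply Rmult_lt_0_compat|]|]; lra. }
  assert (HC3 : 0 < C3).
  { apply Rmult_lt_0_compat; [|lra]; apply Rdiv_lt_0_compat; [|lra].
    apply Rmult_lt_0_compat; [apply Rmult_lt_0_compat; [apply pow_lt; lra|exact HKm]|].
    apply Rmult_lt_0_compat; [exact HCB|apply exp_pos]. }
  exists (C1 + C2 + C3); split; [lra|].
  intros de u R1 Hde Hrho Hps HR1 Hu.
  set (d := Rpower de (- al)) in *.
  assert (Hd : 0 < d) by apply exp_pos.
  set (r0 := c0 * de) in *.
  assert (Hr0 : 0 < r0) by (apply Rmult_lt_0_compat; lra).
  assert (Hdee := Rpower_pos de e).
  set (dP := fun r => r ^ n * K' r * Rpower (u r) q / q).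
  assert (DP : forall x, 0 < x < R1 -> is_derive (pohozaev u) x (dP x)).
  { intros x Hx; apply (is_derive_pohozaev d); [exact Hps|lra|apply Hu; lra]. }
  assert (CP : forall x, continuous (pohozaev u) x) by (intros; apply (continuous_pohozaev d), Hps).
  assert (step : forall a b H h, 0 <= a <= b -> b <= R1 ->
    (forall x, a < x < b -> is_derive H x (h x)) -> (forall x, a <= x <= b -> continuous H x) ->
    (forall x, a < x < b -> dP x <= h x) -> pohozaev u b - pohozaev u a <= H b - H a).
  { intros a b H h Hab HbR HH CH Hle.
    apply (increment_le (pohozaev u) dP H h); auto; [lra|]. intros x Hx; apply DP; lra. }
  assert (Udq : forall x, 0 <= x < R1 -> Rpower (u x) q <= Rpower de (- nu)).
  { intros x Hx; apply Rle_trans with (Rpower d q).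
    - apply Rpower_le_base; [lra|]. split; [apply Hu, Hx|apply (psol_le d); [exact Hps|lra]].
    - apply Req_le; unfold d; rewrite Rpower_mult; f_equal. exponents. }
  assert (S1 : forall s, 0 <= s <= r0 -> s <= R1 -> pohozaev u s <= C1 * Rpower de e).
  { intros s Hs HsR.
    set (c := c2 / q * Rpower r0 (nu + e - 1) * Rpower de (- nu)).
    assert (Hc : 0 <= c).
    { apply Rmult_le_pos; [|apply Rlt_le, exp_pos].
      apply Rmult_le_pos; [apply Rlt_le, Rdiv_lt_0_compat; lra|apply Rlt_le, exp_pos]. }
    assert (H : pohozaev u s - pohozaev u 0 <= c * s - c * 0).
    { apply (step 0 s (fun x => c * x) (fun _ => c)); try lra.
      - intros x _; auto_derive; [exact I|ring].
      - intros x _; apply (ex_derive_continuous (fun x => c * x)); auto_derive; exact I.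
      - intros x Hx; unfold dP, c.
        assert (W := weight_upper e x Hell ltac:(lra)).
        assert (W' : Rpower x (nu + e - 1) <= Rpower r0 (nu + e - 1)) by (apply Rpower_le_base; lra).
        assert (W'' : x ^ n * K' x <= c2 * Rpower r0 (nu + e - 1)).
        { eapply Rle_trans; [exact W|]; apply Rmult_le_compat_l; lra. }
        replace (c2 / q * Rpower r0 (nu + e - 1) * Rpower de (- nu))
          with ((c2 * Rpower r0 (nu + e - 1)) * Rpower de (- nu) / q) by (field; lra).
        apply Rmult_le_compat_r; [apply Rlt_le, Rinv_0_lt_compat; lra|].
        apply Rmult_le_compat; [|apply Rlt_le, exp_pos|exact W''|apply Udq; lra].
        apply Rmult_le_pos; [apply pow_le; lra|apply K'_nonneg; lra]. }
    rewrite pohozaev_0 in H.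
    apply Rle_trans with (c * r0); [assert (c * s <= c * r0) by (apply Rmult_le_compat_l; lra); lra|].
    apply Req_le; unfold c, C1.
    rewrite Rpower_minus_1 by exact Hr0.
    assert (E : Rpower r0 (nu + e) = Rpower c0 (nu + e) * (Rpower de nu * Rpower de e)).
    { unfold r0; rewrite <- Rpower_plus, Rpower_mult_distr by lra; reflexivity. }
    assert (Ed : Rpower de nu * Rpower de (- nu) = 1).
    { rewrite <- Rpower_plus, Rplus_opp_r; apply Rpower_O; lra. }
    rewrite E.
    replace (c2 / q * (Rpower c0 (nu + e) * (Rpower de nu * Rpower de e) / r0) * Rpower de (- nu) * r0)
      with (c2 / q * Rpower c0 (nu + e) * Rpower de e * (Rpower de nu * Rpower de (- nu))) by (field; lra).
    rewrite Ed; ring. }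
  assert (S2 : forall s, r0 <= s <= rho -> s <= R1 ->
    pohozaev u s <= C1 * Rpower de e + C2 * Rpower de e).
  { intros s Hs HsR.
    assert (H1 := S1 r0 ltac:(lra) ltac:(lra)).
    set (c := c2 * CB / q * Rpower de (nu * be)).
    assert (Hc : 0 < c).
    { apply Rmult_lt_0_compat; [|apply exp_pos]. apply Rdiv_lt_0_compat; [|lra].
      apply Rmult_lt_0_compat; lra. }
    assert (H : pohozaev u s - pohozaev u r0 <=
      - c / kap * Rpower s (- kap) - - c / kap * Rpower r0 (- kap)).
    { apply (step r0 s (fun x => - c / kap * Rpower x (- kap))
        (fun x => - c / kap * (- kap * Rpower x (- kap - 1)))); try lra.
      - intros x Hx; apply (is_derive_scal (fun x => Rpower x (- kap))), is_derive_Rpower; lra.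
      - intros x Hx; eapply is_derive_continuous.
        apply (is_derive_scal (fun x => Rpower x (- kap))), is_derive_Rpower; lra.
      - intros x Hx; unfold dP.
        assert (W := weight_upper e x Hell ltac:(lra)).
        assert (B := Hbub de u x ltac:(lra) Hrho Hps ltac:(fold r0; lra) (Hu x ltac:(lra))).
        apply Rle_trans with (c2 * Rpower x (nu + e - 1)
          * (CB * Rpower de (nu * be) * Rpower x (- (nu * pc))) / q).
        + apply Rmult_le_compat_r; [apply Rlt_le, Rinv_0_lt_compat; lra|].
          apply Rmult_le_compat; [|apply Rlt_le, exp_pos|exact W|exact B].
          apply Rmult_le_pos; [apply pow_le; lra|apply K'_nonneg; lra].
        + apply Req_le.
          replace (- kap - 1) with ((nu + e - 1) + - (nu * pc)) by (unfold kap; ring).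
          rewrite Rpower_plus; unfold c. field. lra. }
    assert (Hs' : 0 <= c / kap * Rpower s (- kap)).
    { apply Rmult_le_pos; [apply Rlt_le, Rdiv_lt_0_compat; lra|apply Rlt_le, exp_pos]. }
    assert (E : c / kap * Rpower r0 (- kap) = C2 * Rpower de e).
    { unfold c, C2, r0; rewrite <- Rpower_mult_distr by lra.
      replace (Rpower de e) with (Rpower de (nu * be) * Rpower de (- kap))
        by (rewrite <- Rpower_plus; f_equal; unfold kap; ring).
      field; lra. }
    unfold Rdiv in *; lra. }
  assert (Hfin : pohozaev u R1 <= C1 * Rpower de e + C2 * Rpower de e + C3 * Rpower de e).
  { assert (P2 : 0 < C2 * Rpower de e) by (apply Rmult_lt_0_compat; assumption).
    assert (P3 : 0 < C3 * Rpower de e) by (apply Rmult_lt_0_compat; assumption).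
    destruct (Rle_dec R1 r0) as [A|A].
    { specialize (S1 R1 ltac:(lra) ltac:(lra)); lra. }
    destruct (Rle_dec R1 rho) as [B|B].
    { specialize (S2 R1 ltac:(lra) ltac:(lra)); lra. }
    specialize (S2 rho ltac:(lra) ltac:(lra)).
    assert (B' := Hbub de u rho ltac:(lra) Hrho Hps ltac:(fold r0; lra) (Hu rho ltac:(lra))).
    set (c := M ^ n * Km * (CB * Rpower de (nu * be) * Rpower rho (- (nu * pc))) / q).
    assert (Hc : 0 < c).
    { apply Rdiv_lt_0_compat; [|lra].
      apply Rmult_lt_0_compat; [apply Rmult_lt_0_compat; [apply pow_lt; lra|exact HKm]|].
      apply Rmult_lt_0_compat; [|apply exp_pos].
      apply Rmult_lt_0_compat; [exact HCB|apply exp_pos]. }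
    assert (H : pohozaev u R1 - pohozaev u rho <= c * R1 - c * rho).
    { apply (step rho R1 (fun x => c * x) (fun _ => c)); try lra.
      - intros x _; auto_derive; [exact I|ring].
      - intros x _; apply (ex_derive_continuous (fun x => c * x)); auto_derive; exact I.
      - intros x Hx; unfold dP, c.
        apply Rmult_le_compat_r; [apply Rlt_le, Rinv_0_lt_compat; lra|].
        apply Rle_trans with (M ^ n * Km * Rpower (u x) q).
        + apply Rmult_le_compat_r; [apply Rlt_le, exp_pos|].
          apply Rle_trans with (x ^ n * Km).
          * apply Rmult_le_compat_l; [apply pow_le; lra|].
            specialize (BK x ltac:(lra)); rewrite ext_eq in BK by lra.
            assert (H := Rle_abs (K' x)); lra.
          * apply Rmult_le_compat_r; [lra|]. apply pow_incr; lra.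
        + apply Rmult_le_compat_l.
          * apply Rmult_le_pos; [apply pow_le; lra|lra].
          * eapply Rle_trans; [|exact B']. apply Rpower_le_base; [lra|].
            split; [apply Hu; lra|apply (psol_decr d); [exact Hps|lra]]. }
    assert (Hde' : Rpower de (nu * be) <= Rpower de e).
    { unfold Rpower.
      assert (Hl : ln de <= 0).
      { rewrite <- ln_1; destruct (proj2 Hde) as [H'|H'];
          [apply Rlt_le, ln_increasing; lra|rewrite H'; lra]. }
      assert (Hle : nu * be * ln de <= e * ln de) by nra.
      destruct Hle as [Hle|Hle]; [apply Rlt_le, exp_increasing, Hle|rewrite Hle; lra]. }
    assert (HcM : c * M <= C3 * Rpower de e).
    { unfold c, C3.
      replace (M ^ n * Km * (CB * Rpower de (nu * be) * Rpower rho (- (nu * pc))) / q * M)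
        with (C3 * Rpower de (nu * be)) by (unfold C3; field; lra).
      fold C3; apply Rmult_le_compat_l; lra. }
    assert (c * R1 <= c * M) by (apply Rmult_le_compat_l; lra).
    assert (0 < c * rho) by (apply Rmult_lt_0_compat; lra).
    lra. }
  lra.
Qed.

(** Where u vanishes only R1^n v^pc / pc survives, and the lower bound on v turns it into de^ls
    R1^(n - (n-1) pc), with n - (n-1) pc = -ls. *)
Lemma pohozaev_at_zero : exists c, 0 < c /\ forall de u R1, 0 < de -> c0 * de <= rho ->
  psol (Rpower de (- al)) u -> 0 < R1 -> u R1 = 0 ->
  c * Rpower de ls * Rpower R1 (- ls) <= pohozaev u R1.
Proof.
  destruct vel_lower as [cW [HcW Hvel]].
  assert (Hpc := conj_exp_ge_2). assert (Hn := nu_ge_2).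
  exists (Rpower cW pc / pc); split; [apply Rdiv_lt_0_compat; [apply exp_pos|lra]|].
  intros de u R1 Hde Hrho Hps HR1 Hz.
  (* No zero lies in the core, where u is at least half its initial value. *)
  assert (Hr0 : c0 * de <= R1).
  { apply Rnot_lt_le; intros H.
    assert (A := hhalf de u R1 Hde Hps ltac:(lra) ltac:(lra)).
    assert (A' := Rpower_pos de (- al)); lra. }
  destruct (Hvel de u R1 Hde Hrho Hps Hr0) as [_ Hv].
  assert (HV0 : 0 < cW * Rpower de al * Rpower R1 (- (nu - 1))).
  { repeat apply Rmult_lt_0_compat; try apply exp_pos; exact HcW. }
  unfold pohozaev; rewrite Hz, spow_self_pos by lra.
  assert (Hvp : Rpower cW pc * Rpower de ls * Rpower R1 (- (nu - 1) * pc)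
    <= Rpower (vel N (source (Rmax 0) u) R1) pc).
  { apply Rle_trans with (Rpower (cW * Rpower de al * Rpower R1 (- (nu - 1))) pc).
    - apply Req_le; rewrite <- !Rpower_mult_distr; try apply exp_pos; try exact HcW;
        try (apply Rmult_lt_0_compat; [exact HcW|apply exp_pos]).
      rewrite !Rpower_mult, al_conj_exp; reflexivity.
    - apply Rpower_le_base; lra. }
  rewrite pow_n_Rpower by exact HR1.
  replace (Rpower R1 (- ls)) with (Rpower R1 nu * Rpower R1 (- (nu - 1) * pc)).
  2:{ rewrite <- Rpower_plus; f_equal. exponents. }
  apply Rle_trans with (Rpower R1 nu * (Rpower cW pc * Rpower de ls * Rpower R1 (- (nu - 1) * pc) / pc)).
  { apply Req_le; field; lra. }
  rewrite Rmult_0_l, !Rmult_0_r, Rminus_0_r. unfold Rdiv; rewrite Rmult_0_l, Rplus_0_r.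
  apply Rmult_le_compat_l; [apply Rlt_le, exp_pos|].
  apply Rmult_le_compat_r; [apply Rlt_le, Rinv_0_lt_compat; lra|exact Hvp].
Qed.

(** Both bounds on P are used at the first zero s <= R1, because the upper bound requires positivity
    before the point; the resulting estimate passes from s to R1 by monotonicity of the power. *)
Lemma first_zero_estimate (e M : R) : 0 < e -> e <= ell -> e < nu * be -> rho <= M ->
  exists C, 0 < C /\ forall de u R1, 0 < de <= 1 -> c0 * de <= rho ->
    psol (Rpower de (- al)) u -> 0 < R1 <= M -> u R1 <= 0 ->
    Rpower de ls <= C * Rpower de e * Rpower R1 ls.
Proof.
  intros He Hell Henu HM.
  destruct (pohozaev_upper e M He Hell Henu HM) as [C [HC Hup]].
  destruct pohozaev_at_zero as [c [Hc Hlow]].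
  assert (Hls := ls_pos).
  exists (C / c); split; [apply Rdiv_lt_0_compat; assumption|].
  intros de u R1 Hde Hrho Hps HR1 Hle.
  destruct (first_zero u R1) as [s [Hs [Hs0 Hbef]]].
  - lra.
  - apply Hps.
  - rewrite (psol_0 _ u Hps); apply exp_pos.
  - exact Hle.
  - assert (H1 := Hup de u s Hde Hrho Hps ltac:(lra) Hbef).
    assert (H2 := Hlow de u s ltac:(lra) Hrho Hps ltac:(lra) Hs0).
    assert (H : c * Rpower de ls * Rpower s (- ls) <= C * Rpower de e) by lra.
    rewrite Rpower_Ropp in H.
    assert (Hsl := Rpower_pos s ls).
    assert (HsR : Rpower s ls <= Rpower R1 ls) by (apply Rpower_le_base; lra).
    apply Rle_trans with (C / c * Rpower de e * Rpower s ls).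
    + apply (Rmult_le_compat_r (Rpower s ls)) in H; [|lra].
      rewrite Rmult_assoc, Rinv_l, Rmult_1_r in H by lra.
      apply (Rmult_le_compat_l (/ c)) in H; [|apply Rlt_le, Rinv_0_lt_compat, Hc].
      replace (/ c * (c * Rpower de ls)) with (Rpower de ls) in H by (field; lra).
      unfold Rdiv; lra.
    + apply Rmult_le_compat_l; [|exact HsR].
      apply Rmult_le_pos; [apply Rlt_le, Rdiv_lt_0_compat; lra|apply Rlt_le, exp_pos].
Qed.

(** The flux F does not decrease, so -u'(x) >= (F(r) x^(-(n-1)))^be = F(r)^be x^(-ls-1) for x >= r.
    Integration up to infinity is possible because u stays positive. *)
Lemma positive_decay (d r : R) (u : R -> R) : 0 < d -> psol d u -> (forall r, 0 <= r -> 0 < u r) ->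
  0 < r -> Rpower (flux N (source (Rmax 0) u) r) be * Rpower r (- ls) / ls <= u r.
Proof.
  intros Hd Hps Hu Hr.
  assert (Hls := ls_pos). assert (Hpc := conj_exp_ge_2). assert (Hn := nu_ge_2).
  set (g := source (Rmax 0) u).
  assert (Cg : forall t, continuous g t) by (intros; apply (continuous_psol_source d u _ Hps)).
  set (Fb := Rpower (flux N g r) be).
  assert (HFb : 0 < Fb) by apply exp_pos.
  assert (Hfl : 0 < flux N g r).
  { assert (Hv := psol_vel_pos d u r Hd Hps Hr); fold g in Hv.
    assert (HrN : 0 < r ^ N) by (apply pow_lt, Hr).
    replace (flux N g r) with (vel N g r * r ^ N) by (unfold vel; field; lra).
    apply Rmult_lt_0_compat; assumption. }
  assert (Hdec : forall T, r <= T -> Fb / ls * Rpower r (- ls) - Fb / ls * Rpower T (- ls) <= u r).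
  { intros T HT.
    assert (H : u T - u r <= Fb / ls * Rpower T (- ls) - Fb / ls * Rpower r (- ls)).
    { apply (increment_le u (fun x => - spow pc (vel N g x)) (fun x => Fb / ls * Rpower x (- ls))
        (fun x => Fb / ls * (- ls * Rpower x (- ls - 1)))).
      - exact HT.
      - intros x Hx; apply (is_derive_psol d); [exact Hps|lra].
      - intros; apply Hps.
      - intros x Hx; apply (is_derive_scal (fun x => Rpower x (- ls))), is_derive_Rpower; lra.
      - intros x Hx; eapply is_derive_continuous.
        apply (is_derive_scal (fun x => Rpower x (- ls))), is_derive_Rpower; lra.
      - intros x Hx.
        assert (Hx0 : 0 < x) by lra.
        assert (Hvx : flux N g r * Rpower x (- (nu - 1)) <= vel N g x).
        { unfold vel; rewrite Rpower_Ropp, pow_N_Rpower by exact Hx0.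
          apply Rmult_le_compat_r; [apply Rlt_le, Rinv_0_lt_compat, exp_pos|].
          apply flux_incr; [lra|exact Cg|]. intros; apply psol_source_nonneg. }
        assert (Hp0 : 0 < flux N g r * Rpower x (- (nu - 1))).
        { apply Rmult_lt_0_compat; [exact Hfl|apply exp_pos]. }
        assert (Hb : Fb * Rpower x (- ls - 1) <= spow pc (vel N g x)).
        { rewrite spow_pos_eq by lra.
          apply Rle_trans with (Rpower (flux N g r * Rpower x (- (nu - 1))) be).
          - rewrite <- Rpower_mult_distr by (try apply exp_pos; exact Hfl).
            rewrite Rpower_mult; apply Req_le; unfold Fb; f_equal; f_equal.
            assert (E := ls_be); lra.
          - apply Rpower_le_base; lra. }
        replace (Fb / ls * (- ls * Rpower x (- ls - 1))) with (- (Fb * Rpower x (- ls - 1)))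
          by (field; lra).
        lra. }
    assert (HuT := Hu T ltac:(lra)). lra. }
  apply Rnot_lt_le; intros Hlt.
  (* If the claim failed by e, a T with tail at most e/2 would contradict the estimate on [r, T]. *)
  set (e := Fb * Rpower r (- ls) / ls - u r).
  assert (He : 0 < e) by (unfold e; lra).
  set (X := e * ls / (2 * Fb)).
  assert (HX : 0 < X) by (apply Rdiv_lt_0_compat; [apply Rmult_lt_0_compat|]; lra).
  set (T := Rmax r (Rpower X (- / ls))).
  assert (HT : Rpower T (- ls) <= X).
  { apply Rle_trans with (Rpower (Rpower X (- / ls)) (- ls)).
    - apply Rpower_anti; [exact Hls|]. split; [apply exp_pos|apply Rmax_r].
    - rewrite Rpower_mult; replace (- / ls * - ls) with 1 by (field; lra).
      rewrite Rpower_1; lra. }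
  specialize (Hdec T (Rmax_l _ _)).
  assert (HXe : Fb / ls * X = e / 2) by (unfold X; field; lra).
  assert (Fb / ls * Rpower T (- ls) <= Fb / ls * X).
  { apply Rmult_le_compat_l; [apply Rlt_le, Rdiv_lt_0_compat; lra|exact HT]. }
  assert (Fb * Rpower r (- ls) / ls = Fb / ls * Rpower r (- ls)) by (field; lra).
  unfold e in *; lra.
Qed.

(* P' is compared with a multiple of 1/x: for ell = n/(p-1) nothing better is true. *)
Lemma crossing_exists : ell <= nu * be ->
  exists d u r, 0 < d /\ psol d u /\ 0 < r /\ u r <= 0.
Proof.
  intros Hell.
  destruct (Classical_Prop.classic (exists d u r, 0 < d /\ psol d u /\ 0 < r /\ u r <= 0))
    as [H|H]; [exact H|exfalso].
  assert (Hpos : forall d u, 0 < d -> psol d u -> forall r, 0 <= r -> 0 < u r).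
  { intros d u Hd Hps r Hr; apply Rnot_le_lt; intros Hle.
    destruct Hr as [Hr|<-]; [|rewrite (psol_0 d u Hps) in Hle; lra].
    apply H; exists d, u, r; auto. }
  destruct bubble_upper as [CB [HCB Hbub]].
  destruct flux_lower as [cW [HcW Hflux]].
  assert (Hq := q_crit_ge_2). assert (Hn := nu_ge_2). assert (Hls := ls_pos).
  assert (Hpc := conj_exp_ge_2). assert (Hal := al_pos). assert (Hbe := be_ge_1).
  set (c3 := Rpower (Rpower cW be / ls) q).
  assert (Hc3 : 0 < c3) by apply exp_pos.
  assert (HKr := ext_pos rho).
  set (C4 := rho ^ n * (ext K rho * (CB * Rpower rho (- (nu * pc))) / q)).
  assert (HC4 : 0 < C4).
  { apply Rmult_lt_0_compat; [apply pow_lt; lra|]. apply Rdiv_lt_0_compat; [|lra].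
    apply Rmult_lt_0_compat; [exact HKr|]. apply Rmult_lt_0_compat; [exact HCB|apply exp_pos]. }
  (* The lower bound for P(rho) has the factor ln(rho/r0), the upper bound does not. C5 is the value
     of this logarithm at which they balance, and de is chosen to make it C5 + 1. *)
  set (C5 := C4 * q / (c1 * c3)).
  assert (HC5 : 0 < C5).
  { apply Rdiv_lt_0_compat; apply Rmult_lt_0_compat; lra. }
  set (de := rho / c0 * exp (- C5 - 1)).
  assert (Hde : 0 < de).
  { apply Rmult_lt_0_compat; [apply Rdiv_lt_0_compat; lra|apply exp_pos]. }
  set (r0 := c0 * de).
  assert (Er0 : r0 = rho * exp (- C5 - 1)) by (unfold r0, de; field; lra).
  assert (Hr0 : 0 < r0) by (apply Rmult_lt_0_compat; lra).
  assert (Hr0rho : r0 < rho).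
  { assert (E : exp (- C5 - 1) < exp 0) by (apply exp_increasing; lra).
    rewrite exp_0 in E; rewrite Er0; nra. }
  assert (Hln : ln r0 = ln rho - C5 - 1).
  { rewrite Er0, ln_mult, ln_exp by (try apply exp_pos; lra). ring. }
  set (d := Rpower de (- al)).
  assert (Hd : 0 < d) by apply exp_pos.
  destruct (psol_exists d) as [u Hps].
  assert (Hu := Hpos d u Hd Hps).
  assert (Hdeb := Rpower_pos de (nu * be)).
  assert (Hulow : forall x, r0 <= x -> c3 * Rpower de (nu * be) * Rpower x (- (nu * pc)) <= Rpower (u x) q).
  { intros x Hx.
    assert (Hx0 : 0 < x) by lra.
    assert (Hf := Hflux de u x Hde (Rlt_le _ _ Hr0rho) Hps Hx).
    assert (Hp := positive_decay d x u Hd Hps Hu Hx0).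
    assert (Hcd : 0 < cW * Rpower de al) by (apply Rmult_lt_0_compat; [exact HcW|apply exp_pos]).
    assert (Hp' : Rpower (cW * Rpower de al) be * Rpower x (- ls) / ls <= u x).
    { eapply Rle_trans; [|exact Hp]. apply Rmult_le_compat_r; [apply Rlt_le, Rinv_0_lt_compat, Hls|].
      apply Rmult_le_compat_r; [apply Rlt_le, exp_pos|]. apply Rpower_le_base; lra. }
    assert (Hcl : 0 < Rpower cW be / ls) by (apply Rdiv_lt_0_compat; [apply exp_pos|exact Hls]).
    apply Rle_trans with (Rpower (Rpower (cW * Rpower de al) be * Rpower x (- ls) / ls) q).
    - apply Req_le.
      rewrite <- Rpower_mult_distr by (try apply exp_pos; exact HcW).
      replace (Rpower cW be * Rpower (Rpower de al) be * Rpower x (- ls) / ls)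
        with (Rpower cW be / ls * (Rpower (Rpower de al) be * Rpower x (- ls))) by (field; lra).
      rewrite <- Rpower_mult_distr; [|exact Hcl|apply Rmult_lt_0_compat; apply exp_pos].
      rewrite <- Rpower_mult_distr by apply exp_pos.
      rewrite !Rpower_mult. unfold c3.
      replace (al * (be * q)) with (nu * be) by exponents.
      replace (- ls * q) with (- (nu * pc)) by exponents.
      ring.
    - apply Rpower_le_base; [lra|]. split; [|exact Hp'].
      apply Rdiv_lt_0_compat; [|exact Hls]. apply Rmult_lt_0_compat; apply exp_pos. }
  assert (HP0 : 0 <= pohozaev u r0).
  { apply (pohozaev_nonneg d); [exact Hps|lra|]. intros; apply Hu; lra. }
  set (c := c1 * c3 / q * Rpower de (nu * be)).
  assert (Hc : 0 < c).
  { apply Rmult_lt_0_compat; [apply Rdiv_lt_0_compat; [apply Rmult_lt_0_compat|]; lra|apply exp_pos]. }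
  assert (HPlow : c * ln rho - c * ln r0 <= pohozaev u rho - pohozaev u r0).
  { apply (increment_le (fun x => c * ln x) (fun x => c * / x) (pohozaev u)
      (fun r => r ^ n * K' r * Rpower (u r) q / q)).
    - lra.
    - intros x Hx; auto_derive; [lra|ring].
    - intros x Hx; apply (ex_derive_continuous (fun x => c * ln x)); auto_derive; lra.
    - intros x Hx; apply (is_derive_pohozaev d); [exact Hps|lra|apply Hu; lra].
    - intros; apply (continuous_pohozaev d), Hps.
    - intros x Hx.
      assert (Hx0 : 0 < x) by lra.
      (* The powers of x combine to x^(ell - n/(p-1) - 1), which is at least 1/x because ell <=
         n/(p-1) and x <= 1. *)
      apply Rle_trans with (Rpower x nu * (c1 * Rpower x (ell - 1)) *
        (c3 * Rpower de (nu * be) * Rpower x (- (nu * pc))) / q).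
      + replace (Rpower x nu * (c1 * Rpower x (ell - 1)) *
          (c3 * Rpower de (nu * be) * Rpower x (- (nu * pc))) / q)
          with (c * (Rpower x nu * Rpower x (ell - 1) * Rpower x (- (nu * pc)))) by (unfold c; field; lra).
        apply Rmult_le_compat_l; [lra|].
        rewrite <- !Rpower_plus.
        replace (nu + (ell - 1) + - (nu * pc)) with ((ell - nu * be) - 1) by ring.
        rewrite Rpower_minus_1 by exact Hx0.
        rewrite <- (Rmult_1_l (/ x)); apply Rmult_le_compat_r; [apply Rlt_le, Rinv_0_lt_compat, Hx0|].
        replace (ell - nu * be) with (- (nu * be - ell)) by ring.
        destruct (Req_dec (nu * be - ell) 0) as [E|E].
        * rewrite E, Ropp_0, Rpower_O by exact Hx0; lra.
        * apply Rle_trans with (Rpower 1 (- (nu * be - ell))); [rewrite Rpower_1_base; lra|].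
          apply Rpower_anti; lra.
      + apply Rmult_le_compat_r; [apply Rlt_le, Rinv_0_lt_compat; lra|].
        rewrite pow_n_Rpower by exact Hx0.
        apply Rmult_le_compat.
        * apply Rmult_le_pos; [apply Rlt_le, exp_pos|].
          apply Rmult_le_pos; [lra|apply Rlt_le, exp_pos].
        * apply Rmult_le_pos; [apply Rmult_le_pos|]; try apply Rlt_le, exp_pos; lra.
        * apply Rmult_le_compat_l; [apply Rlt_le, exp_pos|]. apply hK'; lra.
        * apply Hulow; lra. }
  assert (HPup : pohozaev u rho <= C4 * Rpower de (nu * be)).
  { assert (Hrho0 : 0 < rho) by lra.
    assert (Hurho := Hu rho ltac:(lra)).
    assert (B := Hbub de u rho Hde (Rlt_le _ _ Hr0rho) Hps ltac:(fold r0; lra) Hurho).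
    assert (Hp := positive_decay d rho u Hd Hps Hu Hrho0).
    assert (Hv := psol_vel_pos d u rho Hd Hps Hrho0).
    unfold pohozaev. rewrite !spow_self_pos by assumption.
    set (F := flux N (source (Rmax 0) u) rho) in *.
    set (v := vel N (source (Rmax 0) u) rho) in *.
    assert (HrN : 0 < rho ^ N) by (apply pow_lt; lra).
    assert (HF : 0 < F).
    { replace F with (v * rho ^ N) by (unfold v, vel; fold F; field; lra).
      apply Rmult_lt_0_compat; assumption. }
    (* The kinetic term of P(rho) equals al F times exactly the lower bound of [positive_decay] for
       u(rho). It is therefore outweighed by the term -al F u(rho), and only the potential term K
       u^q / q is left. *)
    assert (E : rho ^ n * (Rpower v pc / pc) = al * (F * (Rpower F be * Rpower rho (- ls) / ls))).
    { assert (Ev : v = F * Rpower rho (- (nu - 1))).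
      { unfold v, vel; fold F; rewrite Rpower_Ropp, pow_N_Rpower by lra; reflexivity. }
      rewrite Ev, <- Rpower_mult_distr by (try apply exp_pos; exact HF).
      rewrite Rpower_mult, pow_n_Rpower by lra.
      replace (- ls) with (nu + - (nu - 1) * pc) by exponents.
      assert (EF : F * Rpower F be = Rpower F pc).
      { rewrite <- (Rpower_1 F) at 1 by exact HF; rewrite <- Rpower_plus; f_equal; ring. }
      replace (al * (F * (Rpower F be * Rpower rho (nu + - (nu - 1) * pc) / ls)))
        with (al / ls * (F * Rpower F be) * Rpower rho (nu + - (nu - 1) * pc)) by (field; lra).
      rewrite EF, Rpower_plus, <- al_conj_exp. field; split; [|split]; lra. }
    assert (E' : al * (F * (Rpower F be * Rpower rho (- ls) / ls)) <= al * (F * u rho)).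
    { apply Rmult_le_compat_l; [lra|]; apply Rmult_le_compat_l; lra. }
    assert (E'' : rho ^ n * (ext K rho * Rpower (u rho) q / q) <= C4 * Rpower de (nu * be)).
    { replace (C4 * Rpower de (nu * be)) with (rho ^ n * (ext K rho *
        (CB * Rpower de (nu * be) * Rpower rho (- (nu * pc))) / q)) by (unfold C4; field; lra).
      apply Rmult_le_compat_l; [apply pow_le; lra|].
      apply Rmult_le_compat_r; [apply Rlt_le, Rinv_0_lt_compat; lra|].
      apply Rmult_le_compat_l; lra. }
    lra. }
  assert (Hcc : c * (C5 + 1) <= C4 * Rpower de (nu * be)).
  { replace (c * (C5 + 1)) with (c * ln rho - c * ln r0) by (rewrite Hln; ring). lra. }
  assert (c * C5 = C4 * Rpower de (nu * be)) by (unfold c, C5; field; lra).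
  lra.
Qed.

End Expansion.

(** * Shooting *)

Lemma large_data_scale (s d : R) : 0 < s -> Rpower s (- al) < d ->
  0 < Rpower d (- / al) <= s /\ Rpower (Rpower d (- / al)) (- al) = d.
Proof.
  intros Hs Hd; assert (Hal := al_pos); assert (H := Rpower_pos s (- al)).
  split; [split; [apply exp_pos|]|apply Rpower_scale_inv; lra].
  apply Rle_trans with (Rpower (Rpower s (- al)) (- / al)).
  - apply Rpower_anti; [apply Rinv_0_lt_compat, Hal|lra].
  - rewrite Rpower_mult; replace (- al * - / al) with 1 by (field; split; lra).
    rewrite Rpower_1; lra.
Qed.

(** * Positivity for large initial values and existence of a crossing *)

Section LargeData.
Variables (ell rho c1 c2 : R).
Hypotheses (hrho : 0 < rho <= 1) (hc1 : 0 < c1)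
  (hK' : forall r, 0 < r <= rho -> c1 * Rpower r (ell - 1) <= K' r <= c2 * Rpower r (ell - 1)).

(** Contrapositive of [first_zero_estimate] in terms of d; the bound s on the scale ensures de <= 1
    and c0 de <= rho. *)
Lemma positive_for_large_data (e M : R) : 0 < e -> e <= ell -> e < nu * be -> rho <= M ->
  exists C s, 0 < C /\ 0 < s /\ forall d u m, Rpower s (- al) < d -> psol d u -> 0 < m <= M ->
    C * Rpower (Rpower d (- / al)) e * Rpower m ls < Rpower (Rpower d (- / al)) ls -> 0 < u m.
Proof.
  intros He Hell Henu HM.
  destruct (half_height rho ltac:(lra)) as [c0 [Hc0 Hhalf]].
  destruct (first_zero_estimate ell rho c1 c2 c0 hrho hc1 hK' Hc0 Hhalf e M He Hell Henu HM)
    as [C [HC Hest]].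
  assert (Hs : 0 < Rmin 1 (rho / c0)) by (apply Rmin_pos; [lra|apply Rdiv_lt_0_compat; lra]).
  exists C, (Rmin 1 (rho / c0)); split; [exact HC|split; [exact Hs|]].
  intros d u m Hd Hps Hm Hlt.
  destruct (large_data_scale _ d Hs Hd) as [[Hde1 Hde2] Hdd].
  set (de := Rpower d (- / al)) in *.
  apply Rnot_le_lt; intros Hle.
  rewrite <- Hdd in Hps.
  assert (Hr : c0 * de <= rho).
  { assert (H : de <= rho / c0) by (eapply Rle_trans; [exact Hde2|apply Rmin_r]).
    apply (Rmult_le_compat_l c0) in H; [|lra].
    replace (c0 * (rho / c0)) with rho in H by (field; lra). exact H. }
  assert (H1 : de <= 1) by (eapply Rle_trans; [exact Hde2|apply Rmin_l]).
  specialize (Hest de u m ltac:(lra) Hr Hps Hm Hle). lra.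
Qed.

(** With e = ls the factor de^ls cancels and the condition becomes C m^ls < 1, which does not
    involve d. X is the radius with C X^ls = 1/2. *)
Lemma positive_for_large_data_critical : ell = ls ->
  exists m D, 0 < m /\ forall d u, D < d -> psol d u -> 0 < u m.
Proof.
  intros Hell.
  assert (Hls := ls_pos). assert (Hlt := ls_lt).
  destruct (positive_for_large_data ls rho ltac:(lra) ltac:(lra) Hlt ltac:(lra)) as (C & s & HC & Hs & H).
  set (X := Rpower (/ (2 * C)) (/ ls)).
  assert (HX : 0 < X) by apply exp_pos.
  set (m := Rmin rho X).
  assert (Hm : 0 < m) by (apply Rmin_pos; lra).
  exists m, (Rpower s (- al)); split; [exact Hm|].
  intros d u Hd Hps; apply (H d u m Hd Hps).
  - split; [exact Hm|apply Rmin_l].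
  - assert (Hmls : Rpower m ls <= / (2 * C)).
    { apply Rle_trans with (Rpower X ls); [apply Rpower_le_base; [lra|split; [exact Hm|apply Rmin_r]]|].
      unfold X; rewrite Rpower_mult, Rinv_l, Rpower_1; [lra| |lra].
      apply Rinv_0_lt_compat; lra. }
    set (Y := Rpower (Rpower d (- / al)) ls). assert (HY : 0 < Y) by apply exp_pos.
    assert (C * Y * Rpower m ls <= C * Y * / (2 * C)).
    { apply Rmult_le_compat_l; [apply Rmult_le_pos; lra|exact Hmls]. }
    replace (C * Y * / (2 * C)) with (Y / 2) in * by (field; lra). lra.
Qed.

(** The midpoint e of ls and ell lies strictly below n/(p-1) even if ell does not, and e > ls makes
    C de^(e-ls) M'^ls small for large d, whatever the radius. *)
Lemma positive_for_large_data_supercritical : ls < ell <= nu * be ->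
  forall M, 0 < M -> exists D, forall d u, D < d -> psol d u -> 0 < u M.
Proof.
  intros Hell M HM.
  assert (Hls := ls_pos). assert (Hal := al_pos).
  set (e := (ls + ell) / 2).
  set (M' := Rmax M rho).
  assert (HM' : M <= M') by apply Rmax_l.
  destruct (positive_for_large_data e M') as (C & s & HC & Hs & H);
    [unfold e; lra|unfold e; lra|unfold e; lra|apply Rmax_r|].
  set (X := / (2 * C * Rpower M' ls)).
  assert (HX : 0 < X).
  { apply Rinv_0_lt_compat; apply Rmult_lt_0_compat; [lra|apply exp_pos]. }
  set (s' := Rmin s (Rpower X (/ (e - ls)))).
  assert (Hs' : 0 < s') by (apply Rmin_pos; [exact Hs|apply exp_pos]).
  exists (Rpower s' (- al)); intros d u Hd Hps.
  apply Rlt_le_trans with (u M'); [|apply (psol_decr d); [exact Hps|lra]].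
  destruct (large_data_scale s' d Hs' Hd) as [[Hde1 Hde2] Hdd].
  apply (H d u M'); [|exact Hps|lra|].
  - apply Rle_lt_trans with (Rpower s' (- al)); [|exact Hd].
    apply Rpower_anti; [exact Hal|]. split; [exact Hs'|apply Rmin_l].
  - set (de := Rpower d (- / al)) in *.
    assert (Hd' : Rpower de (e - ls) <= X).
    { apply Rle_trans with (Rpower (Rpower X (/ (e - ls))) (e - ls)).
      - apply Rpower_le_base; [unfold e; lra|]. split; [exact Hde1|].
        eapply Rle_trans; [exact Hde2|apply Rmin_r].
      - rewrite Rpower_mult, Rinv_l, Rpower_1; [lra|exact HX|unfold e; lra]. }
    assert (HMl := Rpower_pos M' ls). assert (Hdl := Rpower_pos de ls).
    replace (Rpower de e) with (Rpower de ls * Rpower de (e - ls))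
      by (rewrite <- Rpower_plus; f_equal; ring).
    assert (Hle : Rpower de (e - ls) * (C * Rpower M' ls) <= X * (C * Rpower M' ls)).
    { apply Rmult_le_compat_r; [apply Rmult_le_pos; lra|exact Hd']. }
    replace (X * (C * Rpower M' ls)) with (/ 2) in Hle by (unfold X; field; lra).
    nra.
Qed.

Lemma crossing_exists_expansion : ell <= nu * be ->
  exists d u r, 0 < d /\ psol d u /\ 0 < r /\ u r <= 0.
Proof.
  intros Hell.
  destruct (half_height rho ltac:(lra)) as [c0 [Hc0 Hhalf]].
  apply (crossing_exists ell rho c1 c2 c0 hrho hc1 hK' Hc0 Hhalf Hell).
Qed.

End LargeData.

Lemma shooting_ivt (rad d1 d2 : R) (u1 u2 : R -> R) : 0 < rad -> d1 < d2 ->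
  psol d1 u1 -> psol d2 u2 -> u1 rad * u2 rad < 0 ->
  exists d v, d1 < d < d2 /\ psol d v /\ v rad = 0.
Proof.
  intros Hrad Hd12 P1 P2 Hsign.
  (* A solution is chosen for every real d, so that d |-> u(rad; d) is a function continuous on R,
     as the intermediate value theorem asks; [uniq] makes its values independent of the choice. *)
  destruct (IndefiniteDescription.functional_choice _ psol_exists) as [U HU].
  assert (close : forall D, 0 < D -> exists C, 0 < C /\ forall d d' u u', d <= D -> d' <= D ->
    psol d u -> psol d' u' -> Rabs (u rad - u' rad) <= C * Rabs (d - d')).
  { intros D HD; destruct (psol_continuous_data D rad HD Hrad) as [C [HC H]].
    exists C; split; [exact HC|]; intros d d' u u' H1 H2 Q1 Q2; apply (H d d' u u'); auto; lra. }
  assert (uniq : forall d u, psol d u -> U d rad = u rad).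
  { intros d u Hu; assert (HD := Rabs_pos d).
    destruct (close (Rabs d + 1) ltac:(lra)) as [C [HC H]].
    assert (Hle := Rle_abs d).
    specialize (H d d (U d) u ltac:(lra) ltac:(lra) (HU d) Hu).
    rewrite Rminus_diag, Rabs_R0, Rmult_0_r in H.
    apply Rminus_diag_uniq; destruct (Req_dec (U d rad - u rad) 0) as [E|E]; [exact E|].
    assert (H' := Rabs_pos (U d rad - u rad)); apply Rabs_no_R0 in E; lra. }
  assert (CU : continuity (fun d => U d rad)).
  { intros d; apply continuity_pt_filterlim, filterlim_locally; intros eps.
    assert (HD := Rabs_pos d). assert (Hle := Rle_abs d).
    destruct (close (Rabs d + 1) ltac:(lra)) as [C [HC H]].
    assert (Hm : 0 < Rmin 1 (eps / C)).
    { apply Rmin_pos; [lra|apply Rdiv_lt_0_compat; [apply cond_pos|exact HC]]. }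
    exists (mkposreal _ Hm); intros y Hy; change (Rabs (y - d) < Rmin 1 (eps / C)) in Hy.
    change (Rabs (U y rad - U d rad) < eps).
    assert (Hy1 : Rabs (y - d) < 1) by (eapply Rlt_le_trans; [exact Hy|apply Rmin_l]).
    assert (Hy2 : Rabs (y - d) < eps / C) by (eapply Rlt_le_trans; [exact Hy|apply Rmin_r]).
    apply Rle_lt_trans with (C * Rabs (y - d)).
    - apply Rabs_def2 in Hy1; apply (H y d (U y) (U d)); [lra|lra|apply HU|apply HU].
    - apply (Rmult_lt_compat_l C) in Hy2; [|exact HC].
      replace (C * (eps / C)) with (pos eps) in Hy2 by (field; lra). exact Hy2. }
  rewrite <- (uniq d1 u1 P1), <- (uniq d2 u2 P2) in Hsign.
  destruct (IVT_gen (fun d => U d rad) d1 d2 0 CU) as [d [Hd E]].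
  - unfold Rmin, Rmax; destruct (Rle_dec (U d1 rad) (U d2 rad)); nra.
  - rewrite Rmin_left, Rmax_right in Hd by lra.
    exists d, (U d); split; [|split; [apply HU|exact E]].
    split; [destruct (Req_dec d d1) as [->|]|destruct (Req_dec d d2) as [->|]]; try lra;
      rewrite E in Hsign; lra.
Qed.

(** Positivity on [0, rad) need not be recorded: with d > 0 the function u is strictly decreasing on
    the half-line, so [rad] is its only zero there. *)
Definition zero_radius (rad : R) : Prop :=
  0 < rad /\ exists d u, 0 < d /\ psol d u /\ u rad = 0.

Lemma zero_radius_admits_one (rad : R) : zero_radius rad -> admits_one n p K rad.
Proof.
  intros [Hrad (d & u & Hd & Hps & Hz)].
  destruct (psol_radial_solution rad d u Hrad Hd Hps Hz) as [w [Hw _]].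
  exists w; exact Hw.
Qed.

Lemma admits_one_zero_radius (rad : R) : 0 < rad -> admits_one n p K rad -> zero_radius rad.
Proof.
  intros Hrad [u Hu]; destruct (radial_solution_psol rad u Hrad Hu) as (d & v & H).
  split; [exact Hrad|exists d, v; exact H].
Qed.

Lemma nonpos_zero_radius (d r : R) (u : R -> R) : 0 < d -> psol d u -> 0 < r -> u r <= 0 ->
  exists s, s <= r /\ zero_radius s.
Proof.
  intros Hd Hps Hr Hle.
  destruct (first_zero u r) as [s [Hs [Hs0 _]]]; [lra|apply Hps| |exact Hle|].
  - rewrite (psol_0 d u Hps); exact Hd.
  - exists s; split; [lra|split; [lra|exists d, u; auto]].
Qed.

(** Solutions with small initial value are positive at [rad], so the value at [rad] changes sign
    below d. *)
Lemma zero_below (d rad : R) (u : R -> R) : 0 < rad -> 0 < d -> psol d u -> u rad < 0 ->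
  exists d' v, 0 < d' < d /\ psol d' v /\ v rad = 0.
Proof.
  intros Hrad Hd Hps Hneg.
  destruct (positive_for_small_data rad Hrad) as [eta [Heta Hpos]].
  set (d1 := Rmin eta (d / 2)).
  assert (Hd1 : 0 < d1) by (apply Rmin_pos; lra).
  assert (Hd1e : d1 <= eta) by apply Rmin_l. assert (Hd1d : d1 <= d / 2) by apply Rmin_r.
  destruct (psol_exists d1) as [w Hw].
  assert (Hwp := Hpos d1 w ltac:(lra) Hw).
  destruct (shooting_ivt rad d1 d w u Hrad ltac:(lra) Hw Hps ltac:(nra)) as (d' & v & Hd' & Hv & Hz).
  exists d', v; split; [lra|auto].
Qed.

Lemma zero_radius_up (rad rad' : R) : zero_radius rad -> rad < rad' -> zero_radius rad'.
Proof.
  intros [Hrad (d & u & Hd & Hps & Hz)] Hlt.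
  assert (Hneg : u rad' < 0) by (rewrite <- Hz; apply (psol_decr_strict d); auto; lra).
  destruct (zero_below d rad' u ltac:(lra) Hd Hps Hneg) as (d' & v & Hd' & Hv & Hz').
  split; [lra|exists d', v; split; [lra|auto]].
Qed.

(** Zero radii exist by the crossing solution and form an upward closed set. They stay away from 0:
    past m for d > D, and past a common m1 for the remaining d. *)
Lemma threshold_exists (m D : R) :
  (exists d u r, 0 < d /\ psol d u /\ 0 < r /\ u r <= 0) ->
  0 < m -> (forall d u, D < d -> psol d u -> 0 < u m) ->
  exists R0, 0 < R0 /\ (forall rad, zero_radius rad -> R0 <= rad) /\
    (forall rad, R0 < rad -> zero_radius rad).
Proof.
  intros (d0 & u0 & r0 & Hd0 & Hps0 & Hr0 & Hle0) Hm Hlarge.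
  set (D1 := Rmax 1 D).
  assert (HD1 : 1 <= D1) by apply Rmax_l. assert (HD1D : D <= D1) by apply Rmax_r.
  destruct (positive_near_origin D1 ltac:(lra)) as [m1 [Hm1 Hnear]].
  set (m2 := Rmin m m1).
  assert (Hm2 : 0 < m2) by (apply Rmin_pos; assumption).
  assert (Hm2m : m2 <= m) by apply Rmin_l. assert (Hm2m1 : m2 <= m1) by apply Rmin_r.
  destruct (nonpos_zero_radius d0 r0 u0 Hd0 Hps0 Hr0 Hle0) as [s [_ Hs]].
  (* The infimum of the zero radii, obtained as the supremum of their lower bounds. *)
  set (E := fun x => forall rad, zero_radius rad -> x <= rad).
  assert (Em2 : E m2).
  { intros rad [Hrad (d & u & Hd & Hps & Hz)]; apply Rnot_lt_le; intros Hlt.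
    destruct (Rle_dec d D1) as [H|H].
    - assert (H1 := Hnear d u ltac:(lra) Hps).
      assert (H2 := psol_decr d u rad m1 Hps ltac:(lra)). lra.
    - assert (H1 := Hlarge d u ltac:(lra) Hps).
      assert (H2 := psol_decr d u rad m Hps ltac:(lra)). lra. }
  destruct (completeness E) as [R0 [Hub Hlub]].
  { exists s; intros x Hx; apply Hx, Hs. }
  { exists m2; exact Em2. }
  exists R0; split; [|split].
  - apply Rlt_le_trans with m2; [exact Hm2|apply Hub, Em2].
  - intros rad Hrad; apply Hlub; intros x Hx; apply Hx, Hrad.
  - intros rad Hrad.
    destruct (Classical_Prop.classic (exists t, zero_radius t /\ t < rad)) as [[t [Ht1 Ht2]]|H].
    + apply (zero_radius_up t rad Ht1 Ht2).
    + assert (Er : E rad).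
      { intros t Ht; apply Rnot_lt_le; intros Hlt; apply H; exists t; auto. }
      apply Hub in Er; lra.
Qed.

(** Otherwise u(R0; d) > 0 for all d > 0. Solutions with a zero before R0 + 1 have d in a compact
    interval [eta, D], where u(R0; d) has a positive minimum mu; a zero just beyond R0 contradicts
    this by the uniform slope bound. *)
Lemma threshold_attained (R0 : R) : 0 < R0 ->
  (forall M, 0 < M -> exists D, forall d u, D < d -> psol d u -> 0 < u M) ->
  (forall rad, zero_radius rad -> R0 <= rad) -> (forall rad, R0 < rad -> zero_radius rad) ->
  zero_radius R0.
Proof.
  intros HR0 Hlarge Hlow Hup.
  destruct (Classical_Prop.classic (zero_radius R0)) as [H|Hn]; [exact H|exfalso].
  assert (Hpos : forall d u, 0 < d -> psol d u -> 0 < u R0).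
  { intros d u Hd Hps; apply Rnot_le_lt; intros Hle.
    destruct (nonpos_zero_radius d R0 u Hd Hps HR0 Hle) as [s [Hs Hz]].
    apply Hn; replace R0 with s; [exact Hz|]. apply Hlow in Hz; lra. }
  set (M := R0 + 1).
  destruct (positive_for_small_data M ltac:(unfold M; lra)) as [eta [Heta Hsmall]].
  destruct (Hlarge M ltac:(unfold M; lra)) as [D0 HD0].
  set (D := Rmax eta D0).
  assert (HDe : eta <= D) by apply Rmax_l. assert (HDD : D0 <= D) by apply Rmax_r.
  destruct (IndefiniteDescription.functional_choice _ psol_exists) as [U HU].
  destruct (psol_continuous_data (D + 1) R0 ltac:(lra) HR0) as [C [HC Hcont]].
  destruct (psol_lipschitz (D + 1) M ltac:(lra) ltac:(unfold M; lra)) as [L [HL Hlip]].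
  destruct (continuity_ab_min (fun d => U d R0) eta D HDe) as [dm [Hmin Hdm]].
  { intros d Hd; apply continuity_pt_filterlim, filterlim_locally; intros eps.
    assert (Hm : 0 < Rmin 1 (eps / C)).
    { apply Rmin_pos; [lra|apply Rdiv_lt_0_compat; [apply cond_pos|exact HC]]. }
    exists (mkposreal _ Hm); intros y Hy; change (Rabs (y - d) < Rmin 1 (eps / C)) in Hy.
    change (Rabs (U y R0 - U d R0) < eps).
    assert (Hy1 : Rabs (y - d) < 1) by (eapply Rlt_le_trans; [exact Hy|apply Rmin_l]).
    assert (Hy2 : Rabs (y - d) < eps / C) by (eapply Rlt_le_trans; [exact Hy|apply Rmin_r]).
    apply Rle_lt_trans with (C * Rabs (y - d)).
    - apply Rabs_def2 in Hy1; apply (Hcont y d (U y) (U d)); [lra|lra|apply HU|apply HU|lra].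
    - apply (Rmult_lt_compat_l C) in Hy2; [|exact HC].
      replace (C * (eps / C)) with (pos eps) in Hy2 by (field; lra). exact Hy2. }
  set (mu := U dm R0) in *.
  assert (Hmu : 0 < mu) by (apply (Hpos dm); [lra|apply HU]).
  (* Small enough that a solution of slope at most L vanishing at R0 + eps is at most mu/2 at R0. *)
  set (eps := Rmin 1 (mu / (2 * L))).
  assert (Heps : 0 < eps) by (apply Rmin_pos; [lra|apply Rdiv_lt_0_compat; lra]).
  assert (Heps1 : eps <= 1) by apply Rmin_l.
  assert (HepsL : L * eps <= mu / 2).
  { apply Rle_trans with (L * (mu / (2 * L))).
    - apply Rmult_le_compat_l; [lra|apply Rmin_r].
    - apply Req_le; field; lra. }
  destruct (Hup (R0 + eps) ltac:(lra)) as [_ (d & u & Hd & Hps & Hz)].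
  assert (HuM : u M <= 0) by (rewrite <- Hz; apply (psol_decr d); [exact Hps|unfold M; lra]).
  assert (Hde : eta <= d).
  { apply Rnot_lt_le; intros H; specialize (Hsmall d u ltac:(lra) Hps); lra. }
  assert (HdD : d <= D).
  { apply Rnot_lt_le; intros H; specialize (HD0 d u ltac:(lra) Hps); lra. }
  assert (HuR : u R0 - u (R0 + eps) <= L * (R0 + eps - R0)).
  { apply (Hlip d); [lra|exact Hps|lra|unfold M; lra]. }
  assert (HUu : Rabs (u R0 - U d R0) <= C * Rabs (d - d)).
  { apply (Hcont d d); [lra|lra|exact Hps|apply HU|lra]. }
  rewrite Rminus_diag, Rabs_R0, Rmult_0_r in HUu; apply Rabs_le_between in HUu.
  specialize (Hmin d ltac:(lra)). fold mu in Hmin. lra.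
Qed.

(** The solution that vanishes at R0 is negative at [rad], while u(rad; d) is positive for small and
    for large d. This gives one zero on each side of its d, and the two solutions differ at r =
    0. *)
Lemma two_above_threshold (R0 rad : R) :
  (forall M, 0 < M -> exists D, forall d u, D < d -> psol d u -> 0 < u M) ->
  zero_radius R0 -> R0 < rad -> admits_two n p K rad.
Proof.
  intros Hlarge [HR0 (d & u & Hd & Hps & Hz)] Hrad.
  assert (Hneg : u rad < 0) by (rewrite <- Hz; apply (psol_decr_strict d); auto; lra).
  destruct (zero_below d rad u ltac:(lra) Hd Hps Hneg) as (d1 & v1 & Hd1 & Hv1 & Hz1).
  destruct (Hlarge rad ltac:(lra)) as [D HD].
  set (d3 := Rmax d D + 1).
  assert (Hd3d : d < d3) by (unfold d3; assert (H := Rmax_l d D); lra).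
  assert (Hd3D : D < d3) by (unfold d3; assert (H := Rmax_r d D); lra).
  destruct (psol_exists d3) as [w Hw].
  assert (Hwp := HD d3 w Hd3D Hw).
  destruct (shooting_ivt rad d d3 u w ltac:(lra) Hd3d Hps Hw ltac:(nra)) as (d2 & v2 & Hd2 & Hv2 & Hz2).
  destruct (psol_radial_solution rad d1 v1 ltac:(lra) ltac:(lra) Hv1 Hz1) as [w1 [Hw1 E1]].
  destruct (psol_radial_solution rad d2 v2 ltac:(lra) ltac:(lra) Hv2 Hz2) as [w2 [Hw2 E2]].
  exists w1, w2; split; [exact Hw1|split; [exact Hw2|]].
  exists 0; split; [lra|]. rewrite E1, E2; lra.
Qed.

End Radial.

(** K' = B ell r^(ell-1) + h', and the limit hypothesis makes r |h'| less than half of B ell r^ell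
    near 0; hence the factors 1/2 and 3/2. *)
Lemma expansion_derivative (A B ell : R) (K K' h : R -> R) : 0 < B -> 0 < ell ->
  (forall r, 0 < r -> is_derive K r (K' r)) ->
  (forall r, 0 < r -> K r = A + B * Rpower r ell + h r) ->
  filterlim (fun r => (Rabs (h r) + r * Rabs (Derive h r)) / Rpower r ell) (at_right 0) (locally 0) ->
  exists rho, 0 < rho <= 1 /\ forall r, 0 < r <= rho ->
    B * ell / 2 * Rpower r (ell - 1) <= K' r <= 3 / 2 * (B * ell) * Rpower r (ell - 1).
Proof.
  intros HB Hell dK HK hh.
  assert (HBl : 0 < B * ell / 2) by (apply Rdiv_lt_0_compat; [apply Rmult_lt_0_compat|]; lra).
  destruct (hh (ball 0 (mkposreal _ HBl)) (locally_ball _ _)) as [e He].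
  assert (He0 := cond_pos e).
  set (rho := Rmin 1 (e / 2)).
  assert (Hrho : 0 < rho) by (apply Rmin_pos; lra).
  assert (Hrho1 : rho <= 1) by apply Rmin_l. assert (Hrhoe : rho <= e / 2) by apply Rmin_r.
  exists rho; split; [lra|].
  intros r Hr.
  (* h is differentiable as the difference of K and the explicit part, so [Derive h] in the limit
     hypothesis is its true derivative and no default value. *)
  assert (dh : is_derive h r (K' r - B * (ell * Rpower r (ell - 1)))).
  { apply is_derive_ext_loc with (fun r => K r - (A + B * Rpower r ell)).
    - exists (mkposreal r (proj1 Hr)); intros y Hy; change (Rabs (y - r) < r) in Hy.
      apply Rabs_def2 in Hy; rewrite HK by lra; simpl; ring.
    - apply (is_derive_minus K (fun r => A + B * Rpower r ell)); [apply dK; lra|].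
      replace (B * (ell * Rpower r (ell - 1))) with (0 + B * (ell * Rpower r (ell - 1))) by ring.
      apply (is_derive_plus (fun _ => A) (fun r => B * Rpower r ell)); [apply (is_derive_const A)|].
      apply (is_derive_scal (fun r => Rpower r ell)), is_derive_Rpower; lra. }
  assert (Hb : Rabs ((Rabs (h r) + r * Rabs (Derive h r)) / Rpower r ell - 0) < B * ell / 2).
  { apply He; [|lra]; change (Rabs (r - 0) < e); rewrite Rabs_pos_eq; lra. }
  rewrite (is_derive_unique h r _ dh), Rminus_0_r in Hb.
  set (x := K' r - B * (ell * Rpower r (ell - 1))) in *.
  assert (Hp := Rpower_pos r ell).
  assert (Hx := Rabs_pos x). assert (Hhr := Rabs_pos (h r)).
  rewrite Rabs_pos_eq in Hb.
  2:{ apply Rmult_le_pos; [|apply Rlt_le, Rinv_0_lt_compat, Hp].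
      assert (0 <= r * Rabs x) by (apply Rmult_le_pos; lra). lra. }
  apply (Rmult_lt_compat_r (Rpower r ell)) in Hb; [|exact Hp].
  unfold Rdiv at 1 in Hb; rewrite Rmult_assoc, Rinv_l, Rmult_1_r in Hb by lra.
  assert (Er : Rpower r ell = r * Rpower r (ell - 1)).
  { rewrite Rpower_minus_1 by lra; field; lra. }
  rewrite Er in Hb.
  assert (Hx' : r * Rabs x <= r * (B * ell / 2 * Rpower r (ell - 1))) by lra.
  apply Rmult_le_reg_l in Hx'; [|lra].
  apply Rabs_le_between in Hx'. unfold x in Hx'.
  split; lra.
Qed.

Theorem theorem3 (n : nat) (p : R) (K : R -> R) (A B ell : R) (h : R -> R)
  (hn : (0 < n)%nat)
  (hp1 : 1 < p) (hpn : p < INR n)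
  (hp_low : 2 * INR n / (INR n + 2) <= p) (hp2 : p <= 2)
  (hKpos : forall r : R, 0 <= r -> 0 < K r)
  (hKC1 : C1_halfline K)
  (hA : 0 < A) (hB : 0 < B)
  (hell_low : ell_star n p <= ell) (hell_up : ell <= INR n / (p - 1))
  (hKexp : forall r : R, 0 < r -> K r = A + B * Rpower r ell + h r)
  (hh : filterlim
          (fun r : R => (Rabs (h r) + r * Rabs (Derive h r)) / Rpower r ell)
          (at_right 0) (locally 0))
  (hab :
     (uniform_continuity (fun t : R => K (exp t)) (fun t : R => 0 <= t) /\
      exists Klow Kup : R, 0 < Klow /\ Klow < Kup /\
        forall r : R, 0 < r -> Klow < K r < Kup)
     \/
     (exists rho1 : R, 0 < rho1 /\
        forall r : R, rho1 <= r -> K rho1 <= K r)) :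
  (ell = ell_star n p ->
     exists R0 : R, 0 < R0 /\
       (forall rad : R, 0 < rad < R0 -> ~ admits_one n p K rad) /\
       (forall rad : R, R0 < rad -> admits_one n p K rad))
  /\
  (ell_star n p < ell ->
     exists R0 : R, 0 < R0 /\
       (forall rad : R, 0 < rad < R0 -> ~ admits_one n p K rad) /\
       admits_one n p K R0 /\
       (forall rad : R, R0 < rad -> admits_two n p K rad)).
Proof.
  destruct (C1_halfline_ext K hKC1) as (K' & dK & cK & cK').
  assert (Hls : 0 < ell_star n p) by (apply ls_pos; assumption).
  destruct (expansion_derivative A B ell K K' h hB ltac:(lra) dK hKexp hh) as (rho & Hrho & HK').
  assert (Hc1 : 0 < B * ell / 2) by (apply Rdiv_lt_0_compat; [apply Rmult_lt_0_compat|]; lra).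
  assert (Hup : ell <= INR n * (conj_exp p - 1)).
  { replace (INR n * (conj_exp p - 1)) with (INR n / (p - 1)) by (unfold conj_exp; field; lra).
    exact hell_up. }
  assert (Hcross : exists d u r, 0 < d /\ psol n p K d u /\ 0 < r /\ u r <= 0).
  { eapply crossing_exists_expansion; eassumption. }
  assert (Hnot : forall R0, (forall rad, zero_radius n p K rad -> R0 <= rad) ->
    forall rad, 0 < rad < R0 -> ~ admits_one n p K rad).
  { intros R0 H rad Hrad Hone.
    assert (Hz : zero_radius n p K rad) by (eapply admits_one_zero_radius; eauto; lra).
    apply H in Hz; lra. }
  split.
  - intros Hell.
    assert (Hlarge : exists m D, 0 < m /\ forall d u, D < d -> psol n p K d u -> 0 < u m).
    { eapply positive_for_large_data_critical; eassumption. }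
    destruct Hlarge as (m & D & Hm & Hlarge).
    assert (HR : exists R0, 0 < R0 /\ (forall rad, zero_radius n p K rad -> R0 <= rad) /\
      (forall rad, R0 < rad -> zero_radius n p K rad)).
    { eapply threshold_exists; eassumption. }
    destruct HR as (R0 & HR0 & Hlow & Habove).
    exists R0; split; [exact HR0|split; [apply Hnot, Hlow|]].
    intros rad Hrad; eapply zero_radius_admits_one; eauto.
  - intros Hell.
    assert (Hlarge : forall M, 0 < M -> exists D, forall d u, D < d -> psol n p K d u -> 0 < u M).
    { eapply positive_for_large_data_supercritical; try eassumption. split; assumption. }
    (* The threshold needs positivity at one radius only, and 1 is an arbitrary choice. *)
    destruct (Hlarge 1 ltac:(lra)) as [D HD].
    assert (HR : exists R0, 0 < R0 /\ (forall rad, zero_radius n p K rad -> R0 <= rad) /\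
      (forall rad, R0 < rad -> zero_radius n p K rad)).
    { eapply threshold_exists with (m := 1) (D := D); try eassumption; lra. }
    destruct HR as (R0 & HR0 & Hlow & Habove).
    assert (Hatt : zero_radius n p K R0) by (eapply threshold_attained; eassumption).
    exists R0; split; [exact HR0|split; [apply Hnot, Hlow|split]].
    + eapply zero_radius_admits_one; eauto.
    + intros rad Hrad; eapply two_above_threshold; eauto.
Qed.
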